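(* Let $p, q, r$ be pairwise distinct primes and let $n = p^2qr$. Then Fuglede's conjecture holds for $\mathbb{Z}_n$: a nonempty subset $S \subseteq \mathbb{Z}_n$ is spectral if and only if it is a tile of $\mathbb{Z}_n$.
   Context: $\mathbb{Z}_n$ denotes the cyclic group of order $n$ (integers modulo $n$). Its characters are $\chi_k(x) = e^{2\pi i k x/n}$ for $k \in \mathbb{Z}_n$. A nonempty subset $S \subseteq \mathbb{Z}_n$ is called spectral if the vector space of complex-valued functions on $S$ is spanned by pairwise orthogonal functions that are restrictions to $S$ of characters of $\mathbb{Z}_n$. Equivalently, there is a set $\Lambda \subseteq \mathbb{Z}_n$ with $|\Lambda| = |S|$ such that $\sum_{s \in S} \chi_{k-l}(s) = 0$ for all $k \neq l$ in $\Lambda$. A subset $S \subseteq \mathbb{Z}_n$ is called a tile if there is a $T \subseteq \mathbb{Z}_n$ such that $S + T = \mathbb{Z}_n$ and $|S||T| = n$, i.e. every element of $\mathbb{Z}_n$ can be written uniquely as $s+t$ with $s \in S$, $t \in T$. *)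

(* Defs.v *)
From HB Require Import structures.
From mathcomp Require Import all_boot all_order all_algebra.
From mathcomp Require Import complex.
From mathcomp Require Import reals trigo.

Set Implicit Arguments.
Unset Strict Implicit.
Unset Printing Implicit Defensive.

Import Order.TTheory GRing.Theory Num.Theory.
Local Open Scope ring_scope.
Local Open Scope complex_scope.

(* The cyclic group of order n is 'Z_n, so everything below is meaningful for
   1 < n only ('Z_0 and 'Z_1 are copies of 'Z_2). *)

(* exp (2 pi i k x / n), where k and x are the representatives in {0..n-1}. *)
Definition chi (R : realType) (n : nat) (k x : 'Z_n) : R[i] :=
  let t := 2 * pi * (k * x)%N%:R / n%:R in cos t +i* sin t.

(* The space of complex functions on S; the regular module R[i]^o makes it a
   finite-dimensional vector space over R[i]. *)
Notation funs_on R S := {ffun {x | x \in S} -> R[i]^o}.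

Definition chi_on (R : realType) (n : nat) (S : {set 'Z_n}) (k : 'Z_n) :
    funs_on R S :=
  [ffun s => chi R k (val s)].

Definition orthogonal_on (R : realType) (n : nat) (S : {set 'Z_n})
    (f g : funs_on R S) : Prop :=
  \sum_s (f s : R[i]) * conjc (g s) = 0.

Definition spectral (R : realType) (n : nat) (S : {set 'Z_n}) : Prop :=
  exists L : {set 'Z_n},
    (forall k l, k \in L -> l \in L -> k != l ->
       orthogonal_on (chi_on R S k) (chi_on R S l)) /\
    <<[seq chi_on R S k | k <- enum L]>>%VS = fullv.

Definition tile (n : nat) (S : {set 'Z_n}) : Prop :=
  exists T : {set 'Z_n},
    [set s + t | s in S, t in T] = [set: 'Z_n] /\ (#|S| * #|T|)%N = n.

(* Main.v *)
Require Import Defs.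
From mathcomp Require Import all_boot all_order all_algebra reals.
From mathcomp Require Import all_field complex trigo.
From mathcomp Require Import zify ring lra.
Set Implicit Arguments.
Unset Strict Implicit.
Unset Printing Implicit Defensive.
Import Order.TTheory GRing.Theory Num.Theory.

(* Only the orders of the differences of elements of a set and of its spectrum
   matter. By irreducibility of the cyclotomic polynomials, whether the Fourier
   transform of S vanishes at k depends only on gcd(k, n); so in a spectral pair
   (S, L) every difference order occurring in L makes the Fourier transform of S
   vanish at all characters of that order, and conversely. In the coordinates
   (x mod p, (x / p) mod p, x mod q, x mod r) this vanishing is a linear
   identity between the numbers of points of S in coordinate fibres, for
   instance N(b, c) + N(b', c') = N(b, c') + N(b', c), which forces
   N(b, c) = u(b) + v(c) with natural u and v.

   Spectral implies tile: divisibility of #|S| by p, p^2, q and r excludes enough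
   difference orders from S and L, and the fibre identities exclude the others,
   that S tiles with a box, i.e. with a set of all elements having prescribed
   coordinates equal to those of 0.

   Tile implies spectral: if S + T tiles and a prime l does not divide #|S|, then
   l S + T tiles too. Applying this to q and r, on S or on T, shows that the
   Fourier transform of S vanishes at all differences of a box of size #|S|. *)

(** * Counting points in fibres *)

Section SquareRule.
Variables X Y : finType.
Implicit Type F : X -> Y -> nat.

(** Two forces collide throughout. An order present in [L] splits a count of [S] as [u + v], so that
    its total has a form such as [r * U + q * V]; non-divisibility then makes [U] or [V] positive,
    and a positive term fills a whole line of fibres of [S]. An order absent from [S] caps certain
    fibres at one point. A filled line also shows new difference types in [S], hence new vanishing
    for [L], and the roles alternate. The obstacle is [p ^ 2]. A difference whose order has [p]-part
    [p] changes only the second digit, whereas a character of order [p] reads only the first one.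
    Call a class the set of points with a given first digit. When [p] divides the size once, two
    boxes compete, one for each digit; what decides is that equidistribution of both digits would
    give a factor [p ^ 2]. In the converse the primes [q] and [r] divide [n] once, so each can
    dilate one of the two factors; for [p] the box is chosen according to the orders at which the
    complement [T] vanishes. *)

Definition square F :=
  forall x x' y y', F x y + F x' y' = F x y' + F x' y.

(** Normalising at the minimum of the row [x0] keeps [v] natural; later arguments need this, since a
    vanishing sum of naturals has only zero terms. *)
Lemma square_split F (x0 : X) (y0 : Y) : square F ->
  exists u v, forall x y, F x y = u x + v y.
Proof.
move=> sqF; pose y1 := [arg min_(y < y0) F x0 y].
have min1 y : F x0 y1 <= F x0 y.
  by rewrite /y1; case: arg_minnP => // z _ /(_ y isT).
exists (fun x => F x y1), (fun y => F x0 y - F x0 y1) => x y.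
have := sqF x x0 y y1; have := min1 y; lia.
Qed.

Lemma square_sums F (x0 : X) (y0 : Y) : square F ->
  exists u v, [/\ forall x y, F x y = u x + v y,
    forall x, \sum_y F x y = #|Y| * u x + \sum_y v y,
    forall y, \sum_x F x y = \sum_x u x + #|X| * v y &
    \sum_x \sum_y F x y = #|Y| * (\sum_x u x) + #|X| * (\sum_y v y)].
Proof.
move=> /(square_split x0 y0)[u [v uv]]; exists u, v.
have s1 x : \sum_y F x y = #|Y| * u x + \sum_y v y.
  by under eq_bigr do rewrite uv; rewrite big_split /= sum_nat_const.
split=> // [y|].
  by under eq_bigr do rewrite uv; rewrite big_split /= sum_nat_const.
by under eq_bigr do rewrite s1; rewrite big_split /= sum_nat_const -big_distrr.
Qed.

End SquareRule.

Lemma sum_pos (X : finType) (u : X -> nat) : 0 < \sum_x u x -> exists x, 0 < u x.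
Proof.
move=> h; have /forallPn[x] : ~~ [forall x, u x == 0].
  by apply: contraL h => /forallP u0; rewrite big1 // => x _; apply/eqP.
by rewrite -lt0n; exists x.
Qed.

Lemma sum_ge (X : finType) (u : X -> nat) x : u x <= \sum_x u x.
Proof. by rewrite (bigD1 x) //= leq_addr. Qed.

Lemma sum_eq0 (X : finType) (u : X -> nat) : \sum_x u x = 0 -> forall x, u x = 0.
Proof. by move=> h x; have := sum_ge u x; rewrite h; lia. Qed.

Lemma ex_other (X : finType) (x : X) : 1 < #|X| -> exists y, y != x.
Proof.
move=> h; have /card_gt0P[y] : 0 < #|predC1 x| by rewrite cardC1; lia.
by exists y.
Qed.

Definition cnt (X : finType) (S : {set X}) (P : pred X) := #|[set x in S | P x]|.

Section Counting.
Variables (X : finType) (S : {set X}).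
Implicit Types P Q : pred X.

Lemma eq_cnt P Q : P =1 Q -> cnt S P = cnt S Q.
Proof. by move=> PQ; apply: eq_card => x; rewrite !inE PQ. Qed.

Lemma cnt_split (Y : finType) (h : X -> Y) P :
  cnt S P = \sum_y cnt S (fun x => P x && (h x == y)).
Proof.
rewrite /cnt -sum1_card (partition_big h predT) //=; apply: eq_bigr => y _.
by rewrite -sum1_card; apply: eq_bigl => x; rewrite !inE andbA.
Qed.

Lemma cntP P : reflect (exists2 x, x \in S & P x) (0 < cnt S P).
Proof.
apply: (iffP card_gt0P) => [[x]|[x xS Px]]; last by exists x; rewrite inE xS.
by rewrite inE => /andP[]; exists x.
Qed.

Lemma cnt_gt0 P x : x \in S -> P x -> 0 < cnt S P.
Proof. by move=> xS Px; apply/cntP; exists x. Qed.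

Lemma cnt_eq0 P : (forall x, x \in S -> ~~ P x) -> cnt S P = 0.
Proof.
move=> h; apply/eqP; rewrite -leqn0 leqNgt; apply/negP => /cntP[x /h].
by move/negP.
Qed.

Lemma cnt0P P x : cnt S P = 0 -> x \in S -> P x -> False.
Proof. by move=> h xS Px; have := cnt_gt0 xS Px; rewrite h. Qed.

Lemma cnt_le_inj (Y : finType) (h : X -> Y) P :
  (forall x y, x \in S -> y \in S -> P x -> P y -> h x = h y -> x = y) ->
  cnt S P <= #|Y|.
Proof.
move=> inj; rewrite /cnt -(card_in_imset (f := h)) ?max_card // => x y.
by rewrite !inE => /andP[xS Px] /andP[yS Py]; apply: inj.
Qed.

Lemma cnt_le1 P :
  (forall x y, x \in S -> y \in S -> P x -> P y -> x = y) -> cnt S P <= 1.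
Proof.
move=> inj; rewrite -card_unit; apply: (@cnt_le_inj _ (fun=> tt)) => x y *.
exact: inj.
Qed.

Lemma cnt_gt1 P x y : x \in S -> y \in S -> P x -> P y -> x != y -> 1 < cnt S P.
Proof.
move=> xS yS Px Py xy.
have -> : 2 = #|[set x; y]| by rewrite cards2 xy.
by apply/subset_leq_card/subsetP => z; rewrite !inE => /orP[] /eqP->; rewrite ?xS ?yS.
Qed.

Lemma cnt_true : cnt S predT = #|S|.
Proof. by apply: eq_card => x; rewrite !inE andbT. Qed.

Local Open Scope ring_scope.

Lemma cntE (A : pzSemiRingType) P : (cnt S P)%:R = \sum_(x in S) (P x)%:R :> A.
Proof.
rewrite /cnt -sum1_card natr_sum [RHS]big_mkcond [LHS]big_mkcond /=.
by apply: eq_bigr => x _; rewrite !inE; case: (x \in S); case: (P x).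
Qed.

Lemma cnt_lin (k : X -> int) P1 P2 P3 P4 :
  \sum_(x in S) k x = 0 ->
  (forall x, k x = (P1 x)%:R + (P2 x)%:R - (P3 x)%:R - (P4 x)%:R) ->
  (cnt S P1 + cnt S P2 = cnt S P3 + cnt S P4)%N.
Proof.
move=> k0 kE; apply/eqP; rewrite -(eqr_nat int) !natrD !cntE -!big_split /=.
rewrite -subr_eq0 -sumrB -[X in _ == X]k0; apply/eqP/eq_bigr => x _.
by rewrite kE; lia.
Qed.

Lemma cnt_lin2 (k : X -> int) P1 P2 :
  \sum_(x in S) k x = 0 ->
  (forall x, k x = (P1 x)%:R - (P2 x)%:R) -> cnt S P1 = cnt S P2.
Proof.
move=> k0 kE; have := @cnt_lin k P1 pred0 P2 pred0 k0.
have -> : cnt S pred0 = 0%N by apply: cnt_eq0.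
by rewrite !addn0; apply => x; rewrite kE addr0 subr0.
Qed.

Lemma cnt_lin8 (k : X -> int) P1 P2 P3 P4 Q1 Q2 Q3 Q4 :
  \sum_(x in S) k x = 0 ->
  (forall x, k x = ((P1 x)%:R + (P2 x)%:R + (P3 x)%:R + (P4 x)%:R)
     - ((Q1 x)%:R + (Q2 x)%:R + (Q3 x)%:R + (Q4 x)%:R)) ->
  (cnt S P1 + cnt S P2 + cnt S P3 + cnt S P4 =
   cnt S Q1 + cnt S Q2 + cnt S Q3 + cnt S Q4)%N.
Proof.
move=> k0 kE; apply/eqP; rewrite -(eqr_nat int) !natrD !cntE -!big_split /=.
by rewrite -subr_eq0 -sumrB -[X in _ == X]k0; apply/eqP/eq_bigr => x _; rewrite kE.
Qed.

End Counting.

(** * Difference types *)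

Section Types.
Variables (X I J B C : finType).
Variables (ci : X -> I) (cj : X -> J) (cb : X -> B) (cc : X -> C).

(* With ei and ej telling whether two points agree in the first and in the second
   digit modulo p, [p_type t ei ej] says that the p-part of the order of their
   difference is p ^ t; once the first digits differ, the second is irrelevant.
   [s_type] does the same for a prime exactly dividing n. *)
Definition p_type (t : nat) (ei ej : bool) :=
  match t with 0 => ei && ej | 1 => ei && ~~ ej | _ => ~~ ei end.
Definition s_type (t : nat) (e : bool) := if t is 0 then e else ~~ e.

Definition has_type (tp tq tr : nat) x x' :=
  [&& p_type tp (ci x == ci x') (cj x == cj x'),
      s_type tq (cb x == cb x') & s_type tr (cc x == cc x')].

Lemma has_typeE tp tq tr x x' : has_type tp tq tr x x' =
  [&& p_type tp (ci x == ci x') (cj x == cj x'),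
      s_type tq (cb x == cb x') & s_type tr (cc x == cc x')].
Proof. by []. Qed.

Definition D (S : {set X}) tp tq tr :=
  [exists x in S, exists x' in S, has_type tp tq tr x x'].

Implicit Types S L : {set X}.

Lemma noD S tp tq tr x x' :
  ~~ D S tp tq tr -> x \in S -> x' \in S -> ~~ has_type tp tq tr x x'.
Proof.
move=> nD xS x'S; apply: contra nD => h.
by apply/exists_inP; exists x => //; apply/exists_inP; exists x'.
Qed.

Lemma hasD S tp tq tr x x' :
  x \in S -> x' \in S -> has_type tp tq tr x x' -> D S tp tq tr.
Proof.
by move=> xS x'S h; apply/exists_inP; exists x => //; apply/exists_inP; exists x'.
Qed.

Lemma DP S tp tq tr :
  reflect (exists x x', [/\ x \in S, x' \in S & has_type tp tq tr x x'])
          (D S tp tq tr).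
Proof.
apply: (iffP exists_inP) => [[x xS /exists_inP[x' x'S h]]|[x [x' [xS x'S h]]]].
  by exists x, x'.
by exists x => //; apply/exists_inP; exists x'.
Qed.

Local Open Scope ring_scope.

(* Differences of indicators of coordinate fibres; they lie in the span of the
   characters whose order has the given component. *)
Definition p_test (t : nat) i i' j j' x : int :=
  match t with
  | 0%N => 1
  | 1%N => (ci x == i)%:R - (ci x == i')%:R
  | _ => ((ci x == i) && (cj x == j))%:R - ((ci x == i) && (cj x == j'))%:R
  end.
Definition s_test (T : finType) (c : X -> T) (t : nat) b b' x : int :=
  if t is 0%N then 1 else (c x == b)%:R - (c x == b')%:R.

(* The Fourier transform of S vanishes at all characters of order p^tp q^tq r^tr. *)
Definition Z (S : {set X}) (tp tq tr : nat) :=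
  forall i i' j j' b b' c c',
    \sum_(x in S) p_test tp i i' j j' x * s_test cb tq b b' x * s_test cc tr c c' x
    = 0.

(** The excluded type is realised by equal points, and there the transform is the size of the
    set. *)
Definition nontriv (tp tq tr : nat) := [|| tp != 0, tq != 0 | tr != 0]%N.

Definition spair (S L : {set X}) :=
  [/\ #|S| = #|L|,
      forall tp tq tr, nontriv tp tq tr -> D S tp tq tr -> Z L tp tq tr &
      forall tp tq tr, nontriv tp tq tr -> D L tp tq tr -> Z S tp tq tr].

Lemma spair_sym S L : spair S L -> spair L S.
Proof. by case. Qed.

End Types.

Ltac sub2 x y xS yS e1 e2 :=
  move=> x y xS yS /andP[/eqP <- /eqP <-] /andP[/eqP e1 /eqP e2].

(* Decides a goal on the coordinates of x and y from the hypotheses comparing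
   them and from the difference types absent from a set containing both. *)
Ltac ty x y :=
  repeat match goal with
  | H : is_true (~~ D _ _ _ _ _ _ _ _), xS : is_true (x \in ?S),
    yS : is_true (y \in ?S) |- _ => (try move: (noD H xS yS)); clear H
  end;
  repeat match goal with
  | H : ?f x = ?f y |- _ => move/eqP: H
  | H : ?f y = ?f x |- _ => move/esym/eqP: H
  | H : ?f x <> ?f y |- _ => move/eqP: H
  | H : is_true (?f x == ?f y) |- _ => move: H
  | H : is_true (?f y == ?f x) |- _ => rewrite eq_sym in H; move: H
  | H : is_true (?f x != ?f y) |- _ => move: H
  | H : is_true (?f y != ?f x) |- _ => rewrite eq_sym in H; move: H
  end;
  try (match goal with |- context [_ -> ?f x = ?f y] => idtac
       | |- ?f x = ?f y => idtac end; move=> *; apply/eqP);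
  repeat match goal with
  | H : is_true _ |- _ => match type of H with
     context [x] => match type of H with context [y] => move: H end end
  end;
  rewrite /has_type /p_type /s_type /=;
  by do ?(case: (_ == _) => //=).

(* 'Z_(p ^ 2 * q * r) through its residues only, so that exchanging q and r is a
   symmetry. *)
Record coords := Coords {
  cX : finType; cI : finType; cJ : finType; cB : finType; cC : finType;
  fI : cX -> cI; fJ : cX -> cJ; fB : cX -> cB; fC : cX -> cC;
  pn : nat; qn : nat; rn : nat;
  coords_inj : forall x y,
    fI x = fI y -> fJ x = fJ y -> fB x = fB y -> fC x = fC y -> x = y;
  prime_pn : prime pn; prime_qn : prime qn; prime_rn : prime rn;
  neq_pq : pn != qn; neq_pr : pn != rn; neq_qr : qn != rn;
  card_cI : #|cI| = pn; card_cJ : #|cJ| = pn; card_cB : #|cB| = qn; card_cC : #|cC| = rn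
}.

#[local] Hint Resolve prime_pn prime_qn prime_rn neq_pq neq_pr neq_qr : core.

(** * Fibre counts in the four coordinates *)

Section Coordinates.
Variable K : coords.
Local Notation X := (cX K).
Local Notation I := (cI K).
Local Notation J := (cJ K).
Local Notation B := (cB K).
Local Notation C := (cC K).
Local Notation ci := (@fI K).
Local Notation cj := (@fJ K).
Local Notation cb := (@fB K).
Local Notation cc := (@fC K).
Local Notation p := (pn K).
Local Notation q := (qn K).
Local Notation r := (rn K).
Local Notation coord_inj := (@coords_inj K).
Local Notation hp := (prime_pn K).
Local Notation hq := (prime_qn K).
Local Notation hr := (prime_rn K).
Local Notation hpq := (neq_pq K).
Local Notation hpr := (neq_pr K).
Local Notation hqr := (neq_qr K).
Local Notation cardI := (card_cI K).
Local Notation cardJ := (card_cJ K).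
Local Notation cardB := (card_cB K).
Local Notation cardC := (card_cC K).

Local Notation D := (D ci cj cb cc).
Local Notation Z := (Z ci cj cb cc).
Local Notation spair := (spair ci cj cb cc).

Implicit Types S L : {set X}.

Definition nI S i := cnt S (fun x => ci x == i).
Definition nB S b := cnt S (fun x => cb x == b).
Definition nC S c := cnt S (fun x => cc x == c).
Definition nIJ S i j := cnt S (fun x => (ci x == i) && (cj x == j)).
Definition nIB S i b := cnt S (fun x => (ci x == i) && (cb x == b)).
Definition nIC S i c := cnt S (fun x => (ci x == i) && (cc x == c)).
Definition nBC S b c := cnt S (fun x => (cb x == b) && (cc x == c)).
Definition nJB S i j b := cnt S (fun x => [&& ci x == i, cj x == j & cb x == b]).
Definition nJC S i j c := cnt S (fun x => [&& ci x == i, cj x == j & cc x == c]).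
Definition nIBC S i b c := cnt S (fun x => [&& ci x == i, cb x == b & cc x == c]).
Definition nIJBC S i j b c :=
  cnt S (fun x => [&& ci x == i, cj x == j, cb x == b & cc x == c]).

Lemma p_gt1 : 1 < p. Proof. by apply: prime_gt1. Qed.
Lemma q_gt1 : 1 < q. Proof. by apply: prime_gt1. Qed.
Lemma r_gt1 : 1 < r. Proof. by apply: prime_gt1. Qed.

Lemma inhI : exists i : I, true.
Proof. by have /card_gt0P[i _] : 0 < #|I| by [rewrite cardI prime_gt0]; exists i. Qed.
Lemma inhJ : exists i : J, true.
Proof. by have /card_gt0P[i _] : 0 < #|J| by [rewrite cardJ prime_gt0]; exists i. Qed.
Lemma inhB : exists i : B, true.
Proof. by have /card_gt0P[i _] : 0 < #|B| by [rewrite cardB prime_gt0]; exists i. Qed.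
Lemma inhC : exists i : C, true.
Proof. by have /card_gt0P[i _] : 0 < #|C| by [rewrite cardC prime_gt0]; exists i. Qed.

Ltac splitc h := apply: (etrans (cnt_split _ h _)); apply: eq_bigr => ? _; apply: eq_cnt => x;
  rewrite ?andTb; do ?(case: (_ == _) => //=).

Lemma tot_I S : #|S| = \sum_i nI S i.
Proof. by rewrite -cnt_true; splitc (@fI K). Qed.
Lemma tot_B S : #|S| = \sum_b nB S b.
Proof. by rewrite -cnt_true; splitc (@fB K). Qed.
Lemma tot_C S : #|S| = \sum_c nC S c.
Proof. by rewrite -cnt_true; splitc (@fC K). Qed.
Lemma nI_J S i : nI S i = \sum_j nIJ S i j. Proof. by splitc (@fJ K). Qed.
Lemma nI_B S i : nI S i = \sum_b nIB S i b. Proof. by splitc (@fB K). Qed.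
Lemma nI_C S i : nI S i = \sum_c nIC S i c. Proof. by splitc (@fC K). Qed.
Lemma nB_I S b : nB S b = \sum_i nIB S i b. Proof. by splitc (@fI K). Qed.
Lemma nB_C S b : nB S b = \sum_c nBC S b c. Proof. by splitc (@fC K). Qed.
Lemma nC_I S c : nC S c = \sum_i nIC S i c. Proof. by splitc (@fI K). Qed.
Lemma nC_B S c : nC S c = \sum_b nBC S b c. Proof. by splitc (@fB K). Qed.
Lemma nIJ_B S i j : nIJ S i j = \sum_b nJB S i j b. Proof. by splitc (@fB K). Qed.
Lemma nIJ_C S i j : nIJ S i j = \sum_c nJC S i j c. Proof. by splitc (@fC K). Qed.
Lemma nIB_J S i b : nIB S i b = \sum_j nJB S i j b. Proof. by splitc (@fJ K). Qed.
Lemma nIC_J S i c : nIC S i c = \sum_j nJC S i j c. Proof. by splitc (@fJ K). Qed.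
Lemma nBC_I S b c : nBC S b c = \sum_i nIBC S i b c. Proof. by splitc (@fI K). Qed.
Lemma nIB_C S i b : nIB S i b = \sum_c nIBC S i b c. Proof. by splitc (@fC K). Qed.

Lemma tot_BC S : #|S| = \sum_b \sum_c nBC S b c.
Proof. by rewrite tot_B; apply: eq_bigr => b _; apply: nB_C. Qed.
Lemma tot_IB S : #|S| = \sum_i \sum_b nIB S i b.
Proof. by rewrite tot_I; apply: eq_bigr => b _; apply: nI_B. Qed.
Lemma tot_IC S : #|S| = \sum_i \sum_c nIC S i c.
Proof. by rewrite tot_I; apply: eq_bigr => b _; apply: nI_C. Qed.
Lemma nI_JB S i : nI S i = \sum_j \sum_b nJB S i j b.
Proof. by rewrite nI_J; apply: eq_bigr => b _; apply: nIJ_B. Qed.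
Lemma nI_JC S i : nI S i = \sum_j \sum_c nJC S i j c.
Proof. by rewrite nI_J; apply: eq_bigr => b _; apply: nIJ_C. Qed.
Lemma nI_BC S i : nI S i = \sum_b \sum_c nIBC S i b c.
Proof. by rewrite nI_B; apply: eq_bigr => b _; apply: nIB_C. Qed.

(** * Vanishing of the transform as identities between fibre counts *)

Lemma Z100 S : Z S 1 0 0 -> forall i i', nI S i = nI S i'.
Proof.
case: inhJ inhB inhC => j _ [b _] [c _] h i i'.
apply: (cnt_lin2 (h i i' j j b b c c)) => x.
by rewrite /p_test /s_test !mulr1.
Qed.

Lemma Z200 S : Z S 2 0 0 -> forall i j j', nIJ S i j = nIJ S i j'.
Proof.
case: inhJ inhB inhC => j0 _ [b _] [c _] h i j j'.
apply: (cnt_lin2 (h i i j j' b b c c)) => x.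
by rewrite /p_test /s_test !mulr1.
Qed.

Lemma Z010 S : Z S 0 1 0 -> forall b b', nB S b = nB S b'.
Proof.
case: inhI inhJ inhC => i _ [j _] [c _] h b b'.
apply: (cnt_lin2 (h i i j j b b' c c)) => x.
by rewrite /p_test /s_test mulr1 mul1r.
Qed.

Lemma Z001 S : Z S 0 0 1 -> forall c c', nC S c = nC S c'.
Proof.
case: inhI inhJ inhB => i _ [j _] [b _] h c c'.
apply: (cnt_lin2 (h i i j j b b c c')) => x.
by rewrite /p_test /s_test !mul1r.
Qed.

Lemma Z011 S : Z S 0 1 1 -> square (nBC S).
Proof.
case: inhI inhJ => i _ [j _] h b b' c c'.
apply: (cnt_lin (h i i j j b b' c c')) => x.
by rewrite /p_test /s_test mul1r; do ?(case: (_ == _) => //=).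
Qed.

Lemma Z110 S : Z S 1 1 0 -> square (nIB S).
Proof.
case: inhJ inhC => j _ [c _] h i i' b b'.
apply: (cnt_lin (h i i' j j b b' c c)) => x.
by rewrite /p_test /s_test mulr1; do ?(case: (_ == _) => //=).
Qed.

Lemma Z101 S : Z S 1 0 1 -> square (nIC S).
Proof.
case: inhJ inhB => j _ [b _] h i i' c c'.
apply: (cnt_lin (h i i' j j b b c c')) => x.
by rewrite /p_test /s_test mulr1; do ?(case: (_ == _) => //=).
Qed.

Lemma Z210 S : Z S 2 1 0 -> forall i, square (nJB S i).
Proof.
case: inhC => c _ h i j j' b b'.
apply: (cnt_lin (h i i j j' b b' c c)) => x.
by rewrite /p_test /s_test mulr1; do ?(case: (_ == _) => //=).
Qed.

Lemma Z201 S : Z S 2 0 1 -> forall i, square (nJC S i).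
Proof.
case: inhB => b _ h i j j' c c'.
apply: (cnt_lin (h i i j j' b b c c')) => x.
by rewrite /p_test /s_test mulr1; do ?(case: (_ == _) => //=).
Qed.

(** The product of three indicator differences is an alternating sum over the corners of a cube. *)
Lemma Z111 S : Z S 1 1 1 -> forall i i' b b' c c',
  nIBC S i b c + nIBC S i b' c' + nIBC S i' b c' + nIBC S i' b' c =
  nIBC S i' b' c' + nIBC S i' b c + nIBC S i b' c + nIBC S i b c'.
Proof.
case: inhJ => j _ h i i' b b' c c'.
apply: (cnt_lin8 (h i i' j j b b' c c')) => x.
by rewrite /p_test /s_test; do ?(case: (_ == _) => //=).
Qed.

Lemma Z211 S : Z S 2 1 1 -> forall i j j' b b' c c',
  nIJBC S i j b c + nIJBC S i j b' c' + nIJBC S i j' b c' + nIJBC S i j' b' c =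
  nIJBC S i j' b' c' + nIJBC S i j' b c + nIJBC S i j b' c + nIJBC S i j b c'.
Proof.
move=> h i j j' b b' c c'.
apply: (cnt_lin8 (h i i j j' b b' c c')) => x.
by rewrite /p_test /s_test; do ?(case: (_ == _) => //=).
Qed.

(** This is how non-divisibility of a size becomes a filled line: a positive sum has a positive
    term. *)
Lemma nd_pos N a b U V : N = a * U + b * V -> ~~ (b %| N) -> 0 < U.
Proof. by move=> -> h; rewrite lt0n; apply: contraNneq h => ->; rewrite muln0 dvdn_mulr. Qed.

Lemma nd_pos' N a b U V : N = a * U + b * V -> ~~ (a %| N) -> 0 < V.
Proof. by rewrite addnC; apply: nd_pos. Qed.

Lemma Z010_dvd S : Z S 0 1 0 -> q %| #|S|.
Proof.
move=> /Z010 h; case: inhB => b _; rewrite tot_B.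
by under eq_bigr => b' _ do rewrite (h b' b); rewrite sum_nat_const cardB dvdn_mulr.
Qed.

Lemma Z001_dvd S : Z S 0 0 1 -> r %| #|S|.
Proof.
move=> /Z001 h; case: inhC => b _; rewrite tot_C.
by under eq_bigr => b' _ do rewrite (h b' b); rewrite sum_nat_const cardC dvdn_mulr.
Qed.

Lemma Z100E S : Z S 1 0 0 -> forall i, #|S| = p * nI S i.
Proof.
move=> /Z100 h i; rewrite tot_I.
by under eq_bigr => b' _ do rewrite (h b' i); rewrite sum_nat_const cardI.
Qed.

Lemma Z200E S : Z S 2 0 0 -> forall i j, nI S i = p * nIJ S i j.
Proof.
move=> /Z200 h i j; rewrite nI_J.
by under eq_bigr => b' _ do rewrite (h i b' j); rewrite sum_nat_const cardJ.
Qed.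

Lemma Z100_dvd S : Z S 1 0 0 -> p %| #|S|.
Proof. by case: inhI => i _ /Z100E/(_ i)->; rewrite dvdn_mulr. Qed.

Lemma Z200_dvdI S : Z S 2 0 0 -> forall i, p %| nI S i.
Proof. by case: inhJ => j _ /Z200E h i; rewrite (h i j) dvdn_mulr. Qed.

Lemma Z200_dvd S : Z S 2 0 0 -> p %| #|S|.
Proof. by move=> /Z200_dvdI h; rewrite tot_I dvdn_sum. Qed.

Lemma Z12_dvd S : Z S 1 0 0 -> Z S 2 0 0 -> p ^ 2 %| #|S|.
Proof.
by case: inhI => i _ /Z100E h1 /Z200_dvdI h2; rewrite (h1 i) -mulnn dvdn_pmul2l ?prime_gt0.
Qed.

Lemma sq011 S : Z S 0 1 1 -> exists u v, [/\ forall b c, nBC S b c = u b + v c,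
  forall b, nB S b = r * u b + \sum_c v c, forall c, nC S c = \sum_b u b + q * v c &
  #|S| = r * (\sum_b u b) + q * (\sum_c v c)].
Proof.
case: inhB inhC => b0 _ [c0 _] /Z011/(square_sums b0 c0)[u [v [h1 h2 h3 h4]]].
exists u, v; rewrite -cardC -cardB tot_BC -h4.
by split=> // [b|c]; rewrite ?nB_C ?nC_B.
Qed.

Lemma sq110 S : Z S 1 1 0 -> exists u v, [/\ forall i b, nIB S i b = u i + v b,
  forall i, nI S i = q * u i + \sum_b v b, forall b, nB S b = \sum_i u i + p * v b &
  #|S| = q * (\sum_i u i) + p * (\sum_b v b)].
Proof.
case: inhB inhI => b0 _ [c0 _] /Z110/(square_sums c0 b0)[u [v [h1 h2 h3 h4]]].
exists u, v; rewrite -cardI -cardB tot_IB -h4.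
by split=> // [b|c]; rewrite ?nI_B ?nB_I.
Qed.

Lemma sq101 S : Z S 1 0 1 -> exists u v, [/\ forall i c, nIC S i c = u i + v c,
  forall i, nI S i = r * u i + \sum_c v c, forall c, nC S c = \sum_i u i + p * v c &
  #|S| = r * (\sum_i u i) + p * (\sum_c v c)].
Proof.
case: inhC inhI => b0 _ [c0 _] /Z101/(square_sums c0 b0)[u [v [h1 h2 h3 h4]]].
exists u, v; rewrite -cardI -cardC tot_IC -h4.
by split=> // [b|c]; rewrite ?nI_C ?nC_I.
Qed.

Lemma sq210 S i : Z S 2 1 0 -> exists u v, [/\ forall j b, nJB S i j b = u j + v b,
  forall j, nIJ S i j = q * u j + \sum_b v b, forall b, nIB S i b = \sum_j u j + p * v b &
  nI S i = q * (\sum_j u j) + p * (\sum_b v b)].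
Proof.
case: inhB inhJ => b0 _ [c0 _] /Z210/(_ i)/(square_sums c0 b0)[u [v [h1 h2 h3 h4]]].
exists u, v; rewrite -cardJ -cardB nI_JB -h4.
by split=> // [b|c]; rewrite ?nIJ_B ?nIB_J.
Qed.

Lemma sq201 S i : Z S 2 0 1 -> exists u v, [/\ forall j c, nJC S i j c = u j + v c,
  forall j, nIJ S i j = r * u j + \sum_c v c, forall c, nIC S i c = \sum_j u j + p * v c &
  nI S i = r * (\sum_j u j) + p * (\sum_c v c)].
Proof.
case: inhC inhJ => b0 _ [c0 _] /Z201/(_ i)/(square_sums c0 b0)[u [v [h1 h2 h3 h4]]].
exists u, v; rewrite -cardJ -cardC nI_JC -h4.
by split=> // [b|c]; rewrite ?nIJ_C ?nIC_J.
Qed.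

Section Absent.
Variables S L : {set X}.
Hypothesis SL : spair S L.

Lemma spairZ tp tq tr : D L tp tq tr -> nontriv tp tq tr -> Z S tp tq tr.
Proof. by move=> d nt; case: SL => _ _; apply. Qed.

Lemma no010 : ~~ (q %| #|S|) -> ~~ D L 0 1 0.
Proof. by apply: contra => d; apply: Z010_dvd (spairZ d isT). Qed.
Lemma no001 : ~~ (r %| #|S|) -> ~~ D L 0 0 1.
Proof. by apply: contra => d; apply: Z001_dvd (spairZ d isT). Qed.
Lemma no100 : ~~ (p %| #|S|) -> ~~ D L 1 0 0.
Proof. by apply: contra => d; apply: Z100_dvd (spairZ d isT). Qed.
Lemma no200 : ~~ (p %| #|S|) -> ~~ D L 2 0 0.
Proof. by apply: contra => d; apply: Z200_dvd (spairZ d isT). Qed.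

End Absent.

(* x - y is a difference of two elements of the box with free coordinates ai, aj,
   ab, ac. The second digit of a difference only makes sense when the first
   digits agree. *)
Definition compat (ai aj ab ac : bool) x y :=
  [&& ai || (ci x == ci y), [|| aj, ci x != ci y | cj x == cj y],
      ab || (cb x == cb y) & ac || (cc x == cc y)].

Definition packs S ai aj ab ac :=
  forall x y, x \in S -> y \in S -> compat ai aj ab ac x y -> x = y.

Definition box_tile S := exists ai aj ab ac : bool,
  packs S ai aj ab ac /\ #|S| * (p ^ (ai + aj) * q ^ ab * r ^ ac) = p ^ 2 * q * r.

Lemma packs_le S ai aj ab ac : packs S ai aj ab ac ->
  #|S| <= p ^ (~~ ai + ~~ aj) * q ^ (~~ ab) * r ^ (~~ ac).
Proof.
move=> pS; case: inhI inhJ inhB inhC => i0 _ [j0 _] [b0 _] [c0 _].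
pose h x := ((if ai then i0 else ci x, if aj then j0 else cj x),
             (if ab then b0 else cb x, if ac then c0 else cc x)).
pose A (T : finType) (t : T) (a : bool) := if a then [set t] else setT.
have cA (T : finType) (t : T) a : #|A T t a| = #|T| ^ (~~ a).
  by case: a; rewrite /A ?cards1 ?cardsT ?expn1.
have hinj : {in S &, injective h}.
  move=> x y xS yS [e1 e2 e3 e4]; apply: pS => //.
  rewrite /compat; move: e1 e2 e3 e4; clear h.
  by case: ai; case: aj; case: ab; case: ac => /= e1 e2 e3 e4;
    rewrite ?e1 ?e2 ?e3 ?e4 ?eqxx ?orbT.
rewrite -(card_in_imset hinj).
have -> : p ^ (~~ ai + ~~ aj) * q ^ (~~ ab) * r ^ (~~ ac) =
  #|setX (setX (A _ i0 ai) (A _ j0 aj)) (setX (A _ b0 ab) (A _ c0 ac))|.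
  by rewrite !cardsX !cA expnD cardI cardJ cardB cardC !mulnA.
apply/subset_leq_card/subsetP => _ /imsetP[x _ ->].
by rewrite !inE /h /A /=; clear h hinj pS; case: ai; case: aj; case: ab; case: ac;
  rewrite !inE ?eqxx.
Qed.

(** The divisor is the index of the box, so divisibility supplies the bound opposite to
    [packs_le]. *)
Lemma packs_tile S ai aj ab ac : S != set0 -> packs S ai aj ab ac ->
  p ^ (~~ ai + ~~ aj) * q ^ (~~ ab) * r ^ (~~ ac) %| #|S| -> box_tile S.
Proof.
move=> S0 pS dv; exists ai, aj, ab, ac; split=> //.
have e : #|S| = p ^ (~~ ai + ~~ aj) * q ^ (~~ ab) * r ^ (~~ ac).
  by apply/eqP; rewrite eqn_leq (packs_le pS) dvdn_leq // card_gt0.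
rewrite e; case: ai {pS dv e}; case: aj; case: ab; case: ac;
  rewrite /= ?addn0 ?add0n ?addn1 ?expn0 ?expn1 ?muln1 ?mul1n //; lia.
Qed.

Lemma sum_const (T : finType) (u : T -> nat) k :
  (forall x, u x = k) -> \sum_x u x = #|T| * k.
Proof. by move=> h; rewrite -sum_nat_const; apply: eq_bigr => x _. Qed.

Lemma sum_ge2 (T : finType) (u : T -> nat) x y : x != y -> u x + u y <= \sum_z u z.
Proof. by move=> xy; rewrite (bigD1 x) //= (bigD1 y) 1?eq_sym //= addnA leq_addr. Qed.

Lemma nI_ex S i : 0 < nI S i -> exists x, x \in S /\ ci x = i.
Proof. by move/cntP => [x xS /eqP ?]; exists x. Qed.
Lemma nBC_ex S b c : 0 < nBC S b c -> exists x, [/\ x \in S, cb x = b & cc x = c].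
Proof. by move/cntP => [x xS /andP[/eqP ? /eqP ?]]; exists x. Qed.
Lemma nIB_ex S i b : 0 < nIB S i b -> exists x, [/\ x \in S, ci x = i & cb x = b].
Proof. by move/cntP => [x xS /andP[/eqP ? /eqP ?]]; exists x. Qed.
Lemma nIC_ex S i c : 0 < nIC S i c -> exists x, [/\ x \in S, ci x = i & cc x = c].
Proof. by move/cntP => [x xS /andP[/eqP ? /eqP ?]]; exists x. Qed.
Lemma nJB_ex S i j b : 0 < nJB S i j b ->
  exists x, [/\ x \in S, ci x = i, cj x = j & cb x = b].
Proof. by move/cntP => [x xS /and3P[/eqP ? /eqP ? /eqP ?]]; exists x. Qed.
Lemma nJC_ex S i j c : 0 < nJC S i j c ->
  exists x, [/\ x \in S, ci x = i, cj x = j & cc x = c].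
Proof. by move/cntP => [x xS /and3P[/eqP ? /eqP ? /eqP ?]]; exists x. Qed.
Lemma nIBC_ex S i b c : 0 < nIBC S i b c ->
  exists x, [/\ x \in S, ci x = i, cb x = b & cc x = c].
Proof. by move/cntP => [x xS /and3P[/eqP ? /eqP ? /eqP ?]]; exists x. Qed.

Section Positive.
Variables (S : {set X}) (x : X).
Hypothesis xS : x \in S.
Ltac pos := by apply: (cnt_gt0 xS); rewrite !eqxx.
Lemma nI_pos : 0 < nI S (ci x). Proof. pos. Qed.
Lemma nC_pos : 0 < nC S (cc x). Proof. pos. Qed.
Lemma nIJ_pos : 0 < nIJ S (ci x) (cj x). Proof. pos. Qed.
Lemma nBC_pos : 0 < nBC S (cb x) (cc x). Proof. pos. Qed.
Lemma nIB_pos : 0 < nIB S (ci x) (cb x). Proof. pos. Qed.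
Lemma nIC_pos : 0 < nIC S (ci x) (cc x). Proof. pos. Qed.
Lemma nJB_pos : 0 < nJB S (ci x) (cj x) (cb x). Proof. pos. Qed.
Lemma nJC_pos : 0 < nJC S (ci x) (cj x) (cc x). Proof. pos. Qed.
Lemma nIBC_pos : 0 < nIBC S (ci x) (cb x) (cc x). Proof. pos. Qed.
End Positive.

Lemma nIJ_BC S i j : nIJ S i j = \sum_b \sum_c nIJBC S i j b c.
Proof. by rewrite nIJ_B; apply: eq_bigr => b _; splitc (@fC K). Qed.

Lemma dvd_const_I S : (forall i i', nI S i = nI S i') -> p %| #|S|.
Proof.
move=> h; case: inhI => i _; rewrite tot_I.
by under eq_bigr => b' _ do rewrite (h b' i); rewrite sum_nat_const cardI dvdn_mulr.
Qed.

Lemma dvd_const_J S i : (forall j j', nIJ S i j = nIJ S i j') -> p %| nI S i.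
Proof.
move=> h; case: inhJ => j _; rewrite nI_J.
by under eq_bigr => b' _ do rewrite (h b' j); rewrite sum_nat_const cardJ dvdn_mulr.
Qed.

Lemma dvd_I S : (forall i, p %| nI S i) -> p %| #|S|.
Proof. by move=> h; rewrite tot_I dvdn_sum. Qed.

Lemma missB S : #|S| < q -> exists b, nB S b = 0.
Proof.
move=> h; have /forallPn[b nb] : ~~ [forall b, 0 < nB S b].
  apply: contraL h => /forallP h; rewrite -leqNgt tot_B -cardB -sum1_card.
  by apply: leq_sum => b _; apply: h.
by exists b; lia.
Qed.

Lemma missC S : #|S| < r -> exists c, nC S c = 0.
Proof.
move=> h; have /forallPn[b nb] : ~~ [forall b, 0 < nC S b].
  apply: contraL h => /forallP h; rewrite -leqNgt tot_C -cardC -sum1_card.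
  by apply: leq_sum => b _; apply: h.
by exists b; lia.
Qed.

Lemma nB0 S b x : nB S b = 0 -> x \in S -> cb x != b.
Proof. by move=> h xS; apply/negP => xb; apply: (cnt0P h xS). Qed.

Lemma nC0 S b x : nC S b = 0 -> x \in S -> cc x != b.
Proof. by move=> h xS; apply/negP => xb; apply: (cnt0P h xS). Qed.

(** Six corners of the cube touch [b0] or [c0] and are empty; the two over [(b, c)] remain. *)
Lemma cube_missing S b0 c0 : nB S b0 = 0 -> nC S c0 = 0 -> Z S 1 1 1 ->
  forall i i' b c, nIBC S i b c = nIBC S i' b c.
Proof.
move=> zb zc /Z111 h i i' b c; have := h i i' b b0 c c0.
have zb' i1 c1 : nIBC S i1 b0 c1 = 0.
  by apply: cnt_eq0 => x xS; rewrite (negPf (nB0 zb xS)) andbF.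
have zc' i1 b1 : nIBC S i1 b1 c0 = 0.
  by apply: cnt_eq0 => x xS; rewrite (negPf (nC0 zc xS)) !andbF.
by rewrite !zb' !zc'; lia.
Qed.

Lemma cube_missing2 S b0 c0 : nB S b0 = 0 -> nC S c0 = 0 -> Z S 2 1 1 ->
  forall i j j' b c, nIJBC S i j b c = nIJBC S i j' b c.
Proof.
move=> zb zc /Z211 h i j j' b c; have := h i j j' b b0 c c0.
have zb' i1 j1 c1 : nIJBC S i1 j1 b0 c1 = 0.
  by apply: cnt_eq0 => x xS; rewrite (negPf (nB0 zb xS)) !andbF.
have zc' i1 j1 b1 : nIJBC S i1 j1 b1 c0 = 0.
  by apply: cnt_eq0 => x xS; rewrite (negPf (nC0 zc xS)) !andbF.
by rewrite !zb' !zc'; lia.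
Qed.

Lemma cube_missing_dvd S t : #|S| < q -> #|S| < r -> Z S t.+1 1 1 -> p %| #|S|.
Proof.
move=> /missB[b0 zb] /missC[c0 zc]; case: t => [|t] h.
  have e := cube_missing zb zc h; apply: dvd_const_I => i i'.
  by rewrite !nI_BC; apply: eq_bigr => b _; apply: eq_bigr => c _.
have e := cube_missing2 zb zc h; apply: dvd_I => i; apply: dvd_const_J => j j'.
by rewrite !nIJ_BC; apply: eq_bigr => b _; apply: eq_bigr => c _.
Qed.

Lemma otherI (i : I) : exists i', i' != i.
Proof. by apply: ex_other; rewrite cardI p_gt1. Qed.
Lemma otherJ (i : J) : exists i', i' != i.
Proof. by apply: ex_other; rewrite cardJ p_gt1. Qed.
Lemma otherB (i : B) : exists i', i' != i.
Proof. by apply: ex_other; rewrite cardB q_gt1. Qed.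
Lemma otherC (i : C) : exists i', i' != i.
Proof. by apply: ex_other; rewrite cardC r_gt1. Qed.

Lemma le_qB S : (forall x y, x \in S -> y \in S -> cb x = cb y -> x = y) -> #|S| <= q.
Proof. by move=> h; rewrite -cnt_true -cardB; apply: (cnt_le_inj (h := cb)) => x y *; apply: h. Qed.

Lemma le_rC S : (forall x y, x \in S -> y \in S -> cc x = cc y -> x = y) -> #|S| <= r.
Proof. by move=> h; rewrite -cnt_true -cardC; apply: (cnt_le_inj (h := cc)) => x y *; apply: h. Qed.

(** * Sizes not divisible by [p] *)

Lemma coprime_no011 S L : spair S L -> ~~ (p %| #|S|) -> ~~ (q %| #|S|) ->
  ~~ (r %| #|S|) -> ~~ D L 0 1 1.
Proof.
move=> SL np nq nr; have LS := spair_sym SL; have [eN _ _] := SL.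
have s1 : ~~ D S 1 0 0 by apply: (no100 LS); rewrite -eN.
have s2 : ~~ D S 2 0 0 by apply: (no200 LS); rewrite -eN.
apply/negP => d; have [u [v [uv _ _ NE]]] := sq011 (spairZ SL d isT).
have le1 b c : nBC S b c <= 1.
  by apply: cnt_le1; sub2 x y xS yS e1 e2; apply: coord_inj; ty x y.
(* Both summands are positive over this [(b, c)], so the fibre has two points, against [le1]. *)
have [b ub] := sum_pos (nd_pos NE nq); have [c vc] := sum_pos (nd_pos' NE nr).
by have := le1 b c; rewrite uv leqNgt -addn1 leq_add.
Qed.

(** A positive [u j] fills all cells [(i, j, b)], and two of them would differ by type 010 or 011;
    so every class has size [p * V]. *)
Lemma coprime_no210 S L : spair S L -> ~~ (p %| #|S|) -> ~~ (q %| #|S|) ->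
  ~~ (r %| #|S|) -> ~~ D L 2 1 0.
Proof.
move=> SL np nq nr; have LS := spair_sym SL; have [eN _ _] := SL.
have s1 : ~~ D S 0 1 0 by apply: (no010 LS); rewrite -eN.
have s2 : ~~ D S 0 1 1 by apply: (coprime_no011 LS); rewrite -?eN.
apply/negP => d; move/negP: np; apply; apply: dvd_I => i.
have [u [v [uv _ _ ->]]] := sq210 i (spairZ SL d isT).
suff -> : \sum_j u j = 0 by rewrite muln0 add0n dvdn_mulr.
apply/eqP; rewrite -leqn0 leqNgt; apply/negP => /sum_pos[j uj].
have [b _] := inhB; have [b' bb'] := otherB b.
have /cntP[x xS /and3P[/eqP x1 /eqP x2 /eqP x3]] : 0 < nJB S i j b by rewrite uv addn_gt0 uj.
have /cntP[y yS /and3P[/eqP y1 /eqP y2 /eqP y3]] : 0 < nJB S i j b' by rewrite uv addn_gt0 uj.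
by subst; ty x y.
Qed.
Lemma nIC_missing S i c : nC S c = 0 -> nIC S i c = 0.
Proof. by rewrite nC_I => /sum_eq0. Qed.

Lemma nJC_missing S i j c : nIC S i c = 0 -> nJC S i j c = 0.
Proof. by rewrite nIC_J => /sum_eq0. Qed.

(** The empty value [c0] removes one term from each side of the square rule. *)
Lemma missing_101 S c0 : nC S c0 = 0 -> Z S 1 0 1 ->
  forall i i' c, nIC S i c = nIC S i' c.
Proof.
move=> z /Z101 h i i' c; have := h i i' c c0.
by rewrite !(nIC_missing _ z) addn0 add0n.
Qed.

Lemma missing_201 S i c0 : nIC S i c0 = 0 -> Z S 2 0 1 ->
  forall j j', nIJ S i j = nIJ S i j'.
Proof.
move=> z /Z201 h j j'; rewrite !nIJ_C; apply: eq_bigr => c _.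
by have := h i j j' c c0; rewrite !(nJC_missing _ z) addn0 add0n.
Qed.

Lemma single_class_no101 S i : (forall x, x \in S -> ci x = i) -> Z S 1 0 1 ->
  r %| #|S|.
Proof.
move=> single /Z101 h; have [i' ii'] := otherI i.
have z c : nIC S i' c = 0.
  by apply: cnt_eq0 => x /single->; rewrite eq_sym (negPf ii').
have nCE c : nC S c = nIC S i c.
  by apply: eq_card => x; rewrite !inE; case: (boolP (x \in S)) => // /single->; rewrite eqxx.
case: inhC => c _; rewrite tot_C (@sum_const _ _ (nC S c)) ?cardC ?dvdn_mulr // => c'.
by have := h i i' c' c; rewrite !nCE !z !addn0.
Qed.

(** Fibres over [(b, c)] have at most one point, so a positive [v c] forces [u = 0]; a [v] positive
    everywhere would give the size [q * r]. *)
Lemma thin_011 S : ~~ D S 1 0 0 -> ~~ D S 2 0 0 -> ~~ (r %| #|S|) -> Z S 0 1 1 ->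
  exists v c0, [/\ nC S c0 = 0, (forall b c, nBC S b c = v c),
    (forall c, v c <= 1) & 0 < \sum_c v c].
Proof.
move=> s1 s2 nr /sq011[u [v [uv _ nCE NE]]].
have le1 b c : nBC S b c <= 1.
  by apply: cnt_le1; sub2 x y xS yS e1 e2; apply: coord_inj; ty x y.
have V0 := nd_pos' NE nr; have [c vc] := sum_pos V0.
have u0 b : u b = 0.
  by apply/eqP; rewrite -leqn0 -(leq_add2r 1); apply: leq_trans (le1 b c); rewrite uv leq_add2l.
have U0 : \sum_b u b = 0 by rewrite big1.
have v1 c' : v c' <= 1 by have [b _] := inhB; have := le1 b c'; rewrite uv u0.
have [c0 vc0] : exists c0, v c0 = 0.
  have /forallPn[c0 vc0] : ~~ [forall c, 0 < v c]; last by exists c0; lia.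
  apply: contra nr => /forallP v0; rewrite NE U0 muln0 add0n (@sum_const _ _ 1).
    by rewrite cardC muln1 dvdn_mull.
  by move=> c'; apply/eqP; rewrite eqn_leq v1 v0.
exists v, c0; split=> // [|b c'].
  by rewrite nCE U0 vc0 muln0.
by rewrite uv u0.
Qed.

(** * Size divisible by [q] alone *)

Section OnlyQ.
Variables S L : {set X}.
Hypothesis SL : spair S L.
Hypotheses (np : ~~ (p %| #|S|)) (nr : ~~ (r %| #|S|)).

Lemma onlyq_absent : [/\ ~~ D S 1 0 0, ~~ D S 2 0 0 & ~~ D S 0 0 1].
Proof.
have [eN _ _] := SL; have LS := spair_sym SL.
by split; [apply: (no100 LS)|apply: (no200 LS)|apply: (no001 LS)]; rewrite -eN.
Qed.

Lemma onlyq_011 : D L 0 1 1 -> exists v c0, [/\ nC S c0 = 0,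
  (forall b c, nBC S b c = v c), (forall c, v c <= 1) & 0 < \sum_c v c].
Proof.
by move=> d; have [s1 s2 s3] := onlyq_absent; apply: thin_011 (spairZ SL d isT).
Qed.

End OnlyQ.

Lemma onlyq_011_no S L : spair S L -> ~~ (p %| #|S|) -> ~~ (r %| #|S|) ->
  D L 0 1 1 -> ~~ D L 1 0 1 /\ ~~ D L 2 0 1.
Proof.
move=> SL np nr /(onlyq_011 SL np nr)[v [c0 [z _ _]]].
split; apply: contra np => d; have h := spairZ SL d isT.
  by apply: dvd_const_I => i i'; rewrite !nI_C; apply: eq_bigr => c _;
    apply: missing_101 z h i i' c.
by apply: dvd_I => i; apply: dvd_const_J; apply: missing_201 (nIC_missing i z) h.
Qed.

Lemma onlyq_leq S L : spair S L -> ~~ (p %| #|S|) -> ~~ (r %| #|S|) ->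
  ~~ D S 1 0 1 -> ~~ D S 2 0 1 -> #|S| <= q.
Proof.
move=> SL np nr n1 n2; have [s1 s2 s3] := onlyq_absent SL np nr.
by apply: le_qB => x y xS yS e; apply: coord_inj; ty x y.
Qed.

Lemma onlyq_201 S L : spair S L -> ~~ (p %| #|S|) -> ~~ (r %| #|S|) ->
  ~~ D S 0 1 1 -> ~~ D L 2 0 1.
Proof.
move=> SL np nr n011; have [s1 s2 s3] := onlyq_absent SL np nr.
apply: contra np => d; apply: dvd_I => i.
have [u [v [uv _ _ ->]]] := sq201 i (spairZ SL d isT).
suff -> : \sum_j u j = 0 by rewrite muln0 add0n dvdn_mulr.
apply/eqP; rewrite -leqn0 leqNgt; apply/negP => /sum_pos[j uj].
have [c _] := inhC; have [c' cc'] := otherC c.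
have /nJC_ex[x [xS x1 x2 x3]] : 0 < nJC S i j c by rewrite uv addn_gt0 uj.
have /nJC_ex[y [yS y1 y2 y3]] : 0 < nJC S i j c' by rewrite uv addn_gt0 uj.
by subst; ty x y.
Qed.

(** A positive [w c] meets all classes of [S] and so creates type 210 there. This forces [L] into
    one class and the size below [q]; the splitting of that class then leaves room for one second
    digit only, against type 101 in [L]. *)
Lemma onlyq_101 S L : spair S L -> ~~ (p %| #|S|) -> ~~ (r %| #|S|) -> q %| #|S| ->
  ~~ D S 0 1 1 -> ~~ D L 0 1 1 -> ~~ D L 1 0 1.
Proof.
move=> SL np nr dq n1 n2; have LS := spair_sym SL; have [eN _ _] := SL.
have np' : ~~ (p %| #|L|) by rewrite -eN.
have nr' : ~~ (r %| #|L|) by rewrite -eN.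
have [s1 s2 s3] := onlyq_absent SL np nr; have [t1 t2 t3] := onlyq_absent LS np' nr'.
have n201 := onlyq_201 SL np nr n1; have n201' := onlyq_201 LS np' nr' n2.
apply/negP => d; have [z [w [zw _ _ NE]]] := sq101 (spairZ SL d isT).
have [c wc] := sum_pos (nd_pos' NE nr).
have d210 : D S 2 1 0.
  have [i _] := inhI; have [i' ii'] := otherI i.
  have /nIC_ex[x [xS x1 x2]] : 0 < nIC S i c by rewrite zw addn_gt0 wc orbT.
  have /nIC_ex[y [yS y1 y2]] : 0 < nIC S i' c by rewrite zw addn_gt0 wc orbT.
  by subst; apply: (hasD xS yS); ty x y.
have [i ui] : exists i, ~~ (p %| nI L i).
  by apply/forallPn; apply: contra np' => /forallP; apply: dvd_I.
have [u [v [uv nIJE _ NIE]]] := sq210 i (spairZ LS d210 isT).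
have U0 := nd_pos NIE ui; have [j uj] := sum_pos U0.
(* The line of [L] over [(i, j)] meets the value [cb x]; types 200 and 201 being absent, [x] lies in
   the class of that line. *)
have single x : x \in L -> ci x = i.
  move=> xL; have /nJB_ex[y [yL y1 y2 y3]] : 0 < nJB L i j (cb x) by rewrite uv addn_gt0 uj.
  by rewrite -y1; ty x y.
have n101 : ~~ D S 1 0 1.
  by apply: contra nr' => d'; apply: single_class_no101 single (spairZ LS d' isT).
have Nq : #|L| <= q by rewrite -eN; apply: onlyq_leq SL np nr n101 n201'.
have /DP[x [y [xL yL /and3P[/andP[xy1 xy2] _ _]]]] := d.
have NLE : #|L| = nI L i.
  rewrite -cnt_true; apply: eq_card => z'; rewrite !inE.
  by case: (boolP (z' \in L)) => // /single->; rewrite eqxx.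
move: NIE; rewrite -NLE => NIE.
have V0 : \sum_b v b = 0.
  have q0 : 0 < q by exact: prime_gt0.
  have p0 : 0 < p by exact: prime_gt0.
  by move: Nq U0 q0 p0; rewrite NIE; clear; nia.
have up z' : z' \in L -> 0 < u (cj z').
  by move=> z'L; have := nJB_pos z'L; rewrite (single _ z'L) uv (sum_eq0 V0) addn0.
have := sum_ge2 u xy2; have := up x xL; have := up y yL.
have q0 : 0 < q by exact: prime_gt0.
by move: Nq q0; rewrite NIE; clear; nia.
Qed.

Lemma onlyq_tile S L : spair S L -> S != set0 ->
  ~~ (p %| #|S|) -> ~~ (r %| #|S|) -> q %| #|S| -> box_tile S.
Proof.
move=> SL S0 np nr dq; have LS := spair_sym SL; have [eN _ _] := SL.
have np' : ~~ (p %| #|L|) by rewrite -eN.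
have nr' : ~~ (r %| #|L|) by rewrite -eN.
have [s1 s2 s3] := onlyq_absent SL np nr; have [t1 t2 t3] := onlyq_absent LS np' nr'.
have main : ~~ D S 1 0 1 -> ~~ D S 2 0 1 -> box_tile S.
  move=> n1 n2; apply: (@packs_tile S true true false true) => //.
    by move=> x y xS yS h; rewrite /compat /= in h; apply: coord_inj; ty x y.
  by rewrite /= expn0 expn1 mul1n muln1.
have [d|n1] := boolP (D S 0 1 1).
  by have [] := onlyq_011_no LS np' nr' d.
have [d|n2] := boolP (D L 0 1 1).
  have [h1 h2] := onlyq_011_no SL np nr d.
  have Nq := onlyq_leq LS np' nr' h1 h2.
  have [v [c0 [_ vE _ /sum_pos[c vc]]]] := onlyq_011 SL np nr d.
  (* The fibre over [c] already has [q] points, which is all that [Nq] allows. *)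
  have cE x : x \in S -> cc x = c.
    move=> xS; apply/eqP; apply: contraTT isT => xc.
    have := sum_ge2 (nC S) xc; have := nC_pos xS; rewrite -tot_C nC_B.
    rewrite [nC S c]nC_B; under [X in _ + X]eq_bigr do rewrite vE.
    rewrite sum_nat_const cardB eN; move: vc Nq; clear; nia.
  by apply: main; apply/negP => /DP[x [y [xS yS /and3P[_ _]]]]; rewrite (cE x) // (cE y) //= eqxx.
apply: main; first by apply: onlyq_101 LS np' nr' _ n2 n1; rewrite -eN.
exact: onlyq_201 LS np' nr' n2.
Qed.

(** * Equidistribution of the digits modulo [p] *)

Definition flatI S := forall i i', nI S i = nI S i'.
Definition flatJ S := forall i j j', nIJ S i j = nIJ S i j'.

Lemma flatIE S : flatI S -> forall i, #|S| = p * nI S i.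
Proof. by move=> h i; rewrite tot_I (@sum_const _ _ (nI S i)) ?cardI. Qed.

Lemma flatJ_dvd S : flatJ S -> forall i, p %| nI S i.
Proof. by move=> h i; apply: dvd_const_J. Qed.

Lemma flat_both S : ~~ (p ^ 2 %| #|S|) -> flatI S -> flatJ S -> False.
Proof.
move=> n2 /flatIE h1 /flatJ_dvd h2; case: inhI => i _; case/negP: n2.
by rewrite (h1 i) -mulnn dvdn_pmul2l ?prime_gt0.
Qed.

Lemma missing_flatI S c0 : nC S c0 = 0 -> Z S 1 0 1 -> flatI S.
Proof.
by move=> z h i i'; rewrite !nI_C; apply: eq_bigr => c _; apply: missing_101 z h _ _ _.
Qed.

Lemma missing_flatJ S c0 : nC S c0 = 0 -> Z S 2 0 1 -> flatJ S.
Proof. by move=> z h i; apply: missing_201 (nIC_missing i z) h. Qed.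

Lemma full_fibre S (P : pred X) : cnt S P = p ->
  (forall x y, x \in S -> y \in S -> P x -> P y -> cj x = cj y -> x = y) ->
  forall j, exists x, [/\ x \in S, P x & cj x = j].
Proof.
move=> cP inj j; pose T := [set x in S | P x].
have injT : {in T &, injective cj}.
  by move=> x y; rewrite !inE => /andP[? ?] /andP[? ?]; apply: inj.
have /imsetP[x] : j \in cj @: T.
  suff -> : cj @: T = setT by rewrite inE.
  by apply/eqP; rewrite eqEcard subsetT /= cardsT cardJ card_in_imset // -cP.
by rewrite inE => /andP[xS Px] ->; exists x.
Qed.

Lemma sum_bound (T : finType) (u : T -> nat) k : (forall x, u x <= k) ->
  #|T| * k <= \sum_x u x -> forall x, u x = k.
Proof.
move=> h; rewrite -sum_nat_const => le.
have /leqif_sum[_] : forall x : T, xpredT x -> u x <= k ?= iff (u x == k).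
  by move=> x _; apply: leqif_eq.
rewrite eqn_leq le leq_sum //= => /esym/forallP e x; exact/eqP/e.
Qed.

(** The difference of [a] and [d] is constant and sums to zero. *)
Lemma flat_difference (a d : I -> nat) : (forall i i', a i + d i' = a i' + d i) ->
  \sum_i a i = \sum_i d i -> a =1 d.
Proof.
move=> ad e i; have : \sum_i' (a i + d i') = \sum_i' (a i' + d i) by apply: eq_bigr.
rewrite !big_split /= !sum_nat_const cardI e addnC => /addnI/eqP.
by rewrite eqn_pmul2l ?prime_gt0 // => /eqP.
Qed.

(** Type 111 makes the defect of the square rule the same in every class; type 011 makes these
    defects sum to zero. *)
Lemma inv_square S : Z S 0 1 1 -> Z S 1 1 1 -> forall i, square (nIBC S i).
Proof.
move=> /Z011 h1 /Z111 h2 i b b' c c'.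
apply: (@flat_difference (fun i => nIBC S i b c + nIBC S i b' c')
  (fun i => nIBC S i b c' + nIBC S i b' c)) i => [i i'|].
  by have := h2 i i' b b' c c'; clear; lia.
by rewrite !big_split /= -!nBC_I.
Qed.

Lemma prime_ndvd a b : prime a -> prime b -> a != b -> ~~ (a %| b).
Proof. by move=> pa pb ab; rewrite dvdn_prime2. Qed.

(** In [q = r * U + q * V] the sum [V] is positive because [r] does not divide [q]; hence [U = 0],
    [V = 1], and one value of [cc] survives. *)
Lemma inv_end S i x y : square (nIBC S i) -> nI S i = q -> x \in S -> y \in S ->
  ci x = i -> ci y = i -> cc x = cc y.
Proof.
case: inhB inhC => b0 _ [c0 _] /(square_sums b0 c0)[u [v [uv _ s2]]].
rewrite -nI_BC cardB cardC => sE iE xS yS xi yi.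
have U0 : \sum_b u b = 0.
  have V1 : 0 < \sum_c v c by apply: nd_pos' sE _; rewrite iE prime_ndvd // eq_sym.
  have q0 : 0 < q by exact: prime_gt0.
  have r0 : 0 < r by exact: prime_gt0.
  by move: V1 q0 r0 sE; rewrite iE; clear; nia.
apply/eqP; apply: contraTT isT => xy; have := sum_ge2 v xy.
have vp z : z \in S -> ci z = i -> 0 < v (cc z).
  by move=> zS zi; have := nIBC_pos zS; rewrite zi uv (sum_eq0 U0).
have := vp x xS xi; have := vp y yS yi; have q0 : 0 < q by exact: prime_gt0.
by move: sE q0; rewrite U0 iE; clear; nia.
Qed.

(** A class is a union of whole [cc] fibres, so [p * q] divides its size; two nonempty classes
    exceed the total. *)
Lemma fin_class S s1 s2 : #|S| = p * q -> (forall c, q %| nC S c) ->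
  (forall x y, x \in S -> y \in S -> cc x = cc y -> ci x = ci y) ->
  (forall i, p %| nI S i) -> s1 \in S -> s2 \in S -> ci s1 != ci s2 -> False.
Proof.
move=> N dq single dp s1S s2S ne.
have d i : p * q %| nI S i.
  rewrite Gauss_dvd ?dp /=; last by rewrite prime_coprime // prime_ndvd.
  rewrite nI_C dvdn_sum // => c _.
  have [->//|/nIC_ex[x [xS <- <-]]] := posnP (nIC S i c).
  suff -> : nIC S (ci x) (cc x) = nC S (cc x) by [].
  apply: eq_card => y; rewrite !inE; case: (boolP (y \in S)) => //= yS.
  by case: (cc y =P cc x) => [e|_]; rewrite ?andbF // (single y x yS xS e) eqxx.
have := sum_ge2 (nI S) ne; rewrite -tot_I N.
have := dvdn_leq (nI_pos s1S) (d (ci s1)); have := dvdn_leq (nI_pos s2S) (d (ci s2)).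
have : 0 < p * q by rewrite muln_gt0 !prime_gt0.
by clear; lia.
Qed.

Lemma Z011_dvd S : q %| #|S| -> Z S 0 1 1 -> forall c, q %| nC S c.
Proof.
move=> dq /sq011[u [v [_ _ nCE NE]]] c.
have dqV n : q %| q * n by exact: dvdn_mulr.
rewrite nCE dvdn_addl //; move: dq; rewrite NE dvdn_addl // Gauss_dvdr //.
by rewrite prime_coprime // prime_ndvd.
Qed.

(** * Size divisible by p and q only *)

Section HalfP.
Variables S L : {set X}.
Hypothesis SL : spair S L.
Hypotheses (dp : p %| #|S|) (ndp2 : ~~ (p ^ 2 %| #|S|)) (dq : q %| #|S|).
Hypothesis (nr : ~~ (r %| #|S|)).

Let eN : #|S| = #|L|. Proof. by case: SL. Qed.
Let LS : spair L S. Proof. exact: spair_sym. Qed.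

Lemma half_absent : ~~ D S 0 0 1 /\ ~~ D L 0 0 1.
Proof. by split; [apply: (no001 LS); rewrite -eN|apply: (no001 SL)]. Qed.

Lemma half_ge : p * q <= #|S|.
Proof.
apply: dvdn_leq; last by rewrite Gauss_dvd ?dp ?dq // prime_coprime // prime_ndvd.
by rewrite lt0n; apply: contra ndp2 => /eqP->; rewrite dvdn0.
Qed.

(** Summing over [b] gives the bound opposite to [half_ge], so every inequality is tight. *)
Lemma half_eq : (forall b, nB L b <= p) ->
  #|S| = p * q /\ forall b, nB L b = p.
Proof.
move=> h; have ge := half_ge; have e : forall b, nB L b = p.
  by apply: sum_bound h _; rewrite -tot_B cardB mulnC -eN.
by split=> //; rewrite eN tot_B (sum_const e) cardB mulnC.
Qed.

Let excS : flatI S -> flatJ S -> False. Proof. exact: flat_both. Qed.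
Let excL : flatI L -> flatJ L -> False.
Proof. by apply: flat_both; rewrite -eN. Qed.

(** Types 210 and 201 split the same [nIJ L i j] with leading coefficients [q] and [r]. One constant
    term vanishes because cells hold at most one point, the other because some second digit is
    empty; a nonempty digit then makes [q] a multiple of [r]. *)
Lemma half_100_201_no210 : D S 1 0 0 -> D S 2 0 1 -> D S 2 1 0 -> False.
Proof.
move=> /(spairZ LS)-/(_ isT)/Z100 f1 /(spairZ LS)-/(_ isT) z201 /(spairZ LS)-/(_ isT) z210.
have [s001 t001] := half_absent; case: inhI => i _.
have nd : ~~ (p %| nI L i).
  by apply: contra ndp2 => h; rewrite eN (flatIE f1 i) -mulnn dvdn_pmul2l ?prime_gt0.
have [u [v [uv uE _ NE]]] := sq201 i z201; have [x [y [xy xE _ NE']]] := sq210 i z210.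
have le1 j b : nJB L i j b <= 1.
  by apply: cnt_le1 => s t sS tS /and3P[/eqP<- /eqP<- /eqP<-] /and3P[/eqP e1 /eqP e2 /eqP e3];
    apply: coord_inj; ty s t.
have [j xj] := sum_pos (nd_pos NE' nd); have [j1 uj] := sum_pos (nd_pos NE nd).
have y0 b : y b = 0.
  by have := le1 j b; rewrite xy; move: xj; clear; lia.
have Y0 : \sum_b y b = 0 by rewrite big1.
have [b0 _] := inhB; have x1 j' : x j' <= 1 by have := le1 j' b0; rewrite xy y0 addn0.
have [j0 xj0] : exists j0, x j0 = 0.
  have /forallPn[j0 h] : ~~ [forall j, 0 < x j]; last by exists j0; lia.
  apply: contra nd => /forallP h; rewrite NE' Y0 muln0 addn0 (@sum_const _ _ 1).
    by rewrite cardJ muln1 dvdn_mull.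
  by move=> j'; apply/eqP; rewrite eqn_leq x1 h.
have V0 : \sum_c v c = 0.
  have := uE j0; rewrite xE xj0 Y0 muln0 addn0 => /eqP.
  by rewrite eq_sym addn_eq0 => /andP[_ /eqP].
have : r %| q.
  have := uE j1; rewrite xE Y0 V0 !addn0 => e.
  have xj1 : x j1 = 1.
    apply/eqP; rewrite eqn_leq x1 lt0n; apply: contraTneq uj => z.
    by move: e; rewrite z muln0 => /esym/eqP; rewrite muln_eq0 eqn0Ngt prime_gt0 // => /eqP->.
  by rewrite -(muln1 q) -xj1 e dvdn_mulr.
by apply/negP; rewrite prime_ndvd // eq_sym.
Qed.

(** Each [cc] fibre of [S] lies in one class, as 200 and 210 are absent. The cells emptied this way
    exclude 101 from [L], and equidistribute the second digits of [S] as soon as [L] has 200 or 201.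
    With or without 100 in [L], the size becomes [p * q]. *)
Lemma half_100_201 : D S 1 0 0 -> D S 2 0 1 -> False.
Proof.
move=> d100 d201; have n210 := half_100_201_no210 d100 d201.
have {}n210 : ~~ D S 2 1 0 by apply/negP => /n210.
have [s001 t001] := half_absent.
have f1 := Z100 (spairZ LS d100 isT); have z201 := spairZ LS d201 isT.
have n200 : ~~ D S 2 0 0 by apply/negP => d; apply: excL f1 (Z200 (spairZ LS d isT)).
have nd i : ~~ (p %| nI L i).
  by apply: contra ndp2 => h; rewrite eN (flatIE f1 i) -mulnn dvdn_pmul2l ?prime_gt0.
have same x y : x \in S -> y \in S -> cc x = cc y -> ci x = ci y by move=> xS yS e; ty x y.
have /DP[s1 [s2 [s1S s2S /and3P[ne /eqP eb nc]]]] := d201; rewrite /= in ne nc.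
have d011 : D L 0 1 1.
  case: inhI => i _; have [u [v [uv uE _ NE]]] := sq201 i z201.
  have [j uj] := sum_pos (nd_pos NE (nd i)).
  have [c _] := inhC; have [c' cc'] := otherC c.
  have /nJC_ex[x [xS x1 x2 x3]] : 0 < nJC L i j c by rewrite uv addn_gt0 uj.
  have /nJC_ex[y [yS y1 y2 y3]] : 0 < nJC L i j c' by rewrite uv addn_gt0 uj.
  by subst; apply: (hasD xS yS); ty x y.
have zero i c x : x \in S -> cc x = c -> ci x != i -> nIC S i c = 0.
  move=> xS e h; apply: cnt_eq0 => z zS; apply/negP => /andP[/eqP e1 /eqP e2].
  by case/eqP: h; rewrite -e1; apply: same; rewrite // e2.
have n101 : ~~ D L 1 0 1.
  apply/negP => d; have := Z101 (spairZ SL d isT) (ci s1) (ci s2) (cc s1) (cc s2).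
  rewrite (zero (ci s1) (cc s2) s2) 1?eq_sym // (zero (ci s2) (cc s1) s1) //.
  by have := nIC_pos s1S; clear; lia.
have flJ : D L 2 0 0 || D L 2 0 1 -> flatJ S.
  case/orP => d; first exact: Z200 (spairZ SL d isT).
  move=> i; have [e|h] := eqVneq (ci s1) i.
    by apply: missing_201 (spairZ SL d isT); apply: (zero _ (cc s2) s2); rewrite // -e eq_sym.
  by apply: missing_201 (spairZ SL d isT); apply: (zero _ (cc s1) s1).
have [d|nd100] := boolP (D L 1 0 0).
  have fI := Z100 (spairZ SL d isT).
  have : ~~ (D L 2 0 0 || D L 2 0 1) by apply/negP => /flJ; apply: excS.
  rewrite negb_or => /andP[m1 m2].
  have [b|N e] := half_eq.
    rewrite -cardJ; apply: (@cnt_le_inj _ _ _ (@fJ K)) => x y xS yS /eqP e1 /eqP e2 e3.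
    by rewrite -e2 in e1; apply: coord_inj; ty x y.
  (* Each [cb] fibre of [L] has [p] points and lies in one class, so [p] divides the class sizes. *)
  have [i _] := inhI; case/negP: (nd i); rewrite nI_B dvdn_sum // => b _.
  have [->//|/nIB_ex[x [xS <- <-]]] := posnP (nIB L i b).
  suff -> : nIB L (ci x) (cb x) = nB L (cb x) by rewrite e.
  apply: eq_card => y; rewrite !inE; case: (boolP (y \in L)) => //= yS.
  case: (cb y =P cb x) => [e1|_]; last by rewrite andbF.
  suff -> : ci y = ci x by rewrite eqxx.
  by ty y x.
have le1 i b : nIB L i b <= 1.
  by apply: cnt_le1; sub2 x y xS yS e1 e2; apply: coord_inj; ty x y.
have [b|N e] := half_eq.
  by rewrite nB_I -cardI -sum1_card; apply: leq_sum => i _; apply: le1.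
have flS : flatJ S.
  apply: flJ; have [b _] := inhB; have : 1 < nB L b by rewrite e p_gt1.
  move=> /card_gt1P[x [y [xS yS xy]]].
  move: xS yS; rewrite !inE => /andP[xS /eqP xb] /andP[yS /eqP yb]; rewrite -yb in xb.
  have ne' : ci x != ci y.
    by apply: contra xy => /eqP h; apply/eqP; apply: coord_inj; ty x y.
  have [h|h] := eqVneq (cc x) (cc y); apply/orP; [left|right]; apply: (hasD xS yS); ty x y.
apply: (fin_class N (Z011_dvd dq (spairZ SL d011 isT)) same (flatJ_dvd flS) s1S s2S ne).
Qed.

Lemma classL_le i : nI L i <= p * q.
Proof.
have [_ t001] := half_absent.
rewrite -cardJ -cardB -card_prod; apply: (@cnt_le_inj _ _ _ (fun x => (cj x, cb x))).
move=> x y xL yL /eqP e1 /eqP e2 [e3 e4]; rewrite -e2 in e1.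
by apply: coord_inj; ty x y.
Qed.

(** Two class sizes differ by a multiple of [p], of [r] and of [q], while [classL_le] keeps them at
    most [p * q]. *)
Lemma classL_flat : (forall i, p %| nI L i) -> Z L 1 0 1 -> Z L 1 1 0 -> flatI L.
Proof.
move=> dpL /sq101[z [w [_ zE _ _]]] /sq110[x [y [_ xE _ _]]].
have main i i' : nI L i <= nI L i'.
  rewrite leqNgt; apply/negP => lt.
  have dp' : p %| nI L i - nI L i' by rewrite dvdn_sub.
  have dr' : r %| nI L i - nI L i' by rewrite !zE subnDr -mulnBr dvdn_mulr.
  have dq' : q %| nI L i - nI L i' by rewrite !xE subnDr -mulnBr dvdn_mulr.
  have : p * q * r %| nI L i - nI L i'.
    rewrite !Gauss_dvd ?dp' ?dq' ?dr' //; first by rewrite prime_coprime // prime_ndvd.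
    by rewrite coprimeMl !prime_coprime // !prime_ndvd.
  move/dvdn_leq => /(_ _)/wrap[|le]; first by rewrite subn_gt0.
  have := leq_trans le (leq_trans (leq_subr _ _) (classL_le i)).
  have : 0 < p * q by rewrite muln_gt0 !prime_gt0.
  by have := r_gt1; clear; nia.
by move=> i i'; apply/eqP; rewrite eqn_leq !main.
Qed.

(** * Types 200 and 101 in [S] *)

Section TwoHundred.
Hypotheses (d200 : D S 2 0 0) (d101 : D S 1 0 1).

Let flL : flatJ L. Proof. exact: Z200 (spairZ LS d200 isT). Qed.
Let nfI : ~ flatI L. Proof. by move/excL; apply. Qed.
Let z101 : Z L 1 0 1. Proof. exact: (spairZ LS d101 isT). Qed.

Lemma two_n100 : ~~ D S 1 0 0.
Proof. by apply/negP => d; apply: nfI; apply: Z100 (spairZ LS d isT). Qed.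

Lemma two_n110 : ~~ D S 1 1 0.
Proof.
apply/negP => d; apply: nfI; apply: classL_flat (spairZ LS d isT) => //.
exact: flatJ_dvd.
Qed.

(** In the square spanned by a pair of type 101 in [S] the two mixed cells are empty: a point there
    would differ from [x] or [y] by type 100 or 110. *)
Lemma two_n201 : ~~ D L 2 0 1.
Proof.
have n100 := two_n100; have n110 := two_n110; have [s001 _] := half_absent.
apply/negP => d; have /DP[x [y [xS yS /and3P[/andP[/eqP e1 e2] /eqP e3 e4]]]] := d101.
have := Z201 (spairZ SL d isT) (ci x) (cj x) (cj y) (cc x) (cc y).
have z1 : nJC S (ci x) (cj x) (cc y) = 0.
  apply: cnt_eq0 => z zS; apply/negP => /and3P[/eqP f1 /eqP f2 /eqP f3].
  by rewrite -f2 in e2; rewrite e1 in f1; ty z y.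
have z2 : nJC S (ci x) (cj y) (cc x) = 0.
  apply: cnt_eq0 => z zS; apply/negP => /and3P[/eqP f1 /eqP f2 /eqP f3].
  by rewrite -f2 in e2; ty x z.
by rewrite z1 z2; have := nJC_pos xS; clear; lia.
Qed.

(** The point of the dichotomy: on such a [cb] fibre the first digit is injective, on the others the
    second digit is, so that no fibre exceeds [p] points. *)
Definition multi b := [exists x in L, exists y in L,
  [&& cb x == b, cb y == b & ci x != ci y]].

Lemma multiP b : reflect (exists x y, [/\ x \in L, y \in L, cb x = b, cb y = b & ci x != ci y])
  (multi b).
Proof.
apply: (iffP exists_inP) => [[x xL /exists_inP[y yL /and3P[/eqP ? /eqP ? ?]]]|].
  by exists x, y.
move=> [x [y [xL yL xb yb ne]]]; exists x => //; apply/exists_inP; exists y => //.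
by rewrite xb yb !eqxx.
Qed.

Lemma two_flatI : D L 1 0 0 -> flatI S.
Proof. by move=> d; apply: Z100 (spairZ SL d isT). Qed.

Lemma two_100_n200 : D L 1 0 0 -> ~~ D L 2 0 0.
Proof.
by move=> /two_flatI h; apply/negP => d; apply: excS h (Z200 (spairZ SL d isT)).
Qed.

Lemma multi_no100 b : multi b -> ~~ D L 1 0 0.
Proof.
move=> /multiP[x [y [xL yL xb yb ne]]]; apply/negP => /two_100_n200 n200.
have n201 := two_n201; rewrite -yb in xb; have [_ t001] := half_absent; by ty x y.
Qed.

(** As 201 is absent from [L], points of the fibre in different classes share [cc]. A point [u] of
    another class thus equates [cc x] with [cc y], and only type 100 could still separate [x] from
    [y]. *)
Lemma multi_inj b x y : multi b -> x \in L -> y \in L -> cb x = b -> cb y = b ->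
  ci x = ci y -> x = y.
Proof.
move=> mb xL yL xb yb e; have n100 := multi_no100 mb; have n201 := two_n201.
have [_ t001] := half_absent; case/multiP: mb => s [t [sL tL sb tb ne]].
have [u [uL ub uc]] : exists u, [/\ u \in L, cb u = b & ci u != ci x].
  by have [h|h] := eqVneq (ci s) (ci x); [exists t; rewrite -h eq_sym|exists s].
rewrite -ub in xb yb; have c1 : cc u = cc x by ty u x.
have c2 : cc u = cc y by rewrite e in uc; ty u y.
rewrite c1 in c2; rewrite -yb in xb; by apply: coord_inj; ty x y.
Qed.

Lemma single_inj b x y : ~~ multi b -> x \in L -> y \in L -> cb x = b -> cb y = b ->
  cj x = cj y -> x = y.
Proof.
move=> mb xL yL xb yb e; have [_ t001] := half_absent.
have ec : ci x = ci y.
  by apply/eqP; apply: contraNT mb => h; apply/multiP; exists x, y.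
by rewrite -yb in xb; apply: coord_inj; ty x y.
Qed.

Lemma two_eq : #|S| = p * q /\ forall b, nB L b = p.
Proof.
apply: half_eq => b; have [m|m] := boolP (multi b).
  rewrite -cardI; apply: (@cnt_le_inj _ _ _ (@fI K)) => x y xS yS /eqP e1 /eqP e2.
  exact: multi_inj m _ _ e1 e2.
rewrite -cardJ; apply: (@cnt_le_inj _ _ _ (@fJ K)) => x y xS yS /eqP e1 /eqP e2.
exact: single_inj m _ _ e1 e2.
Qed.

(** Otherwise each class would meet each [cb] fibre exactly once, so that both digits of [L] would
    be equidistributed. *)
Lemma exists_single : exists b, ~~ multi b.
Proof.
have [_ nBE] := two_eq; apply/existsP; rewrite -negb_forall; apply/negP => /forallP h.
have e i b : nIB L i b = 1.
  apply: (@sum_bound _ (fun i => nIB L i b) 1) => [i'|]; last by rewrite -nB_I nBE cardI muln1.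
  apply: cnt_le1; sub2 x y xS yS e1 e2; by apply: (multi_inj (h (cb x))) => //.
by apply: nfI => i i'; rewrite !nI_B; apply: eq_bigr => b _; rewrite !e.
Qed.

Lemma single_full b x j : x \in L -> cb x = b -> ~~ multi b ->
  exists y, [/\ y \in L, cb y = b, ci y = ci x & cj y = j].
Proof.
move=> xL xb nm; have [_ nBE] := two_eq.
have [|y [yL /eqP yb yj]] := @full_fibre L (fun x => cb x == b) (nBE b) _ j.
  by move=> s t sL tL /eqP e1 /eqP e2; apply: single_inj nm _ _ _ _.
exists y; split=> //; apply/eqP; apply: contraNT nm => h.
by apply/multiP; exists y, x.
Qed.

Lemma two_i0 : exists i0, forall c, 0 < nIC L i0 c.
Proof.
have [z [w [zw zE _ _]]] := sq101 z101.
have /forallPn[i0 h] : ~~ [forall i, z i == 0].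
  by apply/negP => /forallP h; apply: nfI => i i'; rewrite !zE !(eqP (h _)).
by exists i0 => c; rewrite zw addn_gt0 lt0n h.
Qed.

End TwoHundred.

Lemma flat_nIS : #|S| = p * q -> flatI S -> forall i, nI S i = q.
Proof.
move=> N h i; have /eqP := flatIE h i; rewrite N eqn_pmul2l ?prime_gt0 //.
by move/eqP.
Qed.

(** Changing the second digit of one point of a 011 pair yields 111 in [L]. Then [inv_square] and
    [inv_end] give each class of [S] a single [cc], against 101 in [S]. *)
Lemma invariant_contra : #|S| = p * q -> flatI S -> D S 1 0 1 -> D L 0 1 1 ->
  (forall x j, x \in L ->
     exists y, [/\ y \in L, ci y = ci x, cj y = j, cb y = cb x & cc y = cc x]) -> False.
Proof.
move=> N fS d101 d011 inv.
have d111 : D L 1 1 1.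
  have /DP[x [y [xL yL /and3P[/andP[/eqP e1 /eqP e2] e3 e4]]]] := d011; rewrite /= in e3 e4.
  have [j jx] := otherJ (cj x); have [y' [y'L f1 f2 f3 f4]] := inv y j yL.
  apply: (hasD xL y'L); rewrite -f2 in jx; rewrite -f3 in e3; rewrite -f4 in e4.
  by rewrite -f1 in e1; clear e2; ty x y'.
have sq := inv_square (spairZ SL d011 isT) (spairZ SL d111 isT).
have /DP[x [y [xS yS /and3P[/andP[/eqP e1 e2] /eqP e3 e4]]]] := d101.
by case/eqP: e4; apply: inv_end (sq (ci x)) _ _ _ _ _; rewrite ?flat_nIS.
Qed.

(** Equal class sizes make [z] constant, so [nC S c] is [p * nIC S i c] and [q] divides [nIC S i c].
    A class of size [q] has no room for two values of [cc]. *)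
Lemma flat_contra : #|S| = p * q -> flatI S -> D S 1 0 1 -> D L 0 1 1 -> D L 1 0 1 -> False.
Proof.
move=> N fS d101 d011 d101L.
have nIq := flat_nIS N fS; have [z [w [zw zE _ _]]] := sq101 (spairZ SL d101L isT).
have zz i i' : z i = z i'.
  have := nIq i; rewrite -(nIq i') !zE => /addIn/eqP.
  by rewrite eqn_pmul2l ?prime_gt0 // => /eqP.
have dqF i c : q %| nIC S i c.
  have := Z011_dvd dq (spairZ SL d011 isT) c.
  rewrite nC_I (@sum_const _ _ (nIC S i c)); last by move=> i'; rewrite !zw (zz i' i).
  by rewrite cardI Gauss_dvdr // prime_coprime // prime_ndvd // eq_sym.
have /DP[x [y [xS yS /and3P[/andP[/eqP e1 e2] /eqP e3 e4]]]] := d101.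
have := sum_ge2 (nIC S (ci x)) e4; rewrite -nI_C nIq.
have := dvdn_leq (nIC_pos xS) (dqF _ _).
have := dvdn_leq (nIC_pos yS) (dqF _ _); rewrite -e1.
by have := q_gt1; clear; lia.
Qed.

Section TwoHundred2.
Hypotheses (d200 : D S 2 0 0) (d101 : D S 1 0 1).

Lemma two_nIB : ~~ D L 1 0 0 -> exists i b, nIB L i b != 1.
Proof.
move=> n100; have fL := Z200 (spairZ LS d200 isT).
have /existsP[i /existsP[b h]] : [exists i, exists b, nIB L i b != 1]; last by exists i, b.
rewrite -[[exists i, _]]negbK negb_exists; apply/negP => /forallP h.
apply: (excL _ fL) => i i'; rewrite !nI_B; apply: eq_bigr => b _.
have e j : nIB L j b = 1.
  by have := h j; rewrite negb_exists => /forallP/(_ b); rewrite negbK => /eqP.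
by rewrite !e.
Qed.

(** If 100 is absent from [L] too, all [nIB L i b] equal one, which [two_nIB] refutes; if it is
    present, [L] is invariant under changes of the second digit. *)
Lemma two_N101 : ~~ D L 1 0 1 -> False.
Proof.
move=> n101; have [N nBE] := two_eq d200 d101; have [_ t001] := half_absent.
have [d100|n100] := boolP (D L 1 0 0); last first.
  have [i [b /eqP]] := two_nIB n100; apply.
  apply: (@sum_bound _ (fun i => nIB L i b) 1) => [i'|]; last by rewrite -nB_I nBE cardI muln1.
  by apply: cnt_le1; sub2 x y xS yS e1 e2; apply: coord_inj; ty x y.
have n200 := two_100_n200 d100; have n201 := two_n201 d200 d101.
have nm b : ~~ multi b by apply/negP => /multi_no100; rewrite d100 => /(_ d200 d101).
have inv x j : x \in L ->
  exists y, [/\ y \in L, ci y = ci x, cj y = j, cb y = cb x & cc y = cc x].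
  move=> xL; have [y [yL e1 e2 e3]] := single_full d200 d101 j xL (erefl _) (nm _).
  by exists y; split=> //; ty y x.
apply: (@invariant_contra N (two_flatI d100) d101 _ inv).
have [i0 h] := two_i0 d200 d101; have [c _] := inhC; have [c' cc'] := otherC c.
have [x [xL x1 x2]] := nIC_ex (h c); have [y0 [y0L y1 y2]] := nIC_ex (h c').
have [y [yL e1 e2 e3 e4]] := inv y0 (cj x) y0L.
rewrite -e4 in y2; rewrite -e1 -x1 in y1; subst; apply: (hasD xL yL).
by clear e1 e3; ty x y.
Qed.

(** A [cb] fibre inside one class has [p] points, and without type 100 their values of [cc] are
    distinct. *)
Lemma two_ple_r : ~~ D L 1 0 0 -> p <= r.
Proof.
move=> n100; have [N nBE] := two_eq d200 d101; have [_ t001] := half_absent.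
have [b nm] := exists_single d200 d101.
rewrite -(nBE b) -cardC; apply: (@cnt_le_inj _ _ _ (@fC K)) => x y xL yL /eqP e1 /eqP e2 e3.
apply: (single_inj nm xL yL e1 e2).
have ec : ci x = ci y.
  by apply/eqP; apply: contraNT nm => h; apply/multiP; exists x, y.
by rewrite -e2 in e1; ty x y.
Qed.

(** Without 100 in [L] one has [p < r]; as [q] divides every [nC S c], a total of [p * q] leaves a
    value of [cc] empty, and 101 alone equidistributes the first digits of [S]. *)
Lemma two_011 : D L 1 0 1 -> ~~ D L 0 1 1.
Proof.
move=> d101L; apply/negP => d011; have [N nBE] := two_eq d200 d101.
apply: (flat_contra N _ d101 d011 d101L).
have [d100|n100] := boolP (D L 1 0 0); first exact: two_flatI d100.
have pr := two_ple_r n100.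
suff [c0 z] : exists c0, nC S c0 = 0 by apply: missing_flatI z (spairZ SL d101L isT).
have /forallPn[c0 h] : ~~ [forall c, 0 < nC S c]; last by exists c0; move: h; clear; lia.
apply/negP => /forallP h; have : #|C| * q <= \sum_c nC S c.
  rewrite -sum_nat_const; apply: leq_sum => c _; apply: dvdn_leq => //.
  exact: Z011_dvd dq (spairZ SL d011 isT) c.
rewrite -tot_C N cardC leq_pmul2r ?prime_gt0 // leqNgt ltn_neqAle pr andbT.
by rewrite hpr.
Qed.

(** The comparisons [r < p] and [p < q] feed two pigeonholes in [L]: two [cb] fibres in the same
    class, and two second digits of one fibre with the same [cc]. They produce types 010 and 110,
    which make [nIB S i b] independent of [b]; a 101 pair of [S] has such a count at least 2, too
    much for a class of size [q]. *)
Lemma two_contra : False.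
Proof.
have [d101L|n101] := boolP (D L 1 0 1); last exact: two_N101.
have n011 := two_011 d101L; have [N nBE] := two_eq d200 d101; have [_ t001] := half_absent.
have n201 := two_n201 d200 d101.
have uniq x y : x \in L -> y \in L -> ci x = ci y -> cj x = cj y -> cc x = cc y.
  by move=> xL yL e1 e2; ty x y.
have rp : r < p.
  rewrite ltn_neqAle eq_sym hpr /= -cardC -cardJ; have [i0 h] := two_i0 d200 d101.
  have /fin_all_exists[f fP] : forall c, exists x, [/\ x \in L, ci x = i0 & cc x = c].
    by move=> c; apply: nIC_ex.
  apply: (@leq_card _ _ (fun c => cj (f c))) => c c' e.
  have [f1 f2 <-] := fP c; have [g1 g2 <-] := fP c'; apply: uniq => //.
  by rewrite f2.
have d100 : D L 1 0 0.
  by apply: contraTT rp => /two_ple_r; rewrite -leqNgt.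
have n200 := two_100_n200 d100.
have nm b : ~~ multi b by apply/negP => /multi_no100; rewrite d100 => /(_ d200 d101).
have nIq := flat_nIS N (two_flatI d100).
have cls x y : x \in L -> y \in L -> cb x = cb y -> ci x = ci y.
  by move=> xL yL e; ty x y.
have pq : p < q.
  rewrite ltn_neqAle hpq /= -cardI -cardB.
  have [z [w [zw _ _ NE]]] := sq101 (spairZ LS d101 isT).
  have [c1 wc] : exists c, 0 < w c by apply: sum_pos (nd_pos' NE _); rewrite -eN.
  have /fin_all_exists[f fP] : forall i, exists x, [/\ x \in L, ci x = i & cc x = c1].
    by move=> i; apply: nIC_ex; rewrite zw addn_gt0 wc orbT.
  apply: (@leq_card _ _ (fun i => cb (f i))) => i i' e.
  by have [f1 <- _] := fP i; have [g1 <- _] := fP i'; apply: cls.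
have /fin_all_exists[g gP] : forall b, exists x, x \in L /\ cb x = b.
  move=> b; have /cntP[x xL /eqP xb] : 0 < nB L b by rewrite nBE prime_gt0.
  by exists x.
have /injectivePn[b [b' ne ebb]] : ~~ injectiveb (fun b => ci (g b)).
  by apply/negP => /injectiveP/leq_card; rewrite cardI cardB leqNgt pq.
have [gbL gb] := gP b; have [gbL' gb'] := gP b'.
have /fin_all_exists[h hP] : forall j, exists y, [/\ y \in L, cb y = b, ci y = ci (g b) & cj y = j].
  by move=> j; apply: (single_full d200 d101 j gbL gb (nm b)).
have /injectivePn[j1 [j2 nj ec]] : ~~ injectiveb (fun j => cc (h j)).
  by apply/negP => /injectiveP/leq_card; rewrite cardC cardJ leqNgt rp.
have [y [yL yb yi yj]] := single_full d200 d101 j2 gbL' gb' (nm b').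
have [x1L x1b x1i x1j] := hP j1; have [x2L x2b x2i x2j] := hP j2.
have yc : cc (h j2) = cc y by apply: uniq; rewrite // ?x2i ?yi // x2j yj.
have d010 : D L 0 1 0.
  apply: (hasD x2L yL).
  by rewrite /has_type /= x2i yi ebb x2j yj x2b yb yc !eqxx ne.
have d110 : D L 1 1 0.
  apply: (hasD x1L yL).
  by rewrite /has_type /= x1i yi ebb x1j yj x1b yb ec yc !eqxx ne nj.
have nBq b0 : nB S b0 = p.
  have := Z010 (spairZ SL d010 isT) => e; have := tot_B S.
  rewrite (@sum_const _ _ (nB S b0)) // N cardB mulnC => /eqP.
  by rewrite eqn_pmul2l ?prime_gt0 // => /eqP.
have [x [v [uv uE vE _]]] := sq110 (spairZ SL d110 isT).
have /DP[s [t [sS tS /and3P[/andP[/eqP e1 e2] /eqP e3 e4]]]] := d101; rewrite /= in e4.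
have two : 1 < nIB S (ci s) (cb s).
  apply: (cnt_gt1 sS tS); rewrite ?eqxx ?e1 ?e3 ?eqxx //.
  by apply: contraNneq e4 => ->.
have vv b0 : v b0 = v (cb s).
  have := nBq b0; rewrite -(nBq (cb s)) !vE => /addnI/eqP.
  by rewrite eqn_pmul2l ?prime_gt0 // => /eqP.
have := nIq (ci s); rewrite nI_B (@sum_const _ _ (nIB S (ci s) (cb s))).
  by rewrite cardB; move: two (q_gt1); clear; nia.
by move=> b0; rewrite !uv vv.
Qed.
End TwoHundred2.

(** * Types 101 and 201 in [S], without 100 and 200 *)

Section OneTwo.
Hypotheses (d101 : D S 1 0 1) (d201 : D S 2 0 1).
Hypotheses (n100 : ~~ D S 1 0 0) (n200 : ~~ D S 2 0 0).

Let z101 : Z L 1 0 1. Proof. exact: (spairZ LS d101 isT). Qed.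
Let z201 : Z L 2 0 1. Proof. exact: (spairZ LS d201 isT). Qed.

(** Otherwise a cell [(i, j)] of [L] sees at most one value of [cc], so [u = 0] and the second
    digits are equidistributed. Then the first digits are not, some class meets all values of [cc],
    and two of these fall over one [(i, j)]. *)
Lemma one_two_011 : D L 0 1 1.
Proof.
have [_ t001] := half_absent; apply: contraT => n011.
have [c _] := inhC; have [c' cc'] := otherC c.
have full i j : ~ (0 < nJC L i j c /\ 0 < nJC L i j c').
  move=> [/nJC_ex[x [xS x1 x2 x3]] /nJC_ex[y [yS y1 y2 y3]]].
  by subst; ty x y.
have fL : flatJ L.
  move=> i j j'; have [u [v [uv uE _ _]]] := sq201 i z201; rewrite !uE.
  have u0 j0 : u j0 = 0.
    apply/eqP; rewrite -leqn0 leqNgt; apply/negP => h.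
    by apply: (full i j0); rewrite !uv !addn_gt0 h.
  by rewrite !u0.
have [z [w [zw zE _ _]]] := sq101 z101.
have /forallPn[i h] : ~~ [forall i, z i == 0].
  by apply/negP => /forallP h; apply: (excL _ fL) => i i'; rewrite !zE !(eqP (h _)).
have [u [v [uv uE vE _]]] := sq201 i z201.
have [j _] := inhJ.
have V c0 : 0 < nJC L i j c0.
  have : 0 < nIC L i c0 by rewrite zw addn_gt0 lt0n h.
  rewrite vE uv !addn_gt0 muln_gt0 => /orP[/sum_pos[j1 h1]|/andP[_ ->]]; last by rewrite orbT.
  by case: (full i j1); rewrite !uv !addn_gt0 h1.
by case: (full i j (conj (V c) (V c'))).
Qed.

Lemma one_two_flat : [/\ D L 1 0 0 || D L 1 0 1 -> flatI S & D L 2 0 0 || D L 2 0 1 -> flatJ S].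
Proof.
have [v [c0 [z _ _ _]]] := thin_011 n100 n200 nr (spairZ SL one_two_011 isT).
split=> /orP[] d.
- exact: Z100 (spairZ SL d isT).
- exact: missing_flatI z (spairZ SL d isT).
- exact: Z200 (spairZ SL d isT).
exact: missing_flatJ z (spairZ SL d isT).
Qed.

(** The counts [nIB L i b] are all one. This excludes 210 from [S], again by confronting
    coefficients [q] and [r], after which [fin_class] applies. *)
Lemma one_two_1 : ~~ (D L 1 0 0 || D L 1 0 1) -> False.
Proof.
rewrite negb_or => /andP[m1 m2]; have [s001 t001] := half_absent.
have le1 i b : nIB L i b <= 1.
  by apply: cnt_le1; sub2 x y xS yS e1 e2; apply: coord_inj; ty x y.
have [b|N e] := half_eq.
  by rewrite nB_I -cardI -sum1_card; apply: leq_sum => i _; apply: le1.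
have one i b : nIB L i b = 1.
  by apply: (@sum_bound _ (fun i => nIB L i b) 1) => //; rewrite -nB_I e cardI muln1.
have nIq i : nI L i = q by rewrite nI_B (@sum_const _ _ 1) // cardB muln1.
have fI : flatI L by move=> i i'; rewrite !nIq.
have flS : flatJ S.
  apply: (one_two_flat.2); have [b _] := inhB; have : 1 < nB L b by rewrite e p_gt1.
  move=> /card_gt1P[x [y [xS yS xy]]].
  move: xS yS; rewrite !inE => /andP[xS /eqP xb] /andP[yS /eqP yb]; rewrite -yb in xb.
  have ne' : ci x != ci y.
    by apply: contra xy => /eqP h; apply/eqP; apply: coord_inj; ty x y.
  have [h|h] := eqVneq (cc x) (cc y); apply/orP; [left|right]; apply: (hasD xS yS); ty x y.
have n210 : ~~ D S 2 1 0.
  apply/negP => d; case: inhI => i _.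
  have [u [v [uv uE _ _]]] := sq201 i z201.
  have [x [y [xy xE yE NE]]] := sq210 i (spairZ LS d isT).
  (* A total of 1 has no room for [p * y b]. *)
  have y0 b : y b = 0.
    by have := yE b; rewrite one; have := p_gt1; clear; case: (y b) => // n; nia.
  have Y0 : \sum_b y b = 0 by rewrite big1.
  have X1 : \sum_j x j = 1 by have [b _] := inhB; have := yE b; rewrite one y0 muln0 addn0.
  have [j1 xj1] : exists j, 0 < x j by apply: sum_pos; rewrite X1.
  have [j0 ne] := otherJ j1.
  have [xj0 xj1'] : x j0 = 0 /\ x j1 = 1.
    by have := sum_ge2 x ne; rewrite X1; move: xj1; clear; lia.
  have V0 : \sum_c v c = 0.
    have := uE j0; rewrite xE xj0 Y0 muln0 addn0 => /eqP.
    by rewrite eq_sym addn_eq0 => /andP[_ /eqP].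
  have : r %| q.
    by have := uE j1; rewrite xE Y0 V0 !addn0 xj1' muln1 => ->; rewrite dvdn_mulr.
  by apply/negP; rewrite prime_ndvd // eq_sym.
have /DP[s1 [s2 [s1S s2S /and3P[ne /eqP eb nc]]]] := d201; rewrite /= in ne nc.
apply: (fin_class N (Z011_dvd dq (spairZ SL one_two_011 isT)) _ (flatJ_dvd flS) s1S s2S ne).
by move=> x y xS yS e1; ty x y.
Qed.

(** Here the second digit is injective on [cb] fibres of [L], so these have [p] points and contain
    all second digits; once 101 is excluded from [L], this is the invariance wanted by
    [invariant_contra]. *)
Lemma one_two_2 : ~~ (D L 2 0 0 || D L 2 0 1) -> False.
Proof.
rewrite negb_or => /andP[m1 m2]; have [s001 t001] := half_absent.
have inj b x y : x \in L -> y \in L -> cb x = b -> cb y = b -> cj x = cj y -> x = y.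
  by move=> xL yL xb yb e; rewrite -yb in xb; apply: coord_inj; ty x y.
have [b|N e] := half_eq.
  rewrite -cardJ; apply: (@cnt_le_inj _ _ _ (@fJ K)) => x y xS yS /eqP e1 /eqP e2 e3.
  exact: inj xS yS e1 e2 e3.
have fS : flatI S.
  apply: (one_two_flat.1); have [b _] := inhB; have : 1 < nB L b by rewrite e p_gt1.
  move=> /card_gt1P[x [y [xS yS xy]]].
  move: xS yS; rewrite !inE => /andP[xS /eqP xb] /andP[yS /eqP yb]; rewrite -yb in xb.
  have ne' : cj x != cj y.
    by apply: contra xy => /eqP h; apply/eqP; apply: inj h.
  have [h|h] := eqVneq (cc x) (cc y); apply/orP; [left|right]; apply: (hasD xS yS); ty x y.
have n101 : ~~ D L 1 0 1.
  apply/negP => d.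
  have [v [c0 [z vE v1 /sum_pos[c vc]]]] := thin_011 n100 n200 nr (spairZ SL one_two_011 isT).
  have {}vc : v c = 1 by apply/eqP; rewrite eqn_leq v1.
  have nCq : nC S c = q.
    by rewrite nC_B (@sum_const _ _ 1) ?cardB ?muln1 // => b; rewrite vE.
  have : p %| q.
    have [i _] := inhI; rewrite -nCq nC_I (@sum_const _ _ (nIC S i c)) ?cardI ?dvdn_mulr // => i'.
    exact: missing_101 z (spairZ SL d isT) _ _ _.
  by apply/negP; rewrite prime_ndvd.
apply: (invariant_contra N fS d101 one_two_011) => x j xL.
have [|y [yL /eqP yb yj]] := @full_fibre L (fun y => cb y == cb x) (e (cb x)) _ j.
  by move=> s t sL tL /eqP e1 /eqP e2 e3; apply: inj sL tL e1 e2 e3.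
by exists y; split=> //; ty y x.
Qed.

Lemma one_two_contra : False.
Proof.
have [h|h] := boolP (D L 1 0 0 || D L 1 0 1); last exact: one_two_1.
have [h'|h'] := boolP (D L 2 0 0 || D L 2 0 1); last exact: one_two_2.
exact: excS (one_two_flat.1 h) (one_two_flat.2 h').
Qed.
End OneTwo.

(** The box with a fixed first digit is spoiled by 100 and 101, the box with a fixed second digit by
    200 and 201. The contradictions above show that one of them always works. *)
Lemma half_tile : S != set0 -> box_tile S.
Proof.
move=> S0; have [s001 t001] := half_absent.
have dvd : p * q %| #|S| by rewrite Gauss_dvd ?dp ?dq // prime_coprime // prime_ndvd.
have [n1|d1] := boolP (~~ D S 1 0 0 && ~~ D S 1 0 1).
  case/andP: n1 => n1 n2; apply: (@packs_tile S false true false true) => //.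
    by move=> x y xS yS h; rewrite /compat /= in h; apply: coord_inj; ty x y.
  by rewrite /= addn0 !expn1 expn0 muln1.
suff /andP[n1 n2] : ~~ D S 2 0 0 && ~~ D S 2 0 1.
  apply: (@packs_tile S true false false true) => //.
    by move=> x y xS yS h; rewrite /compat /= in h; apply: coord_inj; ty x y.
  by rewrite /= add0n !expn1 expn0 muln1.
rewrite negb_and !negbK in d1; case/orP: d1 => d.
  apply/andP; split; apply/negP => d'; last exact: (half_100_201 d d').
  exact: (excL (Z100 (spairZ LS d isT)) (Z200 (spairZ LS d' isT))).
apply/andP; split; apply/negP => d'; first exact: (two_contra d' d).
have [h|h] := boolP (D S 1 0 0); first exact: (half_100_201 h d').
have [h'|h'] := boolP (D S 2 0 0); first exact: (two_contra h' d).
exact: (one_two_contra d d' h h').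
Qed.
End HalfP.

(** * Size prime to q and r *)

Section NoQR.
Variables S L : {set X}.
Hypothesis SL : spair S L.
Hypotheses (nq : ~~ (q %| #|S|)) (nr : ~~ (r %| #|S|)).
Hypothesis d011 : D L 0 1 1.

Let eN : #|S| = #|L|. Proof. by case: SL. Qed.
Let LS : spair L S. Proof. exact: spair_sym. Qed.
Let s010 : ~~ D S 0 1 0. Proof. by apply: (no010 LS); rewrite -eN. Qed.
Let t010 : ~~ D L 0 1 0. Proof. exact: (no010 SL). Qed.
Let s001 : ~~ D S 0 0 1. Proof. by apply: (no001 LS); rewrite -eN. Qed.
Let t001 : ~~ D L 0 0 1. Proof. exact: (no001 SL). Qed.

(** Neither [q] nor [r] divides the size, so both sums are positive: the projection of [S] to
    [(cb, cc)] contains a full row and a full column. *)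
Lemma cross : exists u v b0 c0, [/\ forall b c, nBC S b c = u b + v c,
  0 < u b0, 0 < v c0 & #|S| = r * (\sum_b u b) + q * (\sum_c v c)].
Proof.
have [u [v [uv _ _ NE]]] := sq011 (spairZ SL d011 isT).
have [b0 ub] := sum_pos (nd_pos NE nq); have [c0 vc] := sum_pos (nd_pos' NE nr).
by exists u, v, b0, c0.
Qed.

Lemma cross_lines : exists b0 c0, (forall c, exists x, [/\ x \in S, cb x = b0 & cc x = c]) /\
  (forall b, exists x, [/\ x \in S, cb x = b & cc x = c0]).
Proof.
have [u [v [b0 [c0 [uv ub vc _]]]]] := cross; exists b0, c0.
by split=> [c|b]; apply: nBC_ex; rewrite uv addn_gt0 ?ub ?vc ?orbT.
Qed.

Lemma single_class_Z110 i : (forall x, x \in S -> ci x = i) -> ~ Z S 1 1 0.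
Proof.
move=> single /Z110 h; have [i' ii'] := otherI i; case/negP: nq.
have z b : nIB S i' b = 0.
  by apply: cnt_eq0 => x /single->; rewrite eq_sym (negPf ii').
have nBE b : nB S b = nIB S i b.
  by apply: eq_card => x; rewrite !inE; case: (boolP (x \in S)) => // /single->; rewrite eqxx.
case: inhB => b _; rewrite tot_B (@sum_const _ _ (nB S b)) ?cardB ?dvdn_mulr // => b'.
by have := h i i' b' b; rewrite !nBE !z !addn0.
Qed.

Section BothAbsent.
Hypotheses (n210 : ~~ D S 2 1 0) (n201 : ~~ D S 2 0 1).

(** Without 210 and 201, points at different places of a row or column of the [(cb, cc)] grid share
    their class, and the full row and column connect all points. *)
Lemma absent_single : exists i0, forall x, x \in S -> ci x = i0.
Proof.
have [u [v [b0 [c0 [uv ub vc _]]]]] := cross.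
have sameC x y : x \in S -> y \in S -> cc x = cc y -> cb x != cb y -> ci x = ci y.
  by move=> xS yS e1 e2; ty x y.
have sameB x y : x \in S -> y \in S -> cb x = cb y -> cc x != cc y -> ci x = ci y.
  by move=> xS yS e1 e2; ty x y.
have [b1 bb1] := otherB b0.
have [e1 [e1S e1b e1c]] : exists x, [/\ x \in S, cb x = b1 & cc x = c0].
  by apply: nBC_ex; rewrite uv addn_gt0 vc orbT.
have [e0 [e0S e0b e0c]] : exists x, [/\ x \in S, cb x = b0 & cc x = c0].
  by apply: nBC_ex; rewrite uv addn_gt0 vc orbT.
exists (ci e1).
have corner z : z \in S -> cb z = b0 -> cc z = c0 -> ci z = ci e1.
  by move=> zS zb zc; apply: sameC; rewrite ?zc ?e1c // zb e1b eq_sym.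
have lineC z : z \in S -> cc z = c0 -> ci z = ci e1.
  move=> zS zc; have [h|h] := eqVneq (cb z) b0; first exact: corner.
  by rewrite -(corner e0) //; apply: sameC; rewrite ?zc ?e0c // e0b.
have lineB z : z \in S -> cb z = b0 -> ci z = ci e1.
  move=> zS zb; have [h|h] := eqVneq (cc z) c0; first exact: corner.
  by rewrite -(corner e0) //; apply: sameB; rewrite ?zb ?e0b // e0c.
move=> z zS; have := nBC_pos zS; rewrite uv addn_gt0 => /orP[h|h].
  have [w [wS wb wc]] : exists x, [/\ x \in S, cb x = cb z & cc x = c0].
    by apply: nBC_ex; rewrite uv addn_gt0 h.
  have [e|ne] := eqVneq (cc z) c0; first exact: lineC.
  by rewrite -(lineC w) //; apply: sameB; rewrite ?wb // wc.
have [w [wS wb wc]] : exists x, [/\ x \in S, cb x = b0 & cc x = cc z].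
  by apply: nBC_ex; rewrite uv addn_gt0 h orbT.
have [e|ne] := eqVneq (cb z) b0; first exact: lineB.
by rewrite -(lineB w) //; apply: sameC; rewrite ?wc // wb.
Qed.

(** In a single class the second digit is injective, so [S] has at most [p] points. But 110 in [S]
    gives [L] exactly [p] points over each value of [cb] that occurs, and at least two values occur
    by 011. *)
Lemma absent_contra : False.
Proof.
have [i0 single] := absent_single; have [b0 [c0 [lineB lineC]]] := cross_lines.
have totE : #|S| = nI S i0.
  rewrite -cnt_true; apply: eq_card => x; rewrite !inE.
  by case: (boolP (x \in S)) => // /single->; rewrite eqxx.
have [x0 [x0S _ _]] := lineB c0.
have Nt100 : ~~ D L 1 0 0.
  apply/negP => d; have [i' ii'] := otherI i0.
  have : nI S i0 = 0.
    rewrite (Z100 (spairZ SL d isT) i0 i'); apply: cnt_eq0 => x /single->.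
    by rewrite eq_sym (negPf ii').
  by rewrite -totE => /eqP; rewrite cards_eq0 => /eqP h; rewrite h inE in x0S.
have t101 : ~~ D L 1 0 1.
  by apply/negP => d; case/negP: nr; apply: single_class_no101 single (spairZ SL d isT).
have t110 : ~~ D L 1 1 0.
  by apply/negP => d; apply: (single_class_Z110 single (spairZ SL d isT)).
have cls x y : x \in S -> y \in S -> ci x = ci y by move=> xS yS; rewrite !single.
have d110 : D S 1 1 0.
  have [b1 ne] := otherB b0; have [x [xS xb xc]] := lineC b0; have [y [yS yb yc]] := lineC b1.
  have e := cls x y xS yS; apply: (hasD xS yS); rewrite -xb -yb in ne; rewrite -yc in xc.
  by ty x y.
have [y [xy xE yE NE]] : exists y, [/\ forall i b, nIB L i b = y b,
    forall b, y b <= 1, 0 < \sum_b y b & #|L| = p * \sum_b y b].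
  have [x [y [xy _ _ NE]]] := sq110 (spairZ LS d110 isT).
  have le1 i b : nIB L i b <= 1.
    by apply: cnt_le1; sub2 s t sS tS e1 e2; apply: coord_inj; ty s t.
  have Y0 : 0 < \sum_b y b by apply: nd_pos' NE _; rewrite -eN.
  have [b yb] := sum_pos Y0.
  have z i : x i = 0 by have := le1 i b; rewrite xy; move: yb; clear; lia.
  exists y; split=> // [i b'|b'|]; first by rewrite xy z.
    by have [i _] := inhI; have := le1 i b'; rewrite xy z.
  by rewrite NE big1 ?muln0.
have t201 : ~~ D L 2 0 1.
  apply/negP => d; case/negP: nr.
  have [x [w [xw _ _ NE']]] := sq201 i0 (spairZ SL d isT).
  have le1 j c : nJC S i0 j c <= 1.
    apply: cnt_le1 => s t sS tS /and3P[/eqP e1 /eqP<- /eqP<-] /and3P[/eqP e2 /eqP e3 /eqP e4].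
    by rewrite -e2 in e1; apply: coord_inj; ty s t.
  rewrite totE; have [W0|/sum_pos[c wc]] := posnP (\sum_c w c).
    by rewrite NE' W0 muln0 addn0 dvdn_mulr.
  have z j : x j = 0 by have := le1 j c; rewrite xw; move: wc; clear; lia.
  rewrite NE' big1 // muln0 add0n (@sum_const _ _ 1) ?cardC ?muln1 ?dvdn_mull // => c'.
  have [s [sS _ sc]] := lineB c'; have := nJC_pos sS.
  rewrite (single s sS) sc => h; have := le1 (cj s) c'; rewrite xw z in h *.
  by move: h; clear; lia.
have sameBC x y' : x \in L -> y' \in L -> cb x = cb y' -> cc x = cc y'.
  by move=> xS yS e; ty x y'.
have s011 : ~~ D S 0 1 1.
  apply/negP => d; have [u' [v' [uv' _ _ NE']]] := sq011 (spairZ LS d isT).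
  have [b ub] : exists b, 0 < u' b by apply: sum_pos (nd_pos NE' _); rewrite -eN.
  have [c1 cc1] := otherC c0.
  have [s [sL sb sc]] : exists x, [/\ x \in L, cb x = b & cc x = c0].
    by apply: nBC_ex; rewrite uv' addn_gt0 ub.
  have [t [tL tb tc]] : exists x, [/\ x \in L, cb x = b & cc x = c1].
    by apply: nBC_ex; rewrite uv' addn_gt0 ub.
  by case/eqP: cc1; rewrite -sc -tc; apply: sameBC; rewrite // sb.
have Np : #|S| <= p.
  rewrite -cnt_true -cardJ; apply: (@cnt_le_inj _ _ _ (@fJ K)) => x y' xS yS _ _ e.
  by have e' := cls x y' xS yS; apply: coord_inj; ty x y'.
have /DP[s [t [sL tL /and3P[_ ne _]]]] := d011.
have ys : 0 < y (cb s) by rewrite -(xy (ci s)) nIB_pos.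
have yt : 0 < y (cb t) by rewrite -(xy (ci t)) nIB_pos.
have := sum_ge2 y ne; move: Np ys yt p_gt1; rewrite eN NE; clear; nia.
Qed.

End BothAbsent.

Lemma nJB_le1 i j b : nJB L i j b <= 1.
Proof.
by apply: cnt_le1 => s t sS tS /and3P[/eqP<- /eqP<- /eqP<-] /and3P[/eqP e1 /eqP e2 /eqP e3];
  apply: coord_inj; ty s t.
Qed.

Lemma nJC_le1 i j c : nJC L i j c <= 1.
Proof.
by apply: cnt_le1 => s t sS tS /and3P[/eqP<- /eqP<- /eqP<-] /and3P[/eqP e1 /eqP e2 /eqP e3];
  apply: coord_inj; ty s t.
Qed.

Definition columnB i := forall j j' b, nJB L i j b = nJB L i j' b.
Definition columnC := forall i j j' c, nJC L i j c = nJC L i j' c.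

Lemma sq210_le1 i : D S 2 1 0 ->
  (exists2 X, 0 < X & (forall b, nIB L i b = X) /\ nI L i = q * X) \/ columnB i.
Proof.
move=> d; have [x [y [xy _ yE NE]]] := sq210 i (spairZ LS d isT).
have [X0|X0] := posnP (\sum_j x j); [right|left].
  by move=> j j' b; rewrite !xy !(sum_eq0 X0).
exists (\sum_j x j); rewrite // NE; have [j xj] := sum_pos X0.
have y0 b : y b = 0 by have := nJB_le1 i j b; rewrite xy; move: xj; clear; lia.
by rewrite [X in p * X]big1 // muln0 addn0; split=> // b; rewrite yE y0 muln0 addn0.
Qed.

(** If some [x j] is positive, then [q * x j = r * u j + V] with [x j <= 1]. As [r] does not divide
    [q], [V] is positive; cells of at most one point then give [u = 0], so [x] is constant. *)
Lemma column_210_201 : D S 2 1 0 -> D S 2 0 1 -> forall i, columnB i.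
Proof.
move=> d d' i j j' b.
have [x [y [xy xE _ NE]]] := sq210 i (spairZ LS d isT).
have [u [v [uv uE _ _]]] := sq201 i (spairZ LS d' isT).
have [X0|/sum_pos[j1 xj1]] := posnP (\sum_j x j); first by rewrite !xy !(sum_eq0 X0).
have y0 b' : y b' = 0 by have := nJB_le1 i j1 b'; rewrite xy; move: xj1; clear; lia.
have x1 j2 : x j2 <= 1 by have := nJB_le1 i j2 b; rewrite xy y0 addn0.
have xj11 : x j1 = 1 by apply/eqP; rewrite eqn_leq x1.
have Y0 : \sum_b y b = 0 by rewrite big1.
have e j2 : q * x j2 = r * u j2 + \sum_c v c by rewrite -uE xE Y0 addn0.
have V0 : \sum_c v c = 0 -> False.
  move=> V0; have := e j1; rewrite xj11 muln1 V0 addn0 => qr.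
  by have : ~~ (r %| q) by [rewrite prime_ndvd // eq_sym]; rewrite qr dvdn_mulr.
have [Vz|/sum_pos[c vc]] := posnP (\sum_c v c); first by case: (V0 Vz).
have u0 j2 : u j2 = 0 by have := nJC_le1 i j2 c; rewrite uv; move: vc; clear; lia.
have xx j2 : x j2 = x j1.
  have := e j2; have := e j1; rewrite !u0 !muln0 !add0n => <- /eqP.
  by rewrite eqn_pmul2l ?prime_gt0 // => /eqP.
by rewrite !xy (xx j) (xx j').
Qed.

(** The square rule descends to [beta] and puts [p ^ 2] points of [L] over each value of [cb] that
    occurs, at least two of them. Type 011 in [S] would leave no value of [cb] empty; without it the
    two digits are injective on [S], which is then too small. *)
Lemma column_no110 : (forall i, columnB i) -> ~~ D S 1 1 0.
Proof.
move=> col; apply/negP => d110; have [j0 _] := inhJ.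
pose beta i b := nJB L i j0 b.
have bE i b : nIB L i b = p * beta i b.
  by rewrite nIB_J (@sum_const _ _ (beta i b)) ?cardJ // => j; apply: col.
have sq : square beta.
  move=> i i' b b'; have := Z110 (spairZ LS d110 isT) i i' b b'.
  rewrite !bE -!mulnDr => /eqP; by rewrite eqn_pmul2l ?prime_gt0 // => /eqP.
have [i0 _] := inhI; have [b1 _] := inhB.
have [x [y [xy _ _ NE]]] := square_sums i0 b1 sq.
have N : #|L| = p * (q * (\sum_i x i) + p * (\sum_b y b)).
  rewrite -cardB -{2}cardI -NE tot_IB big_distrr; apply: eq_bigr => i _.
  by rewrite big_distrr; apply: eq_bigr => b _; rewrite bE.
have Y0 : 0 < \sum_b y b.
  rewrite lt0n; apply/negP => /eqP Y0; case/negP: nq.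
  by rewrite eN N Y0 muln0 addn0 mulnCA dvdn_mulr.
have [b yb] := sum_pos Y0.
have x0 i : x i = 0 by have := nJB_le1 i j0 b; rewrite -/(beta i b) xy; move: yb; clear; lia.
have be i b' : beta i b' = y b' by rewrite xy x0.
have y1 b' : y b' <= 1 by rewrite -(be i0) nJB_le1.
rewrite [X in q * X]big1 // muln0 add0n in N.
have [bs ybs] : exists b, y b = 0.
  have /forallPn[bs h] : ~~ [forall b, 0 < y b]; last by exists bs; move: h; clear; lia.
  apply/negP => /forallP h; case/negP: nq; rewrite eN N (@sum_const _ _ 1).
    by rewrite cardB muln1 mulnA dvdn_mull.
  by move=> b'; apply/eqP; rewrite eqn_leq y1 h.
have yp z : z \in L -> 0 < y (cb z).
  by move=> zL; have := nIB_pos zL; rewrite bE be muln_gt0 => /andP[].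
have [d|n011] := boolP (D S 0 1 1).
  have [u [v [uv _ _ NE']]] := sq011 (spairZ LS d isT).
  have [c vc] : exists c, 0 < v c by apply: sum_pos (nd_pos' NE' _); rewrite -eN.
  have /nBC_ex[z [zL zb _]] : 0 < nBC L bs c by rewrite uv addn_gt0 vc orbT.
  by have := yp z zL; rewrite zb ybs.
have Np : #|S| <= p * p.
  rewrite -cnt_true -{1}cardI -cardJ -card_prod.
  apply: (@cnt_le_inj _ _ _ (fun x => (ci x, cj x))) => z z' zS zS' _ _ [e1 e2].
  by apply: coord_inj; ty z z'.
have /DP[s [t [sL tL /and3P[_ ne _]]]] := d011.
have := sum_ge2 y ne; move: Np (yp s sL) (yp t tL) p_gt1; rewrite eN N; clear; nia.
Qed.

(** * Classes of [L] invariant in the second digit *)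

Section CaseA.
Hypotheses (n110 : ~~ D S 1 1 0) (n101 : ~~ D S 1 0 1).
Hypotheses (colB : forall i, columnB i) (colC : columnC).

(** Some class of [S] meets every [b], and without 010 and 110 the values of [cc] met are distinct.
    Exchanging [q] and [r] will give the reverse inequality. *)
Lemma class_q_le_r : Z S 1 1 0 -> q <= r.
Proof.
move=> /sq110[z [w [zw _ _ _]]]; have [b0 [c0 [_ lineC]]] := cross_lines.
have [i full] : exists i, forall b, 0 < nIB S i b.
  have [Z0|/sum_pos[i zi]] := posnP (\sum_i z i); last by exists i => b; rewrite zw addn_gt0 zi.
  have [i _] := inhI; exists i => b; rewrite zw (sum_eq0 Z0).
  have [x [xS xb _]] := lineC b; have := nIB_pos xS.
  by rewrite zw (sum_eq0 Z0) xb.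
have /fin_all_exists[f fP] : forall b, exists x, [/\ x \in S, ci x = i & cb x = b].
  by move=> b; apply: nIB_ex.
rewrite -cardB -cardC; apply: (@leq_card _ _ (fun b => cc (f b))) => b b' e.
have [f1 f2 <-] := fP b; have [g1 g2 <-] := fP b'; rewrite -f2 in g2.
by ty (f b) (f b').
Qed.

(** Give [x] the second digit of [y] while keeping [cc]: the resulting [z] cannot keep [cb], since
    it would differ from [y] by type 001. *)
Lemma caseA_110 : D L 1 0 1 -> D L 1 1 0.
Proof.
case/DP => [x [y [xL yL /and3P[/andP[/eqP e1 e2] /eqP e3 e4]]]].
have /nJC_ex[z [zL z1 z2 z3]] : 0 < nJC L (ci x) (cj y) (cc x).
  by rewrite (colC _ _ (cj x)) nJC_pos.
apply: (hasD xL zL); have h : cb z != cb x.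
  apply/negP => /eqP h; have yz : cc y = cc z.
    rewrite e1 in z1; rewrite e3 in h; by ty y z.
  by case/eqP: e4; rewrite yz.
rewrite -z2 in e2; clear z2; by ty x z.
Qed.

(** Sliding a point of a 011 pair along its column gives 111 in [L], so classes of [S] obey the
    square rule. A class of size not divisible by [r] then has two points with equal [cc] and
    distinct [cb]. *)
Lemma caseA_n101 : ~~ D L 1 0 1 -> False.
Proof.
move=> m101.
have d111 : D L 1 1 1.
  have /DP[x [y [xL yL /and3P[/andP[/eqP e1 /eqP e2] e3 e4]]]] := d011; rewrite /= in e3 e4.
  have [j jx] := otherJ (cj x).
  have /nJB_ex[z [zL z1 z2 z3]] : 0 < nJB L (ci y) j (cb y).
    by rewrite (colB _ _ (cj y)) nJB_pos.
  have z4 : cc z = cc y by ty z y.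
  apply: (hasD xL zL); rewrite -z2 in jx; rewrite -z3 in e3; rewrite -z4 in e4.
  by rewrite -z1 in e1; ty x z.
have sq := inv_square (spairZ SL d011 isT) (spairZ SL d111 isT).
have [i ni] : exists i, ~~ (r %| nI S i).
  by apply/forallPn; apply: contra nr => /forallP h; rewrite tot_I dvdn_sum.
have [b0 _] := inhB; have [c1 _] := inhC.
have [u [v [uv _ _]]] := square_sums b0 c1 (sq i).
rewrite -nI_BC cardB cardC => NE; have [c vc] := sum_pos (nd_pos' NE ni).
have [b1 bb] := otherB b0.
have /nIBC_ex[x [xS x1 x2 x3]] : 0 < nIBC S i b0 c by rewrite uv addn_gt0 vc orbT.
have /nIBC_ex[y [yS y1 y2 y3]] : 0 < nIBC S i b1 c by rewrite uv addn_gt0 vc orbT.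
by subst; ty x y.
Qed.
End CaseA.

(** * Type 210 without 201 in [S] *)

Section CaseB.
Hypotheses (d210 : D S 2 1 0) (n201 : ~~ D S 2 0 1).

(** A class with constant positive [nIB L i] would break the square rule against a class of size not
    divisible by [q], which has both empty and nonempty values of [cb]. So all classes are
    columns. *)
Lemma caseB_no110 : ~~ D S 1 1 0.
Proof.
apply/negP => d110.
have noX i X : 0 < X -> (forall b, nIB L i b = X) -> False.
  move=> X0 iX.
  have [i2 ni2] : exists i, ~~ (q %| nI L i).
    by apply/forallPn; apply: contra nq => /forallP h; rewrite eN tot_I dvdn_sum.
  have [x [y [xy _ yE NE]]] := sq210 i2 (spairZ LS d210 isT).
  have [b yb] := sum_pos (nd_pos' NE ni2).
  have x0 j : x j = 0 by have := nJB_le1 i2 j b; rewrite xy; move: yb; clear; lia.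
  have X0' : \sum_j x j = 0 by rewrite big1.
  have [j0 _] := inhJ.
  have y1 b' : y b' <= 1 by have := nJB_le1 i2 j0 b'; rewrite xy x0.
  have [bs ybs] : exists b, y b = 0.
    have /forallPn[bs h] : ~~ [forall b, 0 < y b]; last by exists bs; move: h; clear; lia.
    apply: contra ni2 => /forallP h; rewrite NE X0' (@sum_const _ _ 1).
      by rewrite cardB muln1 muln0 add0n dvdn_mull.
    by move=> b'; apply/eqP; rewrite eqn_leq y1 h.
  have := Z110 (spairZ LS d110 isT) i i2 b bs; rewrite !iX !yE X0' ybs muln0 !add0n addn0.
  by move: yb p_gt1; clear; nia.
have col i : columnB i.
  by have [[X X0 [iX _]]|//] := sq210_le1 i d210; case: (noX i X X0 iX).
by move/negP: (column_no110 col).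
Qed.

(** A row with [u b > 0] coincides with a class of [S], and there are fewer rows than classes
    because [q < p]. Since [L] has 100 or 101, counting by rows and by classes disagrees. *)
Lemma caseB_contra : False.
Proof.
have n110 := caseB_no110.
have [u [v [b0 [c0 [uv ub vc NE]]]]] := cross.
have sameC x y : x \in S -> y \in S -> cc x = cc y -> ci x = ci y -> cb x = cb y.
  by move=> xS yS e1 e2; ty x y.
have sameB x y : x \in S -> y \in S -> cb x = cb y -> cc x != cc y -> ci x = ci y.
  by move=> xS yS e1 e2; ty x y.
have qp : q < p.
  rewrite ltn_neqAle eq_sym hpq /= -cardB -cardI.
  have /fin_all_exists[f fP] : forall b, exists x, [/\ x \in S, cb x = b & cc x = c0].
    by move=> b; apply: nBC_ex; rewrite uv addn_gt0 vc orbT.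
  apply: (@leq_card _ _ (fun b => ci (f b))) => b b' e.
  have [f1 f2 f3] := fP b; have [g1 g2 g3] := fP b'; rewrite -f2 -g2.
  by apply: sameC; rewrite // f3 g3.
have line b c : 0 < u b -> exists x, [/\ x \in S, cb x = b & cc x = c].
  by move=> h; apply: nBC_ex; rewrite uv addn_gt0 h.
have oneclass b : 0 < u b -> exists i, forall z, z \in S -> (ci z == i) = (cb z == b).
  move=> h; have [x [xS xb xc]] := line b c0 h.
  have lineB z : z \in S -> cb z = b -> ci z = ci x.
    move=> zS zb; have [e|ne] := eqVneq (cc z) c0; last by apply: sameB; rewrite // ?zb ?xc.
    have [c1 cc1] := otherC c0; have [t [tS tb tc]] := line b c1 h.
    transitivity (ci t); first by apply: sameB; rewrite ?zb ?tb // e tc eq_sym.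
    by apply: sameB; rewrite ?tb ?xb // tc xc.
  exists (ci x) => z zS; apply/eqP/eqP => [e|]; last exact: lineB.
  have [t [tS tb tc]] := line b (cc z) h.
  by rewrite -tb; apply: sameC => //; rewrite e (lineB t).
have S0 : 0 < #|S| by have [x [xS _ _]] := line b0 c0 ub; rewrite card_gt0; apply/set0Pn; exists x.
have [d|d] : D L 1 0 0 \/ D L 1 0 1.
  have [i ni] : exists i, ~~ (q %| nI L i).
    by apply/forallPn; apply: contra nq => /forallP h; rewrite eN tot_I dvdn_sum.
  have [x [y [xy _ _ NE']]] := sq210 i (spairZ LS d210 isT).
  have [b yb] := sum_pos (nd_pos' NE' ni).
  have [j _] := inhJ; have [j' jj] := otherJ j.
  have /nJB_ex[s [sL s1 s2 s3]] : 0 < nJB L i j b by rewrite xy addn_gt0 yb orbT.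
  have /nJB_ex[t [tL t1 t2 t3]] : 0 < nJB L i j' b by rewrite xy addn_gt0 yb orbT.
  subst; have [e|e] := eqVneq (cc s) (cc t); [left|right]; apply: (hasD sL tL); by ty s t.
- have fS := Z100 (spairZ SL d isT).
  have nBle b : nB S b <= nB S b0.
    have nBE b' : nB S b' = r * u b' + \sum_c v c.
      by rewrite nB_C; under eq_bigr do rewrite uv; rewrite big_split /= sum_nat_const cardC.
    have [z|h] := posnP (u b); first by rewrite !nBE z muln0 add0n leq_addl.
    have [i iE] := oneclass b h; have [i' iE'] := oneclass b0 ub.
    have e : nB S b = nI S i
      by apply: eq_card => x; rewrite !inE; case: (boolP (x \in S)) => // /iE->.
    have e' : nB S b0 = nI S i'
      by apply: eq_card => x; rewrite !inE; case: (boolP (x \in S)) => // /iE'->.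
    by rewrite e e' (fS i i').
  have [i iE] := oneclass b0 ub.
  have e : nB S b0 = nI S i
      by apply: eq_card => x; rewrite !inE; case: (boolP (x \in S)) => // /iE->.
  have : #|S| <= #|B| * nB S b0.
    by rewrite tot_B -sum_nat_const; apply: leq_sum => b _; apply: nBle.
  rewrite cardB; have := flatIE fS i; rewrite -e => eS; move: S0 qp; rewrite eS; clear; nia.
have sq1 := Z011 (spairZ SL d011 isT); have sq2 := Z101 (spairZ SL d isT).
have [i iE] := oneclass b0 ub.
have e c : nBC S b0 c = nIC S i c.
  by apply: eq_card => x; rewrite !inE; case: (boolP (x \in S)) => // /iE->.
case/negP: nr; rewrite tot_C (@sum_const _ _ (nC S c0)) ?cardC ?dvdn_mulr // => c.
(* The same variation of [nC S] is computed with factor [q] over rows and with factor [p] over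
   classes; it must vanish, so [r] divides the size. *)
have h1 : nC S c + q * nBC S b0 c0 = nC S c0 + q * nBC S b0 c.
  rewrite !nC_B -cardB -!sum_nat_const -!big_split /=; apply: eq_bigr => b _.
  by rewrite sq1 addnC addnC.
have h2 : nC S c + p * nBC S b0 c0 = nC S c0 + p * nBC S b0 c.
  rewrite !nC_I !e -cardI -!sum_nat_const -!big_split /=; apply: eq_bigr => b _.
  by rewrite sq2 addnC addnC.
by move: h1 h2 qp; clear; nia.
Qed.
End CaseB.

End NoQR.
End Coordinates.

(** * Exchanging [q] and [r] *)

Lemma has_type_swap (X I J B C : finType) (ci : X -> I) (cj : X -> J) (cb : X -> B)
  (cc : X -> C) tp tq tr x y :
  has_type ci cj cc cb tp tq tr x y = has_type ci cj cb cc tp tr tq x y.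
Proof. by rewrite /has_type [X in _ && X]andbC. Qed.

Lemma D_swap (X I J B C : finType) (ci : X -> I) (cj : X -> J) (cb : X -> B)
  (cc : X -> C) S tp tq tr : D ci cj cc cb S tp tq tr = D ci cj cb cc S tp tr tq.
Proof.
apply: eq_existsb => x; congr (_ && _); apply: eq_existsb => y; congr (_ && _).
exact: has_type_swap.
Qed.

Lemma Z_swap (X I J B C : finType) (ci : X -> I) (cj : X -> J) (cb : X -> B)
  (cc : X -> C) S tp tq tr : Z ci cj cb cc S tp tr tq -> Z ci cj cc cb S tp tq tr.
Proof.
move=> h i i' j j' b b' c c'; rewrite -[RHS](h i i' j j' c c' b b').
by apply: eq_bigr => x _; rewrite mulrAC.
Qed.

Lemma spair_swap (X I J B C : finType) (ci : X -> I) (cj : X -> J) (cb : X -> B)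
  (cc : X -> C) S L : spair ci cj cb cc S L -> spair ci cj cc cb S L.
Proof.
case=> e h1 h2; split=> // tp tq tr nt; rewrite D_swap => d; apply: Z_swap.
  by apply: h1 d; move: nt; rewrite /nontriv [(tq != 0) || _]orbC.
by apply: h2 d; move: nt; rewrite /nontriv [(tq != 0) || _]orbC.
Qed.

Lemma neq_rq (K : coords) : rn K != qn K.
Proof. by rewrite eq_sym. Qed.

Definition swap_coords (K : coords) : coords :=
  @Coords (cX K) (cI K) (cJ K) (cC K) (cB K) (@fI K) (@fJ K) (@fC K) (@fB K)
    (pn K) (rn K) (qn K)
    (fun x y e1 e2 e3 e4 => coords_inj e1 e2 e4 e3)
    (prime_pn K) (prime_rn K) (prime_qn K) (neq_pr K) (neq_pq K)
    (neq_rq K)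
    (card_cI K) (card_cJ K) (card_cC K) (card_cB K).

Lemma box_tile_swap (K : coords) (S : {set cX K}) :
  @box_tile (swap_coords K) S -> @box_tile K S.
Proof.
case=> ai [aj [ab [ac [h1 h2]]]]; exists ai, aj, ac, ab; split=> [x y xS yS h|].
  by apply: h1; move: h; rewrite // /compat /= [X in _ && (_ && X)]andbC.
by rewrite [RHS]mulnAC -[RHS]h2; congr (_ * _); apply: mulnAC.
Qed.

(** * Assembling the spectral case *)

Section Classification.
Variable K : coords.
Local Notation X := (cX K).
Local Notation I := (cI K).
Local Notation J := (cJ K).
Local Notation B := (cB K).
Local Notation C := (cC K).
Local Notation ci := (@fI K).
Local Notation cj := (@fJ K).
Local Notation cb := (@fB K).
Local Notation cc := (@fC K).
Local Notation p := (pn K).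
Local Notation q := (qn K).
Local Notation r := (rn K).
Local Notation coord_inj := (@coords_inj K).
Local Notation hp := (prime_pn K).
Local Notation hq := (prime_qn K).
Local Notation hr := (prime_rn K).
Local Notation hpq := (neq_pq K).
Local Notation hpr := (neq_pr K).
Local Notation hqr := (neq_qr K).
Local Notation cardI := (card_cI K).
Local Notation cardJ := (card_cJ K).
Local Notation cardB := (card_cB K).
Local Notation cardC := (card_cC K).

Local Notation D := (D ci cj cb cc).
Local Notation Z := (Z ci cj cb cc).
Local Notation spair := (spair ci cj cb cc).

Implicit Types S L : {set X}.

Lemma coprime_no201 S L : spair S L -> ~~ (p %| #|S|) -> ~~ (q %| #|S|) ->
  ~~ (r %| #|S|) -> ~~ D L 2 0 1.
Proof.
move=> /spair_swap SL np nq nr; rewrite -D_swap.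
exact: (@coprime_no210 (swap_coords K) S L SL np nr nq).
Qed.

Lemma coprime_no110 S L : spair S L -> ~~ (p %| #|S|) -> ~~ (q %| #|S|) ->
  ~~ (r %| #|S|) -> ~~ D L 1 1 0.
Proof.
move=> SL np nq nr; have LS := spair_sym SL; have [eN _ _] := SL.
have s1 : ~~ D S 2 0 1 by apply: (coprime_no201 LS); rewrite -eN.
have s2 : ~~ D S 2 0 0 by apply: (no200 LS); rewrite -eN.
apply/negP => d; have [u [v [uv _ _ NE]]] := sq110 (spairZ SL d isT).
have [b vb] := sum_pos (nd_pos' NE nq).
have [i _] := inhI K; have [i' ii'] := otherI i.
have /nIB_ex[x [xS x1 x2]] : 0 < nIB S i b by rewrite uv addn_gt0 vb orbT.
have /nIB_ex[y [yS y1 y2]] : 0 < nIB S i' b by rewrite uv addn_gt0 vb orbT.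
by subst; ty x y.
Qed.

Lemma coprime_no101 S L : spair S L -> ~~ (p %| #|S|) -> ~~ (q %| #|S|) ->
  ~~ (r %| #|S|) -> ~~ D L 1 0 1.
Proof.
move=> /spair_swap SL np nq nr; rewrite -D_swap.
have LS := spair_sym SL; have [eN _ _] := SL; have SL' := spair_swap SL.
have LS' := spair_sym SL'.
have s1 : ~~ D S 2 1 0 by apply: (coprime_no210 LS'); rewrite -eN.
have s2 : ~~ D S 2 0 0 by apply: (no200 LS'); rewrite -eN.
rewrite D_swap; apply/negP => d; have [u [v [uv _ _ NE]]] := sq101 (spairZ SL' d isT).
have [b vb] := sum_pos (nd_pos' NE nr).
have [i _] := inhI K; have [i' ii'] := otherI i.
have /nIC_ex[x [xS x1 x2]] : 0 < nIC S i b by rewrite uv addn_gt0 vb orbT.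
have /nIC_ex[y [yS y1 y2]] : 0 < nIC S i' b by rewrite uv addn_gt0 vb orbT.
by subst; ty x y.
Qed.

(** The types excluded so far make [cb] and [cc] injective on [S], so [q] and [r] exceed the size
    and a value of each is missing. *)
Lemma coprime_noX11 S L t : spair S L -> ~~ (p %| #|S|) -> ~~ (q %| #|S|) ->
  ~~ (r %| #|S|) -> ~~ D L t.+1 1 1.
Proof.
move=> SL np nq nr; have LS := spair_sym SL; have [eN _ _] := SL.
have s1 : ~~ D S 2 0 1 by apply: (coprime_no201 LS); rewrite -eN.
have s2 : ~~ D S 2 0 0 by apply: (no200 LS); rewrite -eN.
have s3 : ~~ D S 1 0 0 by apply: (no100 LS); rewrite -eN.
have s4 : ~~ D S 1 0 1 by apply: (coprime_no101 LS); rewrite -eN.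
have s5 : ~~ D S 0 0 1 by apply: (no001 LS); rewrite -eN.
have s6 : ~~ D S 2 1 0 by apply: (coprime_no210 LS); rewrite -eN.
have s7 : ~~ D S 1 1 0 by apply: (coprime_no110 LS); rewrite -eN.
have s8 : ~~ D S 0 1 0 by apply: (no010 LS); rewrite -eN.
apply: contra np => d; apply: cube_missing_dvd (spairZ SL d isT).
  rewrite ltn_neqAle; apply/andP; split; first by apply: contraNneq nq => ->.
  by apply: le_qB => x y xS yS e; apply: coord_inj; ty x y.
rewrite ltn_neqAle; apply/andP; split; first by apply: contraNneq nr => ->.
by apply: le_rC => x y xS yS e; apply: coord_inj; ty x y.
Qed.

Lemma coprime_tile S L : spair S L -> S != set0 -> ~~ (p %| #|S|) -> ~~ (q %| #|S|) ->
  ~~ (r %| #|S|) -> box_tile S.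
Proof.
move=> SL S0 np nq nr; have LS := spair_sym SL; have [eN _ _] := SL.
have s1 : ~~ D S 2 0 1 by apply: (coprime_no201 LS); rewrite -eN.
have s2 : ~~ D S 2 0 0 by apply: (no200 LS); rewrite -eN.
have s3 : ~~ D S 1 0 0 by apply: (no100 LS); rewrite -eN.
have s4 : ~~ D S 1 0 1 by apply: (coprime_no101 LS); rewrite -eN.
have s5 : ~~ D S 0 0 1 by apply: (no001 LS); rewrite -eN.
have s6 : ~~ D S 2 1 0 by apply: (coprime_no210 LS); rewrite -eN.
have s7 : ~~ D S 1 1 0 by apply: (coprime_no110 LS); rewrite -eN.
have s8 : ~~ D S 0 1 0 by apply: (no010 LS); rewrite -eN.
have s9 : ~~ D S 0 1 1 by apply: (coprime_no011 LS); rewrite -eN.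
have s10 : ~~ D S 1 1 1 by apply: (coprime_noX11 _ LS); rewrite -eN.
have s11 : ~~ D S 2 1 1 by apply: (coprime_noX11 _ LS); rewrite -eN.
apply: (@packs_tile K S true true true true) => //.
by move=> x y xS yS _; apply: coord_inj; ty x y.
Qed.

(** The exchange of [q] and [r] reduces 201 alone to 210 alone, and when both occur in [S] it yields
    [q <= r] and [r <= q]. *)
Lemma no011 S L : spair S L -> ~~ (q %| #|S|) -> ~~ (r %| #|S|) -> ~~ D L 0 1 1.
Proof.
move=> SL nq nr; apply/negP => d; have SLs := spair_swap SL; have LS := spair_sym SL.
have ds := d; rewrite -D_swap in ds.
have [d1|n1] := boolP (D S 2 1 0); have [d2|n2] := boolP (D S 2 0 1).
- have d1s := d1; rewrite -D_swap in d1s; have d2s := d2; rewrite -D_swap in d2s.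
  have colB := column_210_201 SL nq nr d1 d2.
  have colC := @column_210_201 (swap_coords K) S L SLs nr nq d2s d1s.
  have n110 := column_no110 SL nq nr d colB.
  have n101s := @column_no110 (swap_coords K) S L SLs nr nq ds colC.
  have n101 : ~~ D S 1 0 1 by rewrite -D_swap; apply: n101s.
  have [d101|m101] := boolP (D L 1 0 1); last by apply: (caseA_n101 SL nq nr d n110 n101 colB m101).
  have d110 := caseA_110 SL nq nr colC d101.
  have n110s := n110; rewrite -D_swap in n110s.
  have le1 := class_q_le_r SL nq nr d n110 n101 (spairZ SL d110 isT).
  have d101s := d101; rewrite -D_swap in d101s.
  have le2 := @class_q_le_r (swap_coords K) S L SLs nr nq ds n101s n110s
    (@spairZ (swap_coords K) S L SLs 1 1 0 d101s isT).
  by case/negP: (neq_qr K); rewrite eqn_leq le1 le2.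
- exact: (caseB_contra SL nq nr d d1 n2).
- have n1s := n1; rewrite -D_swap in n1s; have d2s := d2; rewrite -D_swap in d2s.
  exact: (@caseB_contra (swap_coords K) S L SLs nr nq ds d2s n1s).
exact: (absent_contra SL nq nr d n1 n2).
Qed.

Section Residual.
Variables S L : {set X}.
Hypothesis SL : spair S L.
Hypotheses (s010 : ~~ D S 0 1 0) (s001 : ~~ D S 0 0 1) (s011 : ~~ D S 0 1 1).

Lemma thin_nIJ i j : nIJ S i j <= 1.
Proof. by apply: cnt_le1; sub2 x y xS yS e1 e2; apply: coord_inj; ty x y. Qed.

(** A positive [u j0] would put two points over [(i, j0)]; with [u = 0] the counts no longer see the
    second digit. *)
Lemma thin_flatJ : [|| D L 2 0 0, D L 2 1 0 | D L 2 0 1] -> flatJ S.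
Proof.
case/or3P => d; first exact: Z200 (spairZ SL d isT).
  move=> i j j'; have [u [v [uv uE _ _]]] := sq210 i (spairZ SL d isT).
  suff u0 j0 : u j0 = 0 by rewrite !uE !u0.
  apply/eqP; rewrite -leqn0 leqNgt; apply/negP => uj.
  have [b _] := inhB K; have [b' bb] := otherB b.
  have /nJB_ex[x [xS x1 x2 x3]] : 0 < nJB S i j0 b by rewrite uv addn_gt0 uj.
  have /nJB_ex[y [yS y1 y2 y3]] : 0 < nJB S i j0 b' by rewrite uv addn_gt0 uj.
  by subst; ty x y.
move=> i j j'; have [u [v [uv uE _ _]]] := sq201 i (spairZ SL d isT).
suff u0 j0 : u j0 = 0 by rewrite !uE !u0.
apply/eqP; rewrite -leqn0 leqNgt; apply/negP => uj.
have [c _] := inhC K; have [c' cc'] := otherC c.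
have /nJC_ex[x [xS x1 x2 x3]] : 0 < nJC S i j0 c by rewrite uv addn_gt0 uj.
have /nJC_ex[y [yS y1 y2 y3]] : 0 < nJC S i j0 c' by rewrite uv addn_gt0 uj.
by subst; ty x y.
Qed.

Lemma single_class_tile i : S != set0 -> p %| #|S| -> (forall x, x \in S -> ci x = i) ->
  box_tile S.
Proof.
move=> S0 dp single; apply: (@packs_tile K S true false true true) => //.
  move=> x y xS yS h; have e : ci x = ci y by rewrite !single.
  by rewrite /compat /= e eqxx in h; apply: coord_inj; ty x y.
by rewrite /= add0n expn1 !expn0 !muln1.
Qed.

End Residual.

(** * Size divisible by [p] once, and by neither [q] nor [r] *)

Section HalfPOnly.
Variables S L : {set X}.
Hypothesis SL : spair S L.
Hypotheses (dp : p %| #|S|) (ndp2 : ~~ (p ^ 2 %| #|S|)).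
Hypotheses (nq : ~~ (q %| #|S|)) (nr : ~~ (r %| #|S|)).

Let eN : #|S| = #|L|. Proof. by case: SL. Qed.
Let LS : spair L S. Proof. exact: spair_sym. Qed.
Let s010 : ~~ D S 0 1 0. Proof. by apply: (no010 LS); rewrite -eN. Qed.
Let t010 : ~~ D L 0 1 0. Proof. exact: (no010 SL). Qed.
Let s001 : ~~ D S 0 0 1. Proof. by apply: (no001 LS); rewrite -eN. Qed.
Let t001 : ~~ D L 0 0 1. Proof. exact: (no001 SL). Qed.
Let s011 : ~~ D S 0 1 1. Proof. by apply: (no011 LS); rewrite -eN. Qed.
Let t011 : ~~ D L 0 1 1. Proof. exact: (no011 SL). Qed.

Lemma p_le_card : p <= #|S|.
Proof.
by apply: dvdn_leq dp; rewrite lt0n; apply: contra ndp2 => /eqP->; rewrite dvdn0.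
Qed.

(** Some class is empty, and comparison with it excludes 100, 110 and 101 from [L]. Two nonempty
    classes force 111 into [L], whence [p = r * U + q * V] with both sums positive and [q < p]. But
    a nonempty class of [L] has at least [p] and at most [q] points. *)
Lemma flatJ_single : flatJ S -> forall s t, s \in S -> t \in S -> ci s = ci t.
Proof.
move=> fJ s t sS tS; apply/eqP; apply: contraT => ne.
have nIE i j : nI S i = p * nIJ S i j.
  by rewrite nI_J (@sum_const _ _ (nIJ S i j)) ?cardJ.
have nIp x : x \in S -> nI S (ci x) = p.
  move=> xS; rewrite (nIE _ (cj x)).
  have -> : nIJ S (ci x) (cj x) = 1 by apply/eqP; rewrite eqn_leq thin_nIJ //= nIJ_pos.
  by rewrite muln1.
have [i0 i00] : exists i, nI S i = 0.
  have /forallPn[i h] : ~~ [forall i, 0 < nI S i]; last by exists i; move: h; clear; lia.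
  apply/negP => /forallP h; apply: (flat_both ndp2 _ fJ) => i i'.
  have /nI_ex[x [xS <-]] := h i; have /nI_ex[y [yS <-]] := h i'.
  by rewrite !nIp.
have zB b : nIB S i0 b = 0 by move: i00; rewrite nI_B => /sum_eq0.
have zC c : nIC S i0 c = 0 by move: i00; rewrite nI_C => /sum_eq0.
have zBC b c : nIBC S i0 b c = 0 by have := zB b; rewrite nIB_C => /sum_eq0.
have [b0 _] := inhB K; have [c0 _] := inhC K.
have t110 : ~~ D L 1 1 0.
  apply: contra nq => d; rewrite tot_I dvdn_sum // => i _.
  rewrite nI_B (@sum_const _ _ (nIB S i b0)) ?cardB ?dvdn_mulr // => b.
  by have := Z110 (spairZ SL d isT) i i0 b b0; rewrite !zB !addn0.
have t101 : ~~ D L 1 0 1.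
  apply: contra nr => d; rewrite tot_I dvdn_sum // => i _.
  rewrite nI_C (@sum_const _ _ (nIC S i c0)) ?cardC ?dvdn_mulr // => c.
  by have := Z101 (spairZ SL d isT) i i0 c c0; rewrite !zC !addn0.
have t100 : ~~ D L 1 0 0.
  apply/negP => d; have := Z100 (spairZ SL d isT) (ci s) i0; rewrite i00 nIp //.
  by have := p_gt1 K; clear; lia.
have d111 : D L 1 1 1.
  apply: contraT => t111; have : #|L| <= p.
    rewrite -cnt_true -cardI; apply: (@cnt_le_inj _ _ _ (@fI K)) => x y xL yL _ _ e.
    by apply: coord_inj; ty x y.
  have := sum_ge2 (nI S) ne; rewrite -tot_I !nIp // eN.
  by have := p_gt1 K; clear; lia.
have sq i : square (nIBC S i).
  move=> b b' c c'; have := Z111 (spairZ SL d111 isT) i i0 b b' c c'.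
  by rewrite !zBC; clear; lia.
have full x : x \in S ->
    (r < p) * (q < p) * (forall b, exists y, [/\ y \in S, ci y = ci x & cb y = b]).
  move=> xS; have [u [v [uv _ _]]] := square_sums b0 c0 (sq (ci x)).
  rewrite -nI_BC nIp // cardB cardC => NE.
  have U0 : 0 < \sum_b u b by apply: nd_pos NE _; rewrite prime_ndvd // eq_sym.
  have V0 : 0 < \sum_c v c by apply: nd_pos' NE _; rewrite prime_ndvd // eq_sym.
  have [c vc] := sum_pos V0; split.
    by move: U0 V0 NE (q_gt1 K) (r_gt1 K); clear; split; nia.
  move=> b; have /nIBC_ex[y [yS y1 y2 y3]] : 0 < nIBC S (ci x) b c.
    by rewrite uv addn_gt0 vc orbT.
  by exists y.
have fL : flatJ L.
  have [y [yS y1 y2]] := (full s sS).2 b0; have [z [zS z1 z2]] := (full t tS).2 b0.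
  rewrite -y1 -z1 in ne; rewrite -z2 in y2.
  apply: (thin_flatJ LS t010 t001 t011).
  have d : D S 2 0 0 || D S 2 0 1.
    have [e|e] := eqVneq (cc y) (cc z); apply/orP; [left|right];
      by apply: (hasD yS zS); clear y1 z1; ty y z.
  by case/orP: d => ->; rewrite ?orbT.
have [x xL] : exists x, x \in L.
  by apply/set0Pn; rewrite -card_gt0 -eN card_gt0; apply/set0Pn; exists s.
have : p <= nI L (ci x).
  rewrite nI_J (@sum_const _ _ (nIJ L (ci x) (cj x))) ?cardJ // leq_pmulr //.
  exact: nIJ_pos.
have : nI L (ci x) <= q.
  rewrite -cardB; apply: (@cnt_le_inj _ _ _ (@fB K)) => y z yL zL /eqP e1 /eqP e2 e3.
  by rewrite -e2 in e1; apply: coord_inj; ty y z.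
by have := (full s sS).1; move=> [_ lt] l1 l2; have := leq_trans l2 l1; rewrite leqNgt lt.
Qed.

End HalfPOnly.

Section HalfPOnlyTile.
Variables S L : {set X}.
Hypothesis SL : spair S L.
Hypotheses (S0 : S != set0) (dp : p %| #|S|) (ndp2 : ~~ (p ^ 2 %| #|S|)).
Hypotheses (nq : ~~ (q %| #|S|)) (nr : ~~ (r %| #|S|)).

Let eN : #|S| = #|L|. Proof. by case: SL. Qed.
Let LS : spair L S. Proof. exact: spair_sym. Qed.
Let s010 : ~~ D S 0 1 0. Proof. by apply: (no010 LS); rewrite -eN. Qed.
Let t010 : ~~ D L 0 1 0. Proof. exact: (no010 SL). Qed.
Let s001 : ~~ D S 0 0 1. Proof. by apply: (no001 LS); rewrite -eN. Qed.
Let t001 : ~~ D L 0 0 1. Proof. exact: (no001 SL). Qed.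
Let s011 : ~~ D S 0 1 1. Proof. by apply: (no011 LS); rewrite -eN. Qed.
Let t011 : ~~ D L 0 1 1. Proof. exact: (no011 SL). Qed.

Let L0 : exists x, x \in L.
Proof. by apply/set0Pn; rewrite -card_gt0 -eN card_gt0. Qed.

Let pack1 : ~~ D S 1 0 0 -> ~~ D S 1 1 0 -> ~~ D S 1 0 1 -> ~~ D S 1 1 1 -> box_tile S.
Proof.
move=> s1 s2 s3 s4; apply: (@packs_tile K S false true true true) => //.
  by move=> x y xS yS h; rewrite /compat /= in h; apply: coord_inj; ty x y.
by rewrite /= addn0 expn1 !expn0 !muln1.
Qed.

(** [L] is one class of [p] points, and the aim is that first digits are distinct on [S]. The
    delicate type is 111: it gives [p = r * U + q * V] in that class, hence 110 in [L], hence one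
    point in each class of [S]. *)
Lemma dual_flatJ_tile : flatJ L -> box_tile S.
Proof.
move=> fL; have [x0 x0L] := L0.
have single x : x \in L -> ci x = ci x0.
  by move=> xL; apply: (flatJ_single LS) => //; rewrite -eN.
have NE : #|L| = nI L (ci x0).
  rewrite -cnt_true; apply: eq_card => x; rewrite !inE.
  by case: (boolP (x \in L)) => // /single->; rewrite eqxx.
have Np : #|L| = p.
  rewrite NE nI_J (@sum_const _ _ 1) ?cardJ ?muln1 // => j.
  rewrite (fL _ j (cj x0)); apply/eqP; rewrite eqn_leq nIJ_pos // andbT.
  exact: (thin_nIJ t010 t001 t011).
have [i1 ii] := otherI (ci x0).
have nI0 : nI L i1 = 0 by apply: cnt_eq0 => x /single->; rewrite eq_sym.
have s100 : ~~ D S 1 0 0.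
  apply/negP => d; have := Z100 (spairZ LS d isT) (ci x0) i1.
  by rewrite nI0 -NE Np; have := p_gt1 K; clear; lia.
have s110 : ~~ D S 1 1 0.
  by apply/negP => d; apply: (single_class_Z110 _ single (spairZ LS d isT)); rewrite -eN.
have s101 : ~~ D S 1 0 1.
  by apply/negP => d; case/negP: nr; rewrite eN; apply: single_class_no101 single (spairZ LS d isT).
apply: pack1 => //; apply/negP => d.
have zBC b c : nIBC L i1 b c = 0.
  by have := nI0; rewrite nI_B => /sum_eq0/(_ b); rewrite nIB_C => /sum_eq0.
have sq : square (nIBC L (ci x0)).
  move=> b b' c c'; have := Z111 (spairZ LS d isT) (ci x0) i1 b b' c c'.
  by rewrite !zBC; clear; lia.
have [b0 _] := inhB K; have [b1 bb] := otherB b0; have [c0 _] := inhC K.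
have [u [v [uv _ _]]] := square_sums b0 c0 sq.
rewrite -nI_BC -NE Np cardB cardC => PE.
have [c vc] : exists c, 0 < v c.
  by apply: sum_pos (nd_pos' PE _); rewrite prime_ndvd // eq_sym.
have /nIBC_ex[x [xL x1 x2 x3]] : 0 < nIBC L (ci x0) b0 c by rewrite uv addn_gt0 vc orbT.
have /nIBC_ex[y [yL y1 y2 y3]] : 0 < nIBC L (ci x0) b1 c by rewrite uv addn_gt0 vc orbT.
have d110 : D L 1 1 0.
  by subst; apply: (hasD xL yL); rewrite -y1 in x1; clear y1; ty x y.
have [z [w [zw zE _ NE2]]] := sq110 (spairZ SL d110 isT).
have [b wb] : exists b, 0 < w b by apply: sum_pos (nd_pos' NE2 _).
have le1 i b' : nIB S i b' <= 1.
  by apply: cnt_le1; sub2 s t sS tS e1 e2; apply: coord_inj; ty s t.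
have z0 i : z i = 0 by have := le1 i b; rewrite zw; move: wb; clear; lia.
have W1 : \sum_b w b = 1.
  move: NE2; rewrite eN Np [X in q * X]big1 // muln0 add0n => /eqP.
  by rewrite -{1}(muln1 p) eqn_pmul2l ?prime_gt0 // => /eqP <-.
have /DP[s [t [sS tS /and3P[/andP[/eqP e1 e2] _ _]]]] := d.
have : 1 < nI S (ci s).
  by apply: (cnt_gt1 sS tS); rewrite ?e1 ?eqxx //; apply: contraNneq e2 => ->.
by rewrite zE z0 muln0 W1.
Qed.

(** After the equidistributed cases, 211 occurs in [S] or [S] is one class. In the former each value
    of [cb] or [cc] is confined to one class, and [L] is one class of [p] points. If [L] has 100,
    first digits are distinct on [S]; if 111, missing values make the classes of [S] copies of each
    other, against confinement. *)
Lemma half_p_tile : box_tile S.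
Proof.
have single_tile i : (forall x, x \in S -> ci x = i) -> box_tile S.
  by move=> h; apply: single_class_tile h.
have [x0 x0S] := set0Pn _ S0.
have [d|nfS] := boolP [|| D L 2 0 0, D L 2 1 0 | D L 2 0 1].
  apply: (@single_tile (ci x0)) => x xS; apply: (flatJ_single SL) => //.
  exact: (thin_flatJ SL s010 s001 s011 d).
have [d|nfL] := boolP [|| D S 2 0 0, D S 2 1 0 | D S 2 0 1].
  exact: dual_flatJ_tile (thin_flatJ LS t010 t001 t011 d).
have {nfS} [t200 t210 t201] : [/\ ~~ D L 2 0 0, ~~ D L 2 1 0 & ~~ D L 2 0 1].
  by split; apply: contra nfS => ->; rewrite ?orbT.
have {nfL} [s200 s210 s201] : [/\ ~~ D S 2 0 0, ~~ D S 2 1 0 & ~~ D S 2 0 1].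
  by split; apply: contra nfL => ->; rewrite ?orbT.
have [d211|s211] := boolP (D S 2 1 1); last first.
  by apply: (@single_tile (ci x0)) => x xS; ty x x0.
have /DP[s [t [sS tS /and3P[ne nb nc]]]] := d211; rewrite /= in ne nb nc.
have clsB x y : x \in S -> y \in S -> cb x = cb y -> ci x = ci y.
  by move=> xS yS e; ty x y.
have clsC x y : x \in S -> y \in S -> cc x = cc y -> ci x = ci y.
  by move=> xS yS e; ty x y.
have t110 : ~~ D L 1 1 0.
  apply/negP => d; have := Z110 (spairZ SL d isT) (ci s) (ci t) (cb s) (cb t).
  have -> : nIB S (ci s) (cb t) = 0.
    apply: cnt_eq0 => x xS; apply/negP => /andP[/eqP e1 /eqP e2].
    by case/eqP: ne; rewrite -e1; apply: clsB.
  have -> : nIB S (ci t) (cb s) = 0.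
    apply: cnt_eq0 => x xS; apply/negP => /andP[/eqP e1 /eqP e2].
    by case/eqP: ne; rewrite -e1; apply/esym/clsB.
  by have := nIB_pos sS; clear; lia.
have t101 : ~~ D L 1 0 1.
  apply/negP => d; have := Z101 (spairZ SL d isT) (ci s) (ci t) (cc s) (cc t).
  have -> : nIC S (ci s) (cc t) = 0.
    apply: cnt_eq0 => x xS; apply/negP => /andP[/eqP e1 /eqP e2].
    by case/eqP: ne; rewrite -e1; apply: clsC.
  have -> : nIC S (ci t) (cc s) = 0.
    apply: cnt_eq0 => x xS; apply/negP => /andP[/eqP e1 /eqP e2].
    by case/eqP: ne; rewrite -e1; apply/esym/clsC.
  by have := nIC_pos sS; clear; lia.
have [d|t211] := boolP (D L 2 1 1).
  (* The values of [cb] and [cc] at a point [y] of another class are missing from the class of [x],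
     so two corners of the cube survive. *)
  have move x j : x \in S -> 0 < nIJ S (ci x) j.
    move=> xS; have [y yS xy] : exists2 y, y \in S & ci y != ci x.
      by have [e|h] := eqVneq (ci s) (ci x); [exists t; rewrite // -e eq_sym|exists s].
    have zb jj c : nIJBC S (ci x) jj (cb y) c = 0.
      apply: cnt_eq0 => z zS; apply/negP => /and4P[/eqP e1 _ /eqP e2 _].
      by case/eqP: xy; rewrite -e1; apply/esym/clsB.
    have zc jj b : nIJBC S (ci x) jj b (cc y) = 0.
      apply: cnt_eq0 => z zS; apply/negP => /and4P[/eqP e1 _ _ /eqP e2].
      by case/eqP: xy; rewrite -e1; apply/esym/clsC.
    have := Z211 (spairZ SL d isT) (ci x) (cj x) j (cb x) (cb y) (cc x) (cc y).
    rewrite !zb !zc.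
    have : 0 < nIJBC S (ci x) (cj x) (cb x) (cc x) by apply: (cnt_gt0 xS); rewrite !eqxx.
    move=> h e; have /cntP[z zS /and4P[z1 z2 _ _]] : 0 < nIJBC S (ci x) j (cb x) (cc x).
      by move: h e; clear; lia.
    by apply: (cnt_gt0 zS); rewrite z1 z2.
  have fS : flatJ S.
    move=> i j j'; apply/eqP; rewrite eqn_leq; apply/andP; split.
      have [->//|/cntP[x xS /andP[/eqP <- _]]] := posnP (nIJ S i j).
      by apply: leq_trans (move x j' xS); apply: (thin_nIJ s010 s001 s011).
    have [->//|/cntP[x xS /andP[/eqP <- _]]] := posnP (nIJ S i j').
    by apply: leq_trans (move x j xS); apply: (thin_nIJ s010 s001 s011).
  by case/eqP: ne; apply: (flatJ_single SL).
have clsL x y : x \in L -> y \in L -> ci x = ci y by move=> xL yL; ty x y.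
have Np : #|S| = p.
  apply/eqP; rewrite eqn_leq p_le_card // andbT eN.
  rewrite -cnt_true -cardJ; apply: (@cnt_le_inj _ _ _ (@fJ K)) => x y xL yL _ _ e.
  by have e' := clsL x y xL yL; apply: coord_inj; ty x y.
have [d|t100] := boolP (D L 1 0 0).
  have fI := Z100 (spairZ SL d isT).
  have one i : nI S i = 1.
    have /eqP := flatIE fI i; rewrite Np -{1}(muln1 p) eqn_pmul2l ?prime_gt0 // => /eqP <-.
    by [].
  have inj x y : x \in S -> y \in S -> ci x = ci y -> x = y.
    move=> xS yS e; apply/eqP; apply: contraT => h.
    have : 1 < nI S (ci x) by apply: (cnt_gt1 xS yS); rewrite ?e ?eqxx.
    by rewrite one.
  have nope tq tr : ~~ D S 1 tq tr.
    apply/negP => /DP[x [y [xS yS /and3P[/andP[/eqP e1 e2] _ _]]]].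
    by rewrite (inj x y xS yS e1) eqxx in e2.
  exact: pack1.
have d111 : D L 1 1 1.
  apply: contraT => t111; have : #|L| <= 1.
    rewrite -cnt_true; apply: cnt_le1 => x y xL yL _ _.
    by have e := clsL x y xL yL; apply: coord_inj; ty x y.
  by rewrite -eN Np; have := p_gt1 K; clear; lia.
have [b0 zb] : exists b, nB S b = 0.
  apply: missB; rewrite Np ltn_neqAle hpq /= -Np eN.
  by apply: le_qB => x y xL yL e; have e' := clsL x y xL yL; apply: coord_inj; ty x y.
have [c0 zc] : exists c, nC S c = 0.
  apply: missC; rewrite Np ltn_neqAle hpr /= -Np eN.
  by apply: le_rC => x y xL yL e; have e' := clsL x y xL yL; apply: coord_inj; ty x y.
have := nIBC_pos sS; rewrite (cube_missing zb zc (spairZ SL d111 isT) _ (ci t)).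
by move/nIBC_ex => [x [xS x1 x2 _]]; case/eqP: ne; rewrite -x1; apply: clsB.
Qed.

End HalfPOnlyTile.

(** Divisibility of the size by [q] and [r] dictates those sides of the box; a choice exists only
    when [p] divides it exactly once. *)
Lemma spair_box_tile S L : spair S L -> S != set0 -> box_tile S.
Proof.
move=> SL S0; have LS := spair_sym SL; have [eN _ _] := SL.
have S1 : 0 < #|S| by rewrite card_gt0.
have cop_qr : coprime q r by rewrite prime_coprime // prime_ndvd.
have cop_pq : coprime p q by rewrite prime_coprime // prime_ndvd.
have cop_pr : coprime p r by rewrite prime_coprime // prime_ndvd.
have G m n : coprime m n -> m %| #|S| -> n %| #|S| -> m * n %| #|S|.
  by move=> c a b; rewrite Gauss_dvd // a b.
have cop_ppq : coprime (p ^ 2) q by rewrite coprimeXl.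
have cop_ppr : coprime (p ^ 2) r by rewrite coprimeXl.
have cop_ppqr : coprime (p ^ 2 * q) r by rewrite coprimeMl cop_ppr.
have cop_pqr : coprime (p * q) r by rewrite coprimeMl cop_pr.
have [dq|nq] := boolP (q %| #|S|); have [dr|nr] := boolP (r %| #|S|).
- have [dp2|ndp2] := boolP (p ^ 2 %| #|S|).
    apply: (@packs_tile K S false false false false) => //.
      by move=> x y xS yS h; rewrite /compat /= in h; apply: coord_inj; ty x y.
    have dv : p ^ 2 * q * r %| #|S|.
      by apply G => //; apply G.
    by move: dv; rewrite /= !expn1.
  have [dp|np] := boolP (p %| #|S|); last first.
    have s100 : ~~ D S 1 0 0 by apply: (no100 LS); rewrite -eN.
    have s200 : ~~ D S 2 0 0 by apply: (no200 LS); rewrite -eN.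
    apply: (@packs_tile K S true true false false) => //.
      by move=> x y xS yS h; rewrite /compat /= in h; apply: coord_inj; ty x y.
    by rewrite /= addn0 expn0 mul1n !expn1 Gauss_dvd ?dq ?dr.
  have dv : p * q * r %| #|S| by apply G => //; apply G.
  have [s100|d100] := boolP (~~ D S 1 0 0).
    apply: (@packs_tile K S false true false false) => //.
      by move=> x y xS yS h; rewrite /compat /= in h; apply: coord_inj; ty x y.
  have s200 : ~~ D S 2 0 0.
    apply/negP => d; apply: (@flat_both K L); rewrite -?eN //.
      by rewrite negbK in d100; apply: (Z100 (spairZ LS d100 isT)).
    exact: (Z200 (spairZ LS d isT)).
  apply: (@packs_tile K S true false false false) => //.
    by move=> x y xS yS h; rewrite /compat /= in h; apply: coord_inj; ty x y.
- have [dp2|ndp2] := boolP (p ^ 2 %| #|S|).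
    have s001 : ~~ D S 0 0 1 by apply: (no001 LS); rewrite -eN.
    apply: (@packs_tile K S false false false true) => //.
      by move=> x y xS yS h; rewrite /compat /= in h; apply: coord_inj; ty x y.
    have dv : p ^ 2 * q %| #|S| by apply G.
    by move: dv; rewrite /= !expn1 expn0 muln1.
  have [dp|np] := boolP (p %| #|S|); first exact: half_tile SL dp ndp2 dq nr S0.
  exact: onlyq_tile SL S0 np nr dq.
- have SLs := spair_swap SL; have [dp2|ndp2] := boolP (p ^ 2 %| #|S|).
    have s010 : ~~ D S 0 1 0 by apply: (no010 LS); rewrite -eN.
    apply: (@packs_tile K S false false true false) => //.
      by move=> x y xS yS h; rewrite /compat /= in h; apply: coord_inj; ty x y.
    have dv : p ^ 2 * r %| #|S| by apply G.
    by move: dv; rewrite /= !expn1 expn0 muln1.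
  apply: box_tile_swap; have [dp|np] := boolP (p %| #|S|).
    exact: (@half_tile (swap_coords K) S L SLs dp ndp2 dr nq S0).
  exact: (@onlyq_tile (swap_coords K) S L SLs S0 np nq dr).
have s010 : ~~ D S 0 1 0 by apply: (no010 LS); rewrite -eN.
have s001 : ~~ D S 0 0 1 by apply: (no001 LS); rewrite -eN.
have s011 : ~~ D S 0 1 1 by apply: (no011 LS); rewrite -eN.
have [dp2|ndp2] := boolP (p ^ 2 %| #|S|).
  apply: (@packs_tile K S false false true true) => //.
    by move=> x y xS yS h; rewrite /compat /= in h; apply: coord_inj; ty x y.
  by rewrite /= !expn0 !muln1.
have [dp|np] := boolP (p %| #|S|); first exact: half_p_tile SL S0 dp ndp2 nq nr.
exact: coprime_tile SL S0 np nq nr.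
Qed.
End Classification.

(** * Roots of unity *)

Section Galois.
Local Open Scope ring_scope.

Lemma root_Cyclotomic (F : numFieldType) d (z : F) : d.-primitive_root z ->
  root (map_poly intr 'Phi_d) z.
Proof.
move=> zd; have d0 := prim_order_gt0 zd.
have : root (map_poly intr ('X^d - 1)) z.
  rewrite rmorphB /= map_polyXn rmorph1 rootE !hornerE ?hornerXn.
  by rewrite (prim_expr_order zd) subrr.
rewrite -(prod_Cyclotomic d0) rmorph_prod /=.
rewrite -(big_map (fun e => map_poly intr 'Phi_e) predT id) => /negPn.
rewrite root_bigmul => /allPn[_ /mapP[e ed ->]]; rewrite negbK => ze.
rewrite -dvdn_divisors // in ed; have e0 := dvdn_gt0 d0 ed.
suff de : (d %| e)%N by have /eqP -> : d == e by rewrite eqn_dvd de ed.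
rewrite (prim_order_dvd zd); apply/eqP.
have : root (map_poly intr ('X^e - 1)) z.
  rewrite -(prod_Cyclotomic e0) (bigD1_seq e) /= ?divisors_uniq -?dvdn_divisors //.
  by rewrite rmorphM rootM ze.
rewrite rmorphB /= map_polyXn rmorph1 rootE !hornerE ?hornerXn subr_eq0.
by move/eqP.
Qed.

(** Irreducibility over the rationals, from the minimal polynomial [m] of a root in [algC]: if the
    gcd does not vanish at the root, its cofactor does and is divisible by [m], so the gcd is
    constant. *)
Lemma Cyclotomic_alternative d (P : {poly rat}) : (0 < d)%N ->
  let Phi := map_poly intr 'Phi_d in (Phi %| P)%R \/ coprimep Phi P.
Proof.
move=> d0 Phi; have [z zd] := C_prim_root_exists d0.
have [m [mE mm mP]] := minCpolyP z.
have -> : Phi = m.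
  apply: (map_inj_poly (fmorph_inj (ratr : rat -> algC)) (rmorph0 _)).
  rewrite -mE (minCpoly_cyclotomic zd) -(Cintr_Cyclotomic zd) -map_poly_comp.
  by apply: eq_map_poly => x /=; rewrite ratr_int.
have [zP|nzP] := boolP (root (map_poly ratr P) z); [left|right]; first by rewrite -mP.
set g := gcdp m P.
have [h mh] := dvdpP _ _ (dvdp_gcdl m P); rewrite -/g in mh.
have rm : root (map_poly ratr m) z by rewrite mP.
have ng : ~~ root (map_poly ratr g) z.
  by apply: contra nzP; rewrite !mP => /dvdp_trans; apply; apply: dvdp_gcdr.
move: rm; rewrite {1}mh rmorphM rootM (negPf ng) orbF mP => mdh.
have m0 : m != 0 by rewrite monic_neq0.
have h0 : h != 0 by apply: contraNneq m0 => e; rewrite mh e mul0r.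
have g0 : g != 0 by apply: contraNneq m0 => e; rewrite mh e mulr0.
rewrite /coprimep -/g eqn_leq size_poly_gt0 g0 andbT.
have := dvdp_leq h0 mdh; rewrite mh size_mul // -subn1 leq_subLR addnC.
by rewrite leq_add2r.
Qed.

(** Working with rational polynomials carries irreducibility from [algC] to [F], to be used with
    [R[i]]. *)
Lemma primitive_conjugate (F : numFieldType) d (z z' : F) (P : {poly rat}) :
  d.-primitive_root z -> d.-primitive_root z' ->
  root (map_poly ratr P) z -> root (map_poly ratr P) z'.
Proof.
move=> zd zd' zP; have d0 := prim_order_gt0 zd.
pose Phi : {poly rat} := map_poly intr 'Phi_d.
have PhiE : map_poly ratr Phi = map_poly intr 'Phi_d :> {poly F}.
  by rewrite -map_poly_comp; apply: eq_map_poly => x /=; rewrite ratr_int.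
have [/dvdpP[h ->]|] := Cyclotomic_alternative P d0.
  by rewrite rmorphM rootM /= PhiE root_Cyclotomic ?orbT.
move=> /Bezout_coprimepP[[u v] /= e].
have : root (map_poly ratr (u * Phi + v * P)) z.
  rewrite rmorphD !rmorphM /= rootE !hornerE.
  have /rootP -> := zP; have /rootP -> : root (map_poly ratr Phi) z.
    by rewrite PhiE root_Cyclotomic.
  by rewrite !mulr0 addr0.
move: e; rewrite -size_poly_eq1 => /size_poly1P[c c0 ->].
by rewrite map_polyC rootC fmorph_eq0 (negPf c0).
Qed.

Lemma sum_powers_conjugate (F : numFieldType) d (z z' : F) (I : finType) (A : {pred I})
  (e : I -> nat) : d.-primitive_root z -> d.-primitive_root z' ->
  \sum_(i in A) z ^+ e i = 0 -> \sum_(i in A) z' ^+ e i = 0.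
Proof.
move=> zd zd' s0; pose P : {poly rat} := \sum_(i in A) 'X^(e i).
have PE y : (map_poly ratr P).[y] = \sum_(i in A) y ^+ e i :> F.
  rewrite rmorph_sum horner_sum; apply: eq_bigr => i _.
  by rewrite /= map_polyXn hornerXn.
by apply/eqP; rewrite -PE -[_ == 0]rootE; apply: primitive_conjugate zd zd' _;
  rewrite rootE PE s0.
Qed.

End Galois.

Section RootOfUnity.
Variable R : realType.
Local Open Scope ring_scope.
Local Open Scope complex_scope.

Definition cis (t : R) : R[i] := cos t +i* sin t.

Lemma cisD s t : cis (s + t) = cis s * cis t.
Proof. by apply/eqP; rewrite eq_complex /= cosD sinD eqxx /=; apply/eqP; ring. Qed.

Lemma cis0 : cis 0 = 1.
Proof. by rewrite /cis cos0 sin0. Qed.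

Lemma cisM t k : cis (t * k%:R) = cis t ^+ k.
Proof.
elim: k => [|k IH]; first by rewrite mulr0 expr0 cis0.
by rewrite exprSr -IH -cisD -natr1 mulrDr mulr1.
Qed.

Lemma cis_2pi : cis (2 * pi) = 1.
Proof.
apply/eqP; rewrite /cis mulr_natl eq_complex /= cos2pi -[pi *+ 2]add0r sinD2pi.
by rewrite sin0 !eqxx.
Qed.

Lemma cis_eq1 t : 0 < t < 2 * pi -> cis t != 1.
Proof.
case/andP=> t0 t2; rewrite eq_complex /= negb_and.
have [tp|tp|->] := ltgtP t pi; last by rewrite cospi; apply/orP; left; lra.
  by rewrite (@gt_eqF _ _ (sin t)) ?orbT // sin_gt0_pi // t0.
have -> : t = (t - pi) + pi by ring.
rewrite sinDpi oppr_eq0 (@gt_eqF _ _ (sin (t - pi))) ?orbT // sin_gt0_pi //.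
by apply/andP; split; lra.
Qed.

Definition zeta (n : nat) : R[i] := cis (2 * pi / n%:R).

Lemma zeta_prim n : (0 < n)%N -> n.-primitive_root (zeta n).
Proof.
move=> n0; have n0' : 0 < n%:R :> R by rewrite ltr0n.
have zE k : zeta n ^+ k = cis (2 * pi * (k%:R / n%:R)).
  by rewrite /zeta -cisM; congr cis; ring.
apply/andP; split=> //; apply/forallP => i; rewrite unity_rootE zE.
have [->|ne] := eqVneq i.+1 n.
  rewrite divff; last by rewrite gt_eqF.
  by rewrite mulr1 cis_2pi !eqxx.
apply/eqP/negbTE/cis_eq1; have pi0 := pi_gt0 R.
have lt1 : (i.+1%:R / n%:R : R) < 1.
  by rewrite ltr_pdivrMr // mul1r ltr_nat ltn_neqAle ne ltn_ord.
have gt0 : 0 < (i.+1%:R / n%:R : R) by rewrite divr_gt0 // ltr0n.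
by apply/andP; split; nra.
Qed.

Lemma zeta_conj n k : (0 < n)%N -> zeta n ^+ k * conjc (zeta n ^+ k) = 1.
Proof.
move=> n0; rewrite /zeta -cisM; set t := _ * k%:R.
apply/eqP; rewrite eq_complex /=; apply/andP; split; apply/eqP.
  by rewrite mulrN opprK -!expr2 cos2Dsin2.
by ring.
Qed.

Lemma chiE n (k x : 'Z_n) : chi R k x = zeta n ^+ (k * x).
Proof.
rewrite /zeta -cisM /chi /cis.
by have -> : 2 * pi * (k * x)%:R / n%:R = 2 * pi / n%:R * (k * x)%:R :> R by ring.
Qed.

End RootOfUnity.

(** * Dilating one factor of a tiling *)

Section Dilation.
Variables (X Y : finType) (S : {set X}) (T : {set Y}) (n : nat).
Local Open Scope ring_scope.

Definition residue_count (f : X -> nat) (g : Y -> nat) (c : nat) :=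
  (\sum_(x in S) \sum_(y in T) ((f x + g y) %% n == c))%N.

Definition residue_tiling f g := forall c, (c < n)%N -> residue_count f g c = 1%N.

Lemma sum_residue_count (V : comNzRingType) f g (w : nat -> V) : (0 < n)%N ->
  \sum_(x in S) \sum_(y in T) w ((f x + g y) %% n)%N =
  \sum_(c < n) (residue_count f g c)%:R * w c.
Proof.
move=> n0; have e k : w (k %% n)%N = \sum_(c < n) (k %% n == c)%N%:R * w c.
  rewrite (bigD1 (Ordinal (ltn_pmod k n0))) //= eqxx mul1r big1 ?addr0 // => c.
  by rewrite -val_eqE /= eq_sym => /negPf->; rewrite mul0r.
under eq_bigr do under eq_bigr do rewrite e.
under eq_bigr do rewrite exchange_big; rewrite exchange_big /=.
apply: eq_bigr => c _; rewrite natr_sum mulr_suml; apply: eq_bigr => x _.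
by rewrite natr_sum mulr_suml.
Qed.

(** There are [n] pairs for [n] residues, so positive counts are all one. *)
Lemma residue_tiling_ge f g : (#|S| * #|T| = n)%N ->
  (forall c, (c < n)%N -> 0 < residue_count f g c)%N -> residue_tiling f g.
Proof.
move=> ST h c cn; have n0 : (0 < n)%N by apply: leq_ltn_trans cn.
have e : (\sum_(c < n) 1 = \sum_(c < n) residue_count f g c)%N.
  have := sum_residue_count f g (fun=> 1 : int) n0.
  under eq_bigr do rewrite sumr_const; rewrite sumr_const -mulrnA mulnC ST.
  under eq_bigr do rewrite mulr1; rewrite -natr_sum => /eqP; rewrite eqr_nat => /eqP <-.
  by rewrite sum_nat_const card_ord muln1.
have /eqP := e; have := leqif_sum (fun (i : 'I_n) (_ : true) => leqif_eq (h i (ltn_ord i))).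
move=> /leqifP; case: ifP => [/forallP/(_ (Ordinal cn)) /= /eqP <- //|_ lt /eqP ee].
by rewrite ee ltnn in lt.
Qed.

Section Frobenius.
Variables (l : nat) (hl : prime l).
Local Notation F := 'F_l.

Lemma dvdp_sum (d : {poly F}) (I : finType) (A : {set I}) (f : I -> {poly F}) :
  (forall i, i \in A -> d %| f i) -> d %| \sum_(i in A) f i.
Proof. by move=> h; elim/big_rec: _ => [|i g iA dg]; rewrite ?dvdp0 // dvdp_addr ?h. Qed.

Lemma dvd_Xn_mod k : ('X^n - 1 : {poly F}) %| 'X^k - 'X^(k %% n).
Proof.
rewrite [X in 'X^X - _](divn_eq k n) mulnC exprD exprM -[X in _ %| _ - X]mul1r -mulrBl.
by rewrite dvdp_mulr // [X in _ %| X]subrX1 dvdp_mulr.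
Qed.

Lemma dvd_sum_residues f g :
   ('X^n - 1 : {poly F}) %| (\sum_(x in S) 'X^(f x)) * (\sum_(y in T) 'X^(g y))
   - \sum_(x in S) \sum_(y in T) 'X^((f x + g y) %% n).
Proof.
rewrite mulr_suml -sumrB dvdp_sum // => x _.
rewrite mulr_sumr -sumrB dvdp_sum // => y _.
by rewrite -exprD dvd_Xn_mod.
Qed.

(* In characteristic l, raising the generating polynomial of f to the power l
   multiplies f by l. *)
Lemma residue_tiling_dilate f g : (#|S| * #|T| = n)%N -> ~~ (l %| #|S|)%N ->
  residue_tiling f g -> residue_tiling (fun x => l * f x)%N g.
Proof.
move=> ST lS t; apply: residue_tiling_ge => // c cn.
have n0 : (0 < n)%N by apply: leq_ltn_trans cn.
pose P : {poly F} := \sum_(x in S) 'X^(f x).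
pose Q : {poly F} := \sum_(y in T) 'X^(g y).
pose W : {poly F} := \sum_(c < n) 'X^c.
pose B := P ^+ l.-1.
have chl : l \in [pchar {poly F}] by rewrite pchar_poly pchar_Fp.
have PlE : \sum_(x in S) 'X^(l * f x) = P * B.
  rewrite -exprS prednK ?prime_gt0 // -(pFrobenius_autE chl) rmorph_sum.
  by apply: eq_bigr => x _ /=; rewrite mulnC exprM.
have h1 : 'X^n - 1 %| P * Q - W.
  suff -> : W = \sum_(x in S) \sum_(y in T) 'X^((f x + g y) %% n) by apply: dvd_sum_residues.
  rewrite (sum_residue_count f g (fun k => 'X^k)) //.
  by apply: eq_bigr => k _; rewrite t // mul1r.
have h2 := dvd_sum_residues (fun x => l * f x)%N g.
(* Modulo ['X^n - 1], multiplication by ['X] fixes [W], so [B] acts on it through its value at 1. *)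
have h3 : 'X^n - 1 %| B * W - B.[1]%:P * W.
  have : root (B - B.[1]%:P) 1 by rewrite rootE !hornerE subrr.
  move/factor_theorem => [U UE]; rewrite -mulrBl UE -mulrA /W.
  have -> : ('X - 1%:P) * (\sum_(c < n) 'X^c) = 'X^n - 1 :> {poly F} by rewrite subrX1.
  exact: dvdp_mull.
set G := \sum_(x in S) \sum_(y in T) _ in h2.
have h4 : 'X^n - 1 %| G - B.[1]%:P * W.
  have -> : G - B.[1]%:P * W = B * (P * Q - W) + (B * W - B.[1]%:P * W) - (P * B * Q - G) by ring.
  by apply: dvdp_sub; [apply: dvdp_add => //; apply: dvdp_mull|rewrite -PlE].
have GE : G = \sum_(c < n) (residue_count (fun x => l * f x)%N g c)%:R * 'X^c.
  exact: (sum_residue_count _ g (fun k => 'X^k)).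
have ee : G - B.[1]%:P * W = \poly_(c < n)
    ((residue_count (fun x => l * f x)%N g c)%:R - B.[1]).
  rewrite GE /W mulr_sumr -sumrB poly_def; apply: eq_bigr => i _.
  by rewrite scalerBl -!mul_polyC polyCMn.
have z : G - B.[1]%:P * W = 0.
  apply: contraTeq h4 => nz; rewrite gtNdvdp // ee.
  by rewrite -['X^n - 1]/('X^n - 1%:P) size_XnsubC // ltnS size_poly.
(* Every count is [B.[1]] modulo [l], a power of [#|S|], hence not zero. *)
have := congr1 (fun A : {poly F} => A`_c) z; rewrite ee coef_poly cn coef0 => /eqP.
rewrite subr_eq0 lt0n => /eqP ec; apply/eqP => c0; move: ec; rewrite c0 => /esym/eqP.
rewrite mulr0n hornerE expf_eq0 horner_sum => /andP[_].
under eq_bigr do rewrite hornerXn expr1n.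
by rewrite sumr_const -(dvdn_pcharf (pchar_Fp hl)) (negPf lS).
Qed.
End Frobenius.
End Dilation.

Lemma gcdn_coprimeM m a b : coprime a b -> gcdn m (a * b) = gcdn m a * gcdn m b.
Proof.
move=> cab; apply/eqP; rewrite eqn_dvd; apply/andP; split.
  rewrite muln_gcdl !muln_gcdr !dvdn_gcd dvdn_gcdr andbT.
  by rewrite !(dvdn_mulr _ (dvdn_gcdl _ _)) (dvdn_mull _ (dvdn_gcdl _ _)).
rewrite dvdn_gcd dvdn_mul ?dvdn_gcdr // Gauss_dvd ?dvdn_gcdl //.
by apply: coprime_dvdl (dvdn_gcdr m a) _; apply: coprime_dvdr (dvdn_gcdr m b) cab.
Qed.

Lemma gcdn_prime m a : prime a -> gcdn m a = if a %| m then a else 1.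
Proof.
move=> pa; case: ifP => h; first exact/gcdn_idPr.
by apply/eqP; rewrite gcdnC -/(coprime a m) prime_coprime // h.
Qed.

Lemma gcdn_prime2 m a : prime a ->
  gcdn m (a ^ 2) = if a ^ 2 %| m then a ^ 2 else if a %| m then a else 1.
Proof.
move=> pa; case: ifP => h; first exact/gcdn_idPr.
have /(dvdn_pfactor _ _ pa)[k k2 e] := dvdn_gcdr m (a ^ 2).
have km : a ^ k %| m by rewrite -e dvdn_gcdl.
rewrite e; case: k k2 e km => [|[|[|//]]] _ e km.
- case: ifP => // am; have : a %| gcdn m (a ^ 2) by rewrite dvdn_gcd am dvdn_mulr.
  by rewrite e dvdn1 => /eqP.
- by rewrite expn1 in km *; rewrite km.
by rewrite km in h.
Qed.

(** * Spectral sets and tiles *)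

Section Fuglede.
Variables (p q r : nat).
Hypotheses (hp : prime p) (hq : prime q) (hr : prime r).
Hypotheses (hpq : p != q) (hpr : p != r) (hqr : q != r).
Local Notation n := (p ^ 2 * q * r)%N.

Let p0 : 0 < p. Proof. exact: prime_gt0. Qed.
Let q0 : 0 < q. Proof. exact: prime_gt0. Qed.
Let r0 : 0 < r. Proof. exact: prime_gt0. Qed.

Let cop_pq : coprime p q. Proof. by rewrite prime_coprime // dvdn_prime2. Qed.
Let cop_pr : coprime p r. Proof. by rewrite prime_coprime // dvdn_prime2. Qed.
Let cop_qr : coprime q r. Proof. by rewrite prime_coprime // dvdn_prime2. Qed.
Let cop_ppq : coprime (p ^ 2) q. Proof. by rewrite coprimeXl. Qed.
Let cop_ppr : coprime (p ^ 2) r. Proof. by rewrite coprimeXl. Qed.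
Let cop_ppqr : coprime (p ^ 2 * q) r. Proof. by rewrite coprimeMl cop_ppr. Qed.

Lemma n_gt1 : 1 < n.
Proof.
rewrite (leq_trans (prime_gt1 hr)) // leq_pmull // muln_gt0 expn_gt0 p0 /=.
exact: q0.
Qed.
Lemma n_gt0 : 0 < n. Proof. exact: ltnW n_gt1. Qed.

Lemma ltZ (x : 'Z_n) : x < n.
Proof. by rewrite -[X in _ < X](Zp_cast n_gt1) ltn_ord. Qed.

Definition mod_ord m (m0 : 0 < m) (x : nat) : 'I_m := Ordinal (ltn_pmod x m0).

Definition rI (x : 'Z_n) := mod_ord p0 x.
Definition rJ (x : 'Z_n) := mod_ord p0 (x %/ p).
Definition rB (x : 'Z_n) := mod_ord q0 x.
Definition rC (x : 'Z_n) := mod_ord r0 x.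

Lemma rI_eq x y : (rI x == rI y) = (x == y %[mod p]).
Proof. by rewrite -val_eqE. Qed.
Lemma rB_eq x y : (rB x == rB y) = (x == y %[mod q]).
Proof. by rewrite -val_eqE. Qed.
Lemma rC_eq x y : (rC x == rC y) = (x == y %[mod r]).
Proof. by rewrite -val_eqE. Qed.

Lemma mod_pp (x : nat) : x %% p ^ 2 = x %% p + p * ((x %/ p) %% p).
Proof.
rewrite modn_divl -mulnn [LHS](divn_eq _ p) addnC mulnC.
by rewrite modn_dvdm // dvdn_mulr.
Qed.

Lemma mod_pp_eq (x i j : nat) : i < p -> j < p ->
  (x %% p ^ 2 == i + p * j) = (x %% p == i) && ((x %/ p) %% p == j).
Proof.
move=> ip jp; rewrite mod_pp; apply/eqP/andP => [e|[/eqP-> /eqP->] //].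
have e1 := congr1 (modn^~ p) e; have e2 := congr1 (divn^~ p) e.
rewrite /= ![_ + p * _]addnC ![p * _]mulnC !modnMDl (modn_small (ltn_pmod x p0))
  (modn_small ip) in e1.
rewrite /= ![_ + p * _]addnC ![p * _]mulnC !divnMDl // (divn_small (ltn_pmod x p0))
  (divn_small ip) !addn0 in e2.
by rewrite e1 e2 !eqxx.
Qed.

Lemma rJ_eq x y : rI x == rI y -> (rJ x == rJ y) = (x == y %[mod p ^ 2]).
Proof.
rewrite rI_eq -val_eqE /= => /eqP e.
by rewrite !mod_pp e eqn_add2l eqn_pmul2l.
Qed.

Lemma residues_inj (x y : 'Z_n) :
  rI x = rI y -> rJ x = rJ y -> rB x = rB y -> rC x = rC y -> x = y.
Proof.
move=> /eqP eI /eqP eJ /eqP eB /eqP eC; rewrite rJ_eq // in eJ.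
rewrite rB_eq in eB; rewrite rC_eq in eC.
have : x == y %[mod n] by rewrite (chinese_remainder cop_ppqr) (chinese_remainder cop_ppq) eJ eB eC.
by rewrite !modn_small ?ltZ // => /eqP/val_inj.
Qed.

Definition Zcoords : coords :=
  @Coords 'Z_n 'I_p 'I_p 'I_q 'I_r rI rJ rB rC p q r residues_inj hp hq hr hpq hpr hqr
    (card_ord p) (card_ord p) (card_ord q) (card_ord r).

Local Notation has_type := (has_type rI rJ rB rC).
Local Notation D := (D rI rJ rB rC).
Local Notation Z := (Z rI rJ rB rC).
Local Notation spair := (spair rI rJ rB rC).

Lemma subZ_mod (x y : 'Z_n) : (x - y)%R = (x + (n - y)) %% n :> nat.
Proof.
have e (a b N : nat) : N = n -> (a + (N - b) %% N) %% N = (a + (n - b)) %% n.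
  by move=> ->; rewrite modnDmr.
by rewrite -(e x y _ (Zp_cast n_gt1)).
Qed.

Lemma dvd_subZ d (x y : 'Z_n) : d %| n -> (d %| (x - y)%R) = (x == y %[mod d]).
Proof.
move=> dn; rewrite subZ_mod /dvdn modn_dvdm //.
have -> : x + (n - y) = x + n - y by rewrite addnBA // ltnW // ltZ.
rewrite -/(dvdn d _) -eqn_mod_dvd; last by rewrite ltnW // ltn_addl // ltZ.
by have /eqP dn' := dn; rewrite -modnDmr dn' addn0.
Qed.

Definition order_type tp tq tr (m : nat) :=
  [&& p_type tp (p %| m) (p ^ 2 %| m), s_type tq (q %| m) & s_type tr (r %| m)].

Lemma dvd_pn : p %| n. Proof. by rewrite -!mulnA dvdn_mulr. Qed.
Lemma dvd_ppn : p ^ 2 %| n. Proof. by rewrite -mulnA dvdn_mulr. Qed.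
Lemma dvd_qn : q %| n. Proof. by rewrite dvdn_mulr ?dvdn_mull. Qed.
Lemma dvd_rn : r %| n. Proof. by rewrite dvdn_mull. Qed.

Lemma order_type_sub tp tq tr (x y : 'Z_n) :
  order_type tp tq tr (x - y)%R = has_type tp tq tr x y.
Proof.
rewrite /order_type has_typeE !dvd_subZ ?dvd_pn ?dvd_ppn ?dvd_qn ?dvd_rn //.
rewrite rB_eq rC_eq -rI_eq; congr (_ && _).
have [e|ne] := boolP (rI x == rI y); first by rewrite rJ_eq.
by case: tp => [|[|tp]].
Qed.

(** The gcd fixes the order of the [m]-th power of a primitive root, so indices of one type give
    conjugate roots. *)
Lemma order_type_gcd tp tq tr m m' : order_type tp tq tr m -> order_type tp tq tr m' ->
  gcdn m n = gcdn m' n.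
Proof.
have pp k : p ^ 2 %| k -> p %| k by apply: dvdn_trans; rewrite dvdn_mulr.
move=> /and3P[a1 a2 a3] /and3P[b1 b2 b3].
rewrite !(gcdn_coprimeM _ cop_ppqr) !(gcdn_coprimeM _ cop_ppq).
rewrite !(gcdn_prime _ hq) !(gcdn_prime _ hr) !(gcdn_prime2 _ hp).
have -> : (q %| m) = (q %| m').
  by case: tq a2 b2 => [|k] /=; [move=> -> ->|move=> /negPf-> /negPf->].
have -> : (r %| m) = (r %| m').
  by case: tr a3 b3 => [|k] /=; [move=> -> ->|move=> /negPf-> /negPf->].
congr (_ * _ * _); case: tp a1 b1 => [|[|k]] /=.
- by move=> /andP[-> ->] /andP[-> ->].
- by move=> /andP[-> /negPf->] /andP[-> /negPf->].
by move=> a b; rewrite (negPf a) (negPf b) (negPf (contra (@pp m) a)) (negPf (contra (@pp m') b)).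
Qed.

(** * Characters and fibre identities *)

Section Characters.
Variable R : realType.
Local Open Scope ring_scope.
Local Notation z := (zeta R n).

Lemma z_prim : n.-primitive_root z.
Proof. exact: zeta_prim n_gt0. Qed.

Lemma z_dvd k : (n %| k)%N -> z ^+ k = 1.
Proof. by rewrite (prim_order_dvd z_prim) => /eqP. Qed.

Definition E (S : {set 'Z_n}) (m : nat) := \sum_(x in S) z ^+ (m * x).

Lemma E_type S tp tq tr m m' : order_type tp tq tr m -> order_type tp tq tr m' ->
  E S m = 0 -> E S m' = 0.
Proof.
move=> tm tm'; have e := order_type_gcd tm tm'.
have zm := exp_prim_root z_prim m; have zm' := exp_prim_root z_prim m'.
rewrite -e in zm'; rewrite /E.
under eq_bigr do rewrite exprM; under [in X in _ -> X]eq_bigr do rewrite exprM.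
exact: sum_powers_conjugate zm zm'.
Qed.

(** Fourier inversion modulo [M], with [M - a] standing for the opposite of [a] in natural
    exponents. *)
Lemma sum_delta M a x : (M %| n)%N -> (a < M)%N ->
  \sum_(k < M) z ^+ (n %/ M * k * (x + (M - a))) = M%:R * (x %% M == a)%N%:R.
Proof.
move=> Mn aM; have M0 : (0 < M)%N by apply: leq_ltn_trans aM.
pose w := z ^+ (n %/ M * (x + (M - a))).
have -> : \sum_(k < M) z ^+ (n %/ M * k * (x + (M - a))) = \sum_(k < M) w ^+ k.
  by apply: eq_bigr => k _; rewrite /w -exprM; congr (_ ^+ _); lia.
have wE : (w == 1) = (x %% M == a)%N.
  rewrite /w -(prim_order_dvd z_prim) -{1}(divnK Mn) dvdn_pmul2l; last first.
    by rewrite divn_gt0 // dvdn_leq ?n_gt0.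
  rewrite addnBA; last exact: ltnW.
  rewrite -eqn_mod_dvd; last by rewrite ltnW // ltn_addl.
  by rewrite modnDr (modn_small aM).
have [e|ne] := boolP (x %% M == a)%N.
  have -> : w = 1 by apply/eqP; rewrite wE.
  by under eq_bigr do rewrite expr1n; rewrite sumr_const card_ord mulr1.
rewrite mulr0; apply: (mulfI (_ : w - 1 != 0)); first by rewrite subr_eq0 wE.
rewrite mulr0 -subrX1 /w -exprM z_dvd ?subrr //.
by rewrite -{1}(divnK Mn) dvdn_pmul2r // dvdn_mulr.
Qed.

Definition spans (P : pred nat) (f : nat -> R[i]) :=
  exists M (c : nat -> R[i]) (e : nat -> nat), (forall k, ~~ P (e k) -> c k = 0) /\
    forall x, f x = \sum_(k < M) c k * z ^+ (e k * x).

(** By hypothesis the two indicators have equal coefficients at every excluded frequency, so these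
    cancel. *)
Lemma spans_delta M a a' (P : pred nat) : (M %| n)%N -> (a < M)%N -> (a' < M)%N ->
  (forall k, ~~ P (n %/ M * k)%N ->
     z ^+ (n %/ M * k * (M - a)) = z ^+ (n %/ M * k * (M - a'))) ->
  spans P (fun x => (x %% M == a)%N%:R - (x %% M == a')%N%:R).
Proof.
move=> Mn aM aM' h; have M0 : M%:R != 0 :> R[i].
  by rewrite pnatr_eq0 -lt0n (leq_ltn_trans _ aM).
exists M, (fun k => M%:R^-1 * (z ^+ (n %/ M * k * (M - a)) - z ^+ (n %/ M * k * (M - a')))).
exists (fun k => (n %/ M * k)%N); split=> [k /h ->|x]; first by rewrite subrr mulr0.
apply: (mulfI M0); rewrite mulrBr -!sum_delta // -sumrB mulr_sumr.
apply: eq_bigr => k _; rewrite !mulrA divff // mul1r mulrBl -!exprD.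
by congr (_ ^+ _ - _ ^+ _); rewrite -mulnDr addnC.
Qed.

Lemma spans1 (P : pred nat) : P 0%N -> spans P (fun=> 1).
Proof.
move=> P0; exists 1%N, (fun=> 1), (fun=> 0%N); split=> [k|x]; first by rewrite P0.
by rewrite big_ord1 mul0n expr0 mulr1.
Qed.

Definition p_exp t e := [&& p_type t (p %| e) (p ^ 2 %| e), q %| e & r %| e]%N.
Definition q_exp t e := [&& p ^ 2 %| e, s_type t (q %| e) & r %| e]%N.
Definition r_exp t e := [&& p ^ 2 %| e, q %| e & s_type t (r %| e)]%N.

(** Each exponent is invisible to the prime powers governing the other two. *)
Lemma exp_type tp tq tr e1 e2 e3 : p_exp tp e1 -> q_exp tq e2 -> r_exp tr e3 ->
  order_type tp tq tr (e1 + e2 + e3).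
Proof.
have pp k : (p ^ 2 %| k -> p %| k)%N by apply: dvdn_trans; rewrite dvdn_mulr.
move=> /and3P[a1 a2 a3] /and3P[b1 b2 b3] /and3P[c1 c2 c3]; rewrite /order_type.
have -> : (p %| e1 + e2 + e3 = (p %| e1))%N
  by rewrite (dvdn_addl _ (pp _ c1)) (dvdn_addl _ (pp _ b1)).
have -> : (p ^ 2 %| e1 + e2 + e3 = (p ^ 2 %| e1))%N by rewrite (dvdn_addl _ c1) (dvdn_addl _ b1).
have -> : (q %| e1 + e2 + e3 = (q %| e2))%N by rewrite (dvdn_addl _ c2) (dvdn_addr _ a2).
have -> : (r %| e1 + e2 + e3 = (r %| e3))%N by rewrite (dvdn_addr _ (dvdn_add a3 b3)).
by rewrite a1 b2.
Qed.

Lemma sum_spans S tp tq tr (f g h : nat -> R[i]) :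
  (forall m, order_type tp tq tr m -> E S m = 0) ->
  spans (p_exp tp) f -> spans (q_exp tq) g -> spans (r_exp tr) h ->
  \sum_(x in S) f x * g x * h x = 0.
Proof.
move=> E0 [M1 [c1 [e1 [P1 f1]]]] [M2 [c2 [e2 [P2 f2]]]] [M3 [c3 [e3 [P3 f3]]]].
transitivity (\sum_(k1 < M1) \sum_(k2 < M2) \sum_(k3 < M3)
  c1 k1 * c2 k2 * c3 k3 * E S (e1 k1 + e2 k2 + e3 k3)).
  have pt x : f x * g x * h x = \sum_(k1 < M1) \sum_(k2 < M2) \sum_(k3 < M3)
      c1 k1 * c2 k2 * c3 k3 * z ^+ ((e1 k1 + e2 k2 + e3 k3) * x).
    rewrite f1 f2 f3 -mulrA mulr_suml; apply: eq_bigr => k1 _.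
    rewrite mulr_suml mulr_sumr; apply: eq_bigr => k2 _.
    rewrite !mulr_sumr; apply: eq_bigr => k3 _.
    by rewrite !mulnDl !exprD; ring.
  under eq_bigr do rewrite pt.
  rewrite exchange_big /=; apply: eq_bigr => k1 _.
  rewrite exchange_big /=; apply: eq_bigr => k2 _.
  rewrite exchange_big /=; apply: eq_bigr => k3 _.
  by rewrite /E mulr_sumr.
rewrite big1 // => k1 _; rewrite big1 // => k2 _; rewrite big1 // => k3 _.
have [h1|/P1->] := boolP (p_exp tp (e1 k1)); last by rewrite !mul0r.
have [h2|/P2->] := boolP (q_exp tq (e2 k2)); last by rewrite mulr0 !mul0r.
have [h3|/P3->] := boolP (r_exp tr (e3 k3)); last by rewrite mulr0 mul0r.
by rewrite E0 ?mulr0 // exp_type.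
Qed.

Lemma n_div_p : (n %/ p = p * q * r)%N.
Proof. by rewrite -!mulnA mulKn // !mulnA. Qed.
Lemma n_div_pp : (n %/ p ^ 2 = q * r)%N.
Proof. by rewrite -mulnA mulKn // expn_gt0 p0. Qed.
Lemma n_div_q : (n %/ q = p ^ 2 * r)%N.
Proof. by rewrite mulnAC mulnK. Qed.
Lemma n_div_r : (n %/ r = p ^ 2 * q)%N.
Proof. by rewrite mulnK. Qed.

Lemma cop_q_pr : coprime q (p ^ 2 * r).
Proof. by rewrite coprimeMr coprime_sym cop_ppq. Qed.
Lemma cop_r_pq : coprime r (p ^ 2 * q).
Proof. by rewrite coprime_sym. Qed.
Lemma cop_p_qr : coprime p (q * r).
Proof. by rewrite coprimeMr cop_pq. Qed.

Lemma n_dvd_div d k : (d %| n)%N -> (d %| k)%N -> (n %| n %/ d * k)%N.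
Proof. by move=> dn dk; rewrite -{1}(divnK dn) dvdn_mul. Qed.

Lemma spans_q t (b b' : 'I_q) :
  spans (q_exp t) (fun x => if t is 0%N then 1 else (x %% q == b)%N%:R - (x %% q == b')%N%:R).
Proof.
case: t => [|t]; first by apply: spans1; rewrite /q_exp /= !dvdn0.
apply: spans_delta => //; rewrite ?dvd_qn // => k nP.
suff h : (n %| n %/ q * k)%N by rewrite !z_dvd // dvdn_mulr.
apply: n_dvd_div; rewrite ?dvd_qn //.
apply: contraR nP => qk; rewrite /q_exp n_div_q; apply/and3P; split.
- by rewrite -mulnA dvdn_mulr.
- by rewrite /= (Gauss_dvdr _ cop_q_pr).
by rewrite dvdn_mulr // dvdn_mull.
Qed.

Lemma spans_r t (b b' : 'I_r) :
  spans (r_exp t) (fun x => if t is 0%N then 1 else (x %% r == b)%N%:R - (x %% r == b')%N%:R).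
Proof.
case: t => [|t]; first by apply: spans1; rewrite /r_exp /= !dvdn0.
apply: spans_delta => //; rewrite ?dvd_rn // => k nP.
suff h : (n %| n %/ r * k)%N by rewrite !z_dvd // dvdn_mulr.
apply: n_dvd_div; rewrite ?dvd_rn //.
apply: contraR nP => rk; rewrite /r_exp n_div_r; apply/and3P; split.
- by rewrite -mulnA dvdn_mulr.
- by rewrite dvdn_mulr // dvdn_mull.
by rewrite /= (Gauss_dvdr _ cop_r_pq).
Qed.

Lemma spans_p t (i i' j j' : 'I_p) : spans (p_exp t) (fun x => match t with
  | 0%N => 1
  | 1%N => (x %% p == i)%N%:R - (x %% p == i')%N%:R
  | _ => ((x %% p == i) && ((x %/ p) %% p == j))%N%:R
         - ((x %% p == i) && ((x %/ p) %% p == j'))%N%:R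
  end).
Proof.
case: t => [|[|t]]; first by apply: spans1; rewrite /p_exp /= !dvdn0.
  apply: spans_delta => //; rewrite ?dvd_pn // => k nP.
  suff h : (n %| n %/ p * k)%N by rewrite !z_dvd // dvdn_mulr.
  apply: n_dvd_div; rewrite ?dvd_pn //.
  apply: contraR nP => pk; rewrite /p_exp n_div_p; apply/and3P; split.
  - rewrite /= -!mulnA dvdn_mulr //= -mulnn dvdn_pmul2l // mulnA.
    by rewrite (Gauss_dvdr _ cop_p_qr).
  - by rewrite -!mulnA mulnCA dvdn_mulr.
  by rewrite dvdn_mulr // dvdn_mull.
have lt (j1 : 'I_p) : (i + p * j1 < p ^ 2)%N.
  rewrite -mulnn; apply: leq_trans (_ : p + p * j1 <= _)%N; first by rewrite ltn_add2r.
  by rewrite -mulnS leq_mul2l ltn_ord orbT.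
have [M [c [e [h1 h2]]]] : spans (p_exp t.+2)
  (fun x => (x %% p ^ 2 == i + p * j)%N%:R - (x %% p ^ 2 == i + p * j')%N%:R).
  apply: spans_delta => //; rewrite ?dvd_ppn // => k nP.
  have pk : (p %| k)%N.
    apply: contraR nP => pk; rewrite /p_exp n_div_pp; apply/and3P; split.
    - by rewrite /= (Gauss_dvdr _ cop_p_qr).
    - by rewrite -mulnA dvdn_mulr.
    by rewrite dvdn_mulr // dvdn_mull.
  (* For [p] dividing [k] the frequency reads the first digit only, which both residues share. *)
  have inv (j1 : 'I_p) : z ^+ (n %/ p ^ 2 * k * (p ^ 2 - (i + p * j1)))
      = (z ^+ (n %/ p ^ 2 * k * i))^-1.
    have u : z ^+ (n %/ p ^ 2 * k * i) \is a GRing.unit.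
      by rewrite unitfE expf_neq0 // (prim_root_eq0 z_prim) -lt0n n_gt0.
    apply: (mulIr u); rewrite mulVr // -exprD -mulnDr.
    have z0 : z ^+ (n %/ p ^ 2 * k * (p * j1)) = 1.
      apply: z_dvd; rewrite -(mulnA (n %/ p ^ 2)%N); apply: n_dvd_div; first exact: dvd_ppn.
      by rewrite -mulnn mulnA dvdn_mulr // dvdn_mul.
    have z1 : z ^+ (n %/ p ^ 2 * k * p ^ 2) = 1.
      apply: z_dvd; rewrite -(mulnA (n %/ p ^ 2)%N); apply: n_dvd_div; first exact: dvd_ppn.
      exact: dvdn_mull.
    have le : (i + p * j1 <= p ^ 2)%N by exact: ltnW.
    rewrite -[LHS]mulr1 -{1}z0 -exprD -mulnDr -addnA (subnK le); exact: z1.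
  by rewrite !inv.
exists M, c, e; split=> // x; rewrite -h2.
by rewrite !(mod_pp_eq _ (ltn_ord i)).
Qed.

Lemma E_Z S tp tq tr : (forall m, order_type tp tq tr m -> E S m = 0) -> Z S tp tq tr.
Proof.
move=> E0 i i' j j' b b' c c'; apply: (@intr_inj (R[i])).
have := sum_spans E0 (spans_p tp i i' j j') (spans_q tq b b') (spans_r tr c c').
rewrite rmorph0 => <-; rewrite rmorph_sum; apply: eq_bigr => x _ /=.
rewrite !rmorphM; congr (_ * _ * _).
- by case: tp {E0} => [|[|tp]] //=; rewrite rmorphB !rmorph_nat -!val_eqE.
- by case: tq {E0} => [|tq] //=; rewrite rmorphB !rmorph_nat -!val_eqE.
by case: tr {E0} => [|tr] //=; rewrite rmorphB !rmorph_nat -!val_eqE.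
Qed.

Lemma z_neq0 k : z ^+ k != 0.
Proof. by rewrite expf_neq0 // (prim_root_eq0 z_prim) -lt0n n_gt0. Qed.

Lemma z_conj k : conjc (z ^+ k) = (z ^+ k)^-1.
Proof.
apply: (mulfI (z_neq0 k)); rewrite divff ?z_neq0 //.
exact: zeta_conj n_gt0.
Qed.

Lemma z_sub (k l : 'Z_n) (x : nat) : z ^+ (k * x) * (z ^+ (l * x))^-1 = z ^+ ((k - l)%R * x).
Proof.
apply: (mulIf (z_neq0 (l * x))); rewrite mulfVK ?z_neq0 // -exprD -mulnDl.
have e : (((k - l)%R + l) %% n = k %% n)%N.
  by rewrite subZ_mod modnDml -addnA subnK ?(ltnW (ltZ _)) // modnDr.
by apply/eqP; rewrite (eq_prim_root_expr z_prim) -[X in X == _]modnMml -e modnMml.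
Qed.

Lemma orthogonal_E S k l :
  orthogonal_on (chi_on R S k) (chi_on R S l) <-> E S (k - l)%R = 0.
Proof.
suff -> : E S (k - l)%R = \sum_s (chi_on R S k s : R[i]) * conjc (chi_on R S l s) by [].
rewrite /E (big_sub (mem S) (fun x : 'Z_n => z ^+ ((k - l)%R * x))).
by apply: eq_bigr => x _; rewrite !ffunE !chiE z_conj z_sub.
Qed.

Definition orthogonal_set (S L : {set 'Z_n}) :=
  forall k l, k \in L -> l \in L -> k != l -> E S (k - l)%R = 0.

Lemma E0 S : E S 0 = #|S|%:R.
Proof.
by rewrite /E; under eq_bigr do rewrite mul0n expr0; rewrite sumr_const.
Qed.

Lemma free_orthogonal S L : S != set0 -> orthogonal_set S L ->
  free [seq chi_on R S k | k <- enum L].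
Proof.
move=> S0 oL; have sz : size [seq chi_on R S k | k <- enum L] == #|L|.
  by rewrite size_map -cardE.
rewrite -[X in free X]/(tval (Tuple sz)); apply/freeP => c c0 i.
pose l := nth 0 (enum L) i.
have iL (j : 'I_#|L|) : nth 0 (enum L) j \in L by rewrite -mem_enum mem_nth // -cardE.
have XE (j : 'I_#|L|) : (Tuple sz)`_j = chi_on R S (nth 0 (enum L) j).
  by rewrite (nth_map 0) // -cardE.
have : \sum_(s : {x | x \in S}) ((\sum_j c j *: (Tuple sz)`_j) s : R[i]) *
    conjc (chi_on R S l s) = 0.
  by rewrite c0; apply: big1 => s _; rewrite ffunE mul0r.
have -> : \sum_(s : {x | x \in S}) ((\sum_j c j *: (Tuple sz)`_j) s : R[i]) *
    conjc (chi_on R S l s) = \sum_j c j * E S (nth 0 (enum L) j - l)%R.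
  under eq_bigr do rewrite sum_ffunE mulr_suml.
  rewrite exchange_big /=; apply: eq_bigr => j _.
  rewrite /E (big_sub (mem S) (fun x : 'Z_n => z ^+ ((nth 0 (enum L) j - l)%R * x))) mulr_sumr.
  by apply: eq_bigr => s _; rewrite XE !ffunE !chiE z_conj -z_sub mulrA.
rewrite (bigD1 i) // big1 => [|j ji].
  rewrite Monoid.mulm1 /l subrr E0 => /eqP; rewrite mulf_eq0 pnatr_eq0 cards_eq0 (negPf S0) orbF.
  by move/eqP.
rewrite oL ?mulr0 ?iL //; apply: contra ji => /eqP/(congr1 (index^~ (enum L))).
by rewrite !index_uniq -?cardE ?enum_uniq // => /val_inj ->.
Qed.

Lemma dim_funs_on (S : {set 'Z_n}) : \dim {: funs_on R S} = #|S|.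
Proof. by rewrite dimvf /dim /= muln1 card_sig. Qed.

(** Orthogonal restrictions are free, so spanning amounts to having as many of them as the
    dimension. *)
Lemma spectralP S : S != set0 ->
  spectral R S <-> exists L, orthogonal_set S L /\ #|L| = #|S|.
Proof.
move=> S0; split=> -[L [oL cL]]; exists L.
  have oS : orthogonal_set S L by move=> k l kL lL kl; apply/orthogonal_E/oL.
  split=> //; have /eqP := free_orthogonal S0 oS.
  by rewrite cL dim_funs_on size_map -cardE.
split=> [k l kL lL kl|]; first by apply/orthogonal_E/oL.
apply/eqP; rewrite eqEdim subvf /= dim_funs_on.
by have /eqP -> := free_orthogonal S0 oL; rewrite size_map -cardE cL.
Qed.

(** A one-sided inverse of a square matrix is two-sided: orthogonality of rows passes to columns. *)
Lemma dual_orthogonal (S L : {set 'Z_n}) : #|L| = #|S| -> orthogonal_set S L -> orthogonal_set L S.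
Proof.
move=> cL oL s t sS tS st; pose N := #|S|.
have N0 : N%:R != 0 :> R[i] by rewrite pnatr_eq0 cards_eq0; apply/set0Pn; exists s.
pose fS (i : 'I_N) := nth 0 (enum S) i; pose fL (i : 'I_N) := nth 0 (enum L) i.
have sumS (F : 'Z_n -> R[i]) : \sum_(x in S) F x = \sum_(i < N) F (fS i).
  by rewrite -big_enum (big_nth 0) big_mkord -cardE.
have sumL (F : 'Z_n -> R[i]) : \sum_(x in L) F x = \sum_(i < N) F (fL i).
  by rewrite -big_enum (big_nth 0) big_mkord -cardE cL.
have fLL i : fL i \in L by rewrite -mem_enum mem_nth // -cardE cL.
have fL_inj i j : (fL i == fL j) = (i == j).
  by rewrite nth_uniq ?enum_uniq // -cardE cL.
pose A := \matrix_(i < N, j < N) (z ^+ (fL i * fS j)).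
pose B := \matrix_(j < N, i < N) ((z ^+ (fL i * fS j))^-1).
have AB : A *m B = N%:R%:M.
  apply/matrixP => i j; rewrite !mxE.
  under eq_bigr do rewrite !mxE z_sub.
  rewrite -(sumS (fun x => z ^+ ((fL i - fL j)%R * x))) -/(E S _).
  have [->|ij] := eqVneq i j; first by rewrite subrr E0 mulr1n.
  by rewrite mulr0n oL // fL_inj.
have BA : B *m A = N%:R%:M.
  have : (N%:R^-1 *: A) *m B = 1%:M by rewrite -scalemxAl AB scale_scalar_mx mulVf.
  move/mulmx1C; rewrite -scalemxAr => h.
  by rewrite -[LHS](scalerKV N0) h scale_scalar_mx mulr1.
have ex x : x \in S -> exists i, fS i = x.
  move=> xS; have ix : (index x (enum S) < N)%N by rewrite /N cardE index_mem mem_enum.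
  by exists (Ordinal ix); rewrite /fS nth_index // mem_enum.
have [i ii] := ex s sS; have [j jj] := ex t tS.
have := congr1 (fun M : 'M_N => M j i) BA; rewrite !mxE.
under eq_bigr do rewrite !mxE mulrC ii jj ![(fL _ * _)%N]mulnC z_sub.
have ji : j == i = false by apply: contraNF st => /eqP e; rewrite -ii -jj e.
rewrite ji mulr0n => h; rewrite /E sumL -[RHS]h. by apply: eq_bigr.
Qed.

Lemma spair_orthogonal (S L : {set 'Z_n}) : #|L| = #|S| -> orthogonal_set S L ->
  spair S L.
Proof.
move=> cL oL; have oS := dual_orthogonal cL oL.
have main (A B : {set 'Z_n}) tp tq tr : orthogonal_set A B -> nontriv tp tq tr ->
    D B tp tq tr -> Z A tp tq tr.
  move=> oAB nt /DP[x [y [xB yB xy]]].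
  have ne : x != y.
    apply: contraL xy => /eqP->; rewrite has_typeE !eqxx.
    by move: nt; rewrite /nontriv; case: tp => [|[|?]]; case: tq => [|?]; case: tr.
  rewrite -order_type_sub in xy; apply: E_Z => m tm.
  by apply: (E_type xy tm); apply: oAB.
by split=> // tp tq tr; apply: main.
Qed.

(** * Boxes in the cyclic group *)

Definition boxZ (ai aj ab ac : bool) : {set 'Z_n} :=
  [set x | [&& ai || (rI x == rI 0), aj || (rJ x == rJ 0),
               ab || (rB x == rB 0) & ac || (rC x == rC 0)]].

Definition coordsZ (x : 'Z_n) := ((rI x, rJ x), (rB x, rC x)).

Lemma coordsZ_bij : bijective coordsZ.
Proof.
apply: inj_card_bij => [x y [e1 e2 e3 e4]|]; first by apply: residues_inj; apply: val_inj.
by rewrite !card_prod !card_ord mulnn mulnA [X in (_ <= X)%N](Zp_cast n_gt1).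
Qed.

Lemma card_boxZ ai aj ab ac :
  #|boxZ ai aj ab ac| = (p ^ (ai + aj) * q ^ ab * r ^ ac)%N.
Proof.
pose A (T : finType) (t : T) (a : bool) := if a then setT else [set t].
have cA (T : finType) (t : T) a : #|A T t a| = (#|T| ^ a)%N.
  by case: a; rewrite /A ?cards1 ?cardsT ?expn1.
have -> : boxZ ai aj ab ac = coordsZ @^-1:
    setX (setX (A _ (rI 0) ai) (A _ (rJ 0) aj)) (setX (A _ (rB 0) ab) (A _ (rC 0) ac)).
  apply/setP => x; rewrite !inE /A /=.
  by case: ai; case: aj; case: ab; case: ac; rewrite !inE ?andbT -?andbA.
rewrite on_card_preimset; last by apply: onW_bij; apply: coordsZ_bij.
by rewrite !cardsX !cA !card_ord expnD !mulnA.
Qed.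

(** The right side sees only [x - y], which lets [compat] pass from differences in the box to
    differences in [S]. *)
Lemma compat_dvd ai aj ab ac (x y : 'Z_n) :
  compat (K := Zcoords) ai aj ab ac x y =
  [&& ai || (p %| (x - y)%R), [|| aj, ~~ (p %| (x - y)%R) | p ^ 2 %| (x - y)%R],
      ab || (q %| (x - y)%R) & ac || (r %| (x - y)%R)]%N.
Proof.
rewrite !dvd_subZ ?dvd_pn ?dvd_ppn ?dvd_qn ?dvd_rn // /compat /= rB_eq rC_eq -rI_eq.
by have [e|ne] := boolP (rI x == rI y); [rewrite rJ_eq|rewrite !orbT].
Qed.

Lemma compat_sub ai aj ab ac (x y x' y' : 'Z_n) : (x - y = x' - y')%R ->
  compat (K := Zcoords) ai aj ab ac x y = compat (K := Zcoords) ai aj ab ac x' y'.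
Proof. by move=> e; rewrite !compat_dvd e. Qed.

Lemma compat_boxZ ai aj ab ac x y : x \in boxZ ai aj ab ac -> y \in boxZ ai aj ab ac ->
  compat (K := Zcoords) ai aj ab ac x y.
Proof.
rewrite !inE => /and4P[h1 h2 h3 h4] /and4P[k1 k2 k3 k4]; apply/and4P; split => /=.
- by case: ai h1 k1 => //= /eqP-> /eqP->.
- by case: aj h2 k2 => //= /eqP-> /eqP->; rewrite eqxx orbT.
- by case: ab h3 k3 => //= /eqP-> /eqP->.
by case: ac h4 k4 => //= /eqP-> /eqP->.
Qed.

Lemma card_Z : #|{: 'Z_n}| = n.
Proof. by rewrite card_ord (Zp_cast n_gt1). Qed.

Lemma sumset_full (S T : {set 'Z_n}) :
  (forall s s' t t', s \in S -> s' \in S -> t \in T -> t' \in T ->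
     (s + t = s' + t')%R -> s = s' /\ t = t') ->
  (#|S| * #|T|)%N = n -> [set s + t | s in S, t in T]%R = [set: 'Z_n].
Proof.
move=> inj c; apply/eqP; rewrite eqEcard subsetT /= cardsT card_Z.
suff e : #|[set s + t | s in S, t in T]%R| = n by rewrite e.
rewrite curry_imset2X card_in_imset ?cardsX ?c // => -[s t] [s' t'].
by rewrite !inE /= => /andP[sS tT] /andP[sS' tT'] e; have [-> ->] := inj _ _ _ _ sS sS' tT tT' e.
Qed.

Lemma box_tile_tile (S : {set 'Z_n}) : box_tile (K := Zcoords) S -> tile S.
Proof.
move=> [ai [aj [ab [ac [pS c]]]]]; exists (boxZ ai aj ab ac).
have c' : (#|S| * #|boxZ ai aj ab ac|)%N = n by rewrite card_boxZ -[RHS]c.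
split=> //; apply: sumset_full c' => s s' t t' sS sS' tT tT' e.
have e' : (s - s' = t' - t)%R.
  by apply/eqP; rewrite subr_eq addrAC -[t' + s']addrC -e addrK.
have es : s = s' by apply: pS; rewrite ?(compat_sub _ _ _ _ e') ?compat_boxZ.
by split=> //; move: e; rewrite es => /addrI.
Qed.

Lemma spectral_tile (S : {set 'Z_n}) : S != set0 -> spectral R S -> tile S.
Proof.
move=> S0 /(spectralP S0)[L [oL cL]]; apply: box_tile_tile.
exact: (@spair_box_tile Zcoords S L (spair_orthogonal cL oL) S0).
Qed.

(** * From tiles to spectra *)

Implicit Types S T : {set 'Z_n}.

Definition tiles (S T : {set 'Z_n}) (m m' : nat) :=
  residue_tiling S T n (fun x : 'Z_n => m * x)%N (fun y : 'Z_n => m' * y)%N.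

Lemma residue_countC (X Y : finType) (S : {set X}) (T : {set Y}) N f g c :
  residue_count S T N f g c = residue_count T S N g f c.
Proof.
rewrite /residue_count exchange_big /=; apply: eq_bigr => y _; apply: eq_bigr => x _.
by rewrite addnC.
Qed.

Lemma tilesC S T m m' : tiles S T m m' -> tiles T S m' m.
Proof. by move=> t c cn; rewrite residue_countC t. Qed.

Lemma tiles_dilate S T m m' l : prime l -> ~~ (l %| #|S|)%N -> (#|S| * #|T|)%N = n ->
  tiles S T m m' -> tiles S T (l * m) m'.
Proof.
move=> pl lS ST /(residue_tiling_dilate pl ST lS) t c /t h; rewrite -[RHS]h.
by apply: eq_bigr => x _; apply: eq_bigr => y _; rewrite mulnA.
Qed.

Lemma addZ_mod (x y : 'Z_n) : (x + y)%R = ((x + y) %% n)%N :> nat.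
Proof.
have e (a N : nat) : N = n -> (a %% N)%N = (a %% n)%N by move=> ->.
exact: (e _ _ (Zp_cast n_gt1)).
Qed.

Lemma tiles_sumset (S T : {set 'Z_n}) : [set s + t | s in S, t in T]%R = [set: 'Z_n] ->
  (#|S| * #|T|)%N = n -> tiles S T 1 1.
Proof.
move=> ST c; apply: residue_tiling_ge => // k kn; rewrite lt0n.
have kZ : (k < (Zp_trunc n).+2)%N by move: kn; rewrite -{1}(Zp_cast n_gt1).
have : Ordinal kZ \in [set s + t | s in S, t in T]%R by rewrite ST inE.
case/imset2P => s t sS tT /(congr1 val) /= e.
apply/eqP => /eqP; rewrite sum_nat_eq0 => /forallP/(_ s); rewrite sS sum_nat_eq0.
by move=> /forallP/(_ t); rewrite tT !mul1n -addZ_mod {1}e eqxx.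
Qed.

Lemma tiles_E S T m m' k : tiles S T m m' -> ~~ (n %| k)%N ->
  E S (m * k) * E T (m' * k) = 0.
Proof.
move=> t nk; rewrite /E mulr_suml.
transitivity (\sum_(x in S) \sum_(y in T) z ^+ (k * ((m * x + m' * y) %% n))).
  apply: eq_bigr => x _; rewrite mulr_sumr; apply: eq_bigr => y _.
  rewrite -exprD; apply/eqP; rewrite (eq_prim_root_expr z_prim) modnMmr.
  by apply/eqP; congr (_ %% n)%N; ring.
rewrite (sum_residue_count S T _ _ (fun c => z ^+ (k * c)) n_gt0).
have zk : z ^+ k - 1 != 0 by rewrite subr_eq0 -(prim_order_dvd z_prim).
apply: (mulfI zk); rewrite mulr0.
under eq_bigr => c _ do rewrite t // mul1r exprM.
by rewrite -subrX1 -exprM z_dvd ?subrr // dvdn_mull.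
Qed.

Lemma dvd_type0 e : order_type 0 0 0 e -> (n %| e)%N.
Proof.
by move=> /and3P[/= /andP[_ a] b c]; rewrite (Gauss_dvd _ cop_ppqr) (Gauss_dvd _ cop_ppq) a b.
Qed.

Lemma E_type0 (T : {set 'Z_n}) e : T != set0 -> order_type 0 0 0 e -> E T e != 0.
Proof.
move=> T0 /dvd_type0 ne; rewrite /E.
under eq_bigr => x _ do rewrite z_dvd ?dvdn_mulr //.
by rewrite sumr_const pnatr_eq0 cards_eq0.
Qed.

Lemma E0_Z S tp tq tr e : order_type tp tq tr e -> E S e = 0 -> Z S tp tq tr.
Proof. by move=> te Se; apply: E_Z => m tm; apply: (E_type te tm). Qed.

Lemma E_type_dvd S t e : order_type t.+1 0 0 e -> ~~ (p %| #|S|)%N -> E S e != 0.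
Proof.
move=> te; apply: contra => /eqP /(E0_Z te).
by case: t {te} => [|t]; [apply: (@Z100_dvd Zcoords)|apply: (@Z200_dvd Zcoords)].
Qed.

(** With [codil], this sends the dilation by [l] to a factor of the tiling whose size [l] does not
    divide. *)
Definition dil (l s : nat) := if (l %| s)%N then 1%N else l.
Definition codil (l s : nat) := if (l %| s)%N then l else 1%N.

Lemma dil_coprime a l s : coprime a l -> coprime a (dil l s).
Proof. by rewrite /dil; case: ifP => // _ _; apply: coprimen1. Qed.

Lemma codil_coprime a l s : coprime a l -> coprime a (codil l s).
Proof. by rewrite /codil; case: ifP => // _ _; apply: coprimen1. Qed.

Lemma dvd_dil l s m d : coprime l m -> (l %| s)%N || (l %| d)%N ->
  (l %| dil l s * m * d)%N = (l %| d)%N.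
Proof.
rewrite /dil; case: ifP => /= _ lm ld; first by rewrite mul1n Gauss_dvdr.
by rewrite ld -mulnA dvdn_mulr.
Qed.

Lemma dvd_codil l s m d : (l %| s)%N || (l %| d)%N -> (l %| codil l s * m * d)%N.
Proof.
rewrite /codil; case: ifP => /= _ ld; last exact: dvdn_mull.
by rewrite -mulnA dvdn_mulr.
Qed.

Lemma tiles_dil S T : (#|S| * #|T|)%N = n -> tiles S T 1 1 ->
  tiles S T (dil q #|S| * dil r #|S|) (codil q #|S| * codil r #|S|).
Proof.
move=> ST t; have TS : (#|T| * #|S|)%N = n by rewrite mulnC.
have step l m m' : prime l -> ~~ (l ^ 2 %| n)%N -> tiles S T m m' ->
    tiles S T (dil l #|S| * m) (codil l #|S| * m').
  move=> pl ln tt; rewrite /dil /codil; case: ifP => lS; rewrite mul1n.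
    apply: tilesC; apply: (tiles_dilate pl _ TS (tilesC tt)).
    by apply: contra ln => lT; rewrite -ST -mulnn dvdn_mul.
  by apply: (tiles_dilate pl _ ST tt); rewrite lS.
have nq : ~~ (q ^ 2 %| n)%N.
  rewrite -mulnn mulnAC dvdn_pmul2r // -prime_coprime //; exact: cop_q_pr.
have nr : ~~ (r ^ 2 %| n)%N.
  rewrite -mulnn dvdn_pmul2r // -prime_coprime //; exact: cop_r_pq.
have := step _ _ _ hq nq (step _ _ _ hr nr t); by rewrite !muln1.
Qed.

(* The dilated tiling makes E S (m * d) * E T (m' * d) vanish; m' * d keeps only the
   p-part of the order of d, and m * d keeps all of it. *)
Lemma E_tile_vanish (S T : {set 'Z_n}) tp tq tr d : (#|S| * #|T|)%N = n -> tiles S T 1 1 ->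
  order_type tp tq tr d -> ~~ (n %| d)%N ->
  (q %| #|S|)%N || (q %| d)%N -> (r %| #|S|)%N || (r %| d)%N ->
  (forall e, order_type tp 0 0 e -> E T e != 0) -> E S d = 0.
Proof.
move=> ST t td nd hqd hrd hT; pose s := #|S|.
have qr : coprime r q by rewrite coprime_sym.
have /eqP := tiles_E (tiles_dil ST t) nd; rewrite mulf_eq0 => /orP[/eqP Ed|/eqP Ed].
  have cp : coprime p (dil q s * dil r s) by rewrite coprimeMr !dil_coprime.
  have cpp : coprime (p ^ 2) (dil q s * dil r s) by rewrite coprimeXl.
  apply: (E_type _ td Ed); move: td => /and3P[a b c]; apply/and3P.
  rewrite (Gauss_dvdr _ cp) (Gauss_dvdr _ cpp) dvd_dil ?dil_coprime //.
  by rewrite [(dil q s * _)%N]mulnC dvd_dil ?dil_coprime.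
suff /hT : order_type tp 0 0 (codil q s * codil r s * d) by rewrite Ed eqxx.
have cp : coprime p (codil q s * codil r s) by rewrite coprimeMr !codil_coprime.
have cpp : coprime (p ^ 2) (codil q s * codil r s) by rewrite coprimeXl.
move: td => /and3P[a _ _]; apply/and3P; rewrite (Gauss_dvdr _ cp) (Gauss_dvdr _ cpp).
by split=> //; [|rewrite [(codil q s * _)%N]mulnC]; apply: dvd_codil.
Qed.

Lemma order_typeP d : exists tp tq tr, [/\ order_type tp tq tr d, (tp < 3)%N &
  ((p %| d)%N -> tp < 2)%N /\ ((p ^ 2 %| d)%N -> tp = 0%N)].
Proof.
exists (if (p ^ 2 %| d)%N then 0 else if (p %| d)%N then 1 else 2)%N.
exists (~~ (q %| d))%N, (~~ (r %| d))%N; split=> //; last 2 first.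
- by case: ifP => // _; case: ifP.
- by split=> ->; [case: ifP|].
have pp : (p ^ 2 %| d -> p %| d)%N by apply: dvdn_trans; rewrite dvdn_mulr.
apply/and3P; split; try by case: (_ %| d)%N.
by case: ifP => [h|h]; [rewrite /= (pp h)|case: ifP => g; rewrite /= ?g ?h].
Qed.

(** The spectrum is a box of size [#|S|] whose free digits modulo [p] correspond to orders at which
    the transform of [T] does not vanish. *)
Lemma tile_spectral (S : {set 'Z_n}) : S != set0 -> tile S -> spectral R S.
Proof.
move=> S0 [T [full ST]]; apply/(spectralP S0).
have t := tiles_sumset full ST.
have T0 : T != set0.
  by apply: contraTneq n_gt0 => e; rewrite -ST e cards0 muln0.
pose s := #|S|.
have sE : s = (gcdn s (p ^ 2) * q ^ (q %| s) * r ^ (r %| s))%N.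
  have sn : (s %| n)%N by rewrite -ST dvdn_mulr.
  rewrite -[LHS](gcdn_idPl sn) (gcdn_coprimeM _ cop_ppqr) (gcdn_coprimeM _ cop_ppq).
  rewrite (gcdn_prime _ hq) (gcdn_prime _ hr).
  by congr (_ * _ * _)%N; case: (_ %| _)%N; rewrite ?expn1.
have p3 : ~~ (p ^ 3 %| n)%N.
  rewrite -mulnA (expnSr p 2) dvdn_pmul2l ?expn_gt0 ?p0 //.
  rewrite -prime_coprime //; exact: cop_p_qr.
have main (ai aj : bool) : gcdn s (p ^ 2) = (p ^ (ai + aj))%N ->
    (ai -> forall e, order_type 2 0 0 e -> E T e != 0) ->
    (aj -> forall e, order_type 1 0 0 e -> E T e != 0) ->
    exists L, orthogonal_set S L /\ #|L| = #|S|.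
  move=> sp hi hj; exists (boxZ ai aj (q %| s)%N (r %| s)%N).
  split; last by rewrite card_boxZ -sp -sE.
  move=> k l kL lL kl; have := compat_boxZ kL lL; rewrite compat_dvd.
  have nd : ~~ (n %| (k - l)%R)%N.
    apply: contra kl => nd; rewrite -subr_eq0; apply/eqP/val_inj.
    have [//|/dvdn_leq/(_ nd) le] := posnP ((k - l)%R : nat).
    by have := ltZ (k - l)%R; rewrite ltnNge le.
  set d : nat := (k - l)%R in nd *.
  case/and4P => c1 c2 c3 c4; have [tp [tq [tr [td tp3 [tp1 tp2]]]]] := order_typeP d.
  apply: (E_tile_vanish ST t td nd c3 c4) => e.
  case: tp tp3 tp1 tp2 td => [|[|[|//]]] _ tp1 tp2 td.
  - exact: E_type0.
  - case/or3P: c2 => [/hj|np|/tp2 //]; first by apply.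
    by move: td => /and3P[/andP[]]; rewrite (negPf np).
  by case/orP: c1 => [/hi|/tp1 //]; apply.
have gE := gcdn_prime2 s hp.
have [p2|p2] := boolP (p ^ 2 %| s)%N.
  have pT : ~~ (p %| #|T|)%N.
    by apply: contra p3 => pT; rewrite -ST (expnSr p 2) dvdn_mul.
  by apply: (main true true) => [|_ e /E_type_dvd|_ e /E_type_dvd]; [rewrite gE p2|exact|exact].
rewrite (negPf p2) in gE.
have [p1|p1] := boolP (p %| s)%N; last first.
  by apply: (main false false); rewrite // gE (negPf p1).
rewrite p1 in gE.
have p2T : ~~ (p ^ 2 %| #|T|)%N.
  by apply: contra p3 => pT; rewrite -ST (expnS p 2) dvdn_mul.
have type1 : order_type 1 0 0 (p * q * r).
  apply/and3P; split=> /=.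
  - rewrite -mulnA dvdn_mulr //= -mulnn dvdn_pmul2l // -prime_coprime //; exact: cop_p_qr.
  - by rewrite dvdn_mulr // dvdn_mull.
  by rewrite dvdn_mull.
(* The index [p * q * r] represents order [p]. [T] cannot vanish at both orders [p] and [p ^ 2],
   since [p ^ 2] does not divide its size. *)
have [E1|E1] := eqVneq (E T (p * q * r)) 0.
  apply: (main true false) => // _ e te; apply: contra p2T => /eqP/(E0_Z te) Z2.
  exact: (@Z12_dvd Zcoords _ (E0_Z type1 E1) Z2).
by apply: (main false true) => // _ e te; apply: contra E1 => /eqP/(E_type te type1)->.
Qed.

End Characters.
End Fuglede.

Theorem mainTheorem2 (R : realType) (p q r : nat) (S : {set 'Z_(p ^ 2 * q * r)})
    (hp : prime p) (hq : prime q) (hr : prime r)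
    (hpq : p != q) (hpr : p != r) (hqr : q != r) (hS : S != set0) :
  spectral R S <-> tile S.
Proof. by split; [apply: spectral_tile|apply: tile_spectral]. Qed.
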